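(* Let $n\ge3$, $1\le j\le n-1$, and let $P$ and $Q$ be origin-symmetric convex bodies with non-empty interior in $\mathbb{R}^n$ such that $P$ is the $j$-projection body of $Q$. Then $$S_j(P,\mathbb{S}^{n-1}\cap E)=\frac{\kappa_{n-j}}{\kappa_j}\,S_{n-j}(Q,\mathbb{S}^{n-1}\cap E^\perp)\qquad\text{for every } E\in\mathrm{Gr}_{n-j,n}.$$ Moreover, if $P$ is a polytope, then $Q$ is a polytope, and for every $F\in\mathrm{Gr}_{j,n}$, $P$ has a $j$-dimensional face whose affine hull is parallel to $F$ if and only if $Q$ has an $(n-j)$-dimensional face whose affine hull is parallel to $F^\perp$.
   Context: $K$ is called the $j$-projection body of $L$ if $\mathrm{vol}_j(K|E^\perp)=\mathrm{vol}_{n-j}(L|E)$ for every $E\in\mathrm{Gr}_{n-j,n}$, the Grassmannian of $(n-j)$-dimensional linear subspaces ($K|E$ orthogonal projection). $\kappa_m$ is the volume of the $m$-dimensional unit ball. $S_i(K,\cdot)$ is the area measure of order $i$, defined by $S_{n-1}(K+rB,\cdot)=\sum_{i=0}^{n-1}r^{n-1-i}\binom{n-1}{i}S_i(K,\cdot)$ for $r\ge0$, with $S_{n-1}$ the surface area measure and $B$ the unit ball. *)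

(* Defs.v *)
From HB Require Import structures.
From mathcomp Require Import all_boot all_order all_algebra.
From mathcomp Require Import all_classical all_reals all_analysis.
Set Implicit Arguments. Unset Strict Implicit. Unset Printing Implicit Defensive.
Import Order.TTheory GRing.Theory Num.Theory.
Import numFieldNormedType.Exports.
Local Open Scope classical_set_scope.
Local Open Scope ring_scope.

Section Convex.
Variable R : realType.

Definition dotv (n : nat) (x y : 'rV[R]_n) : R := (x *m y^T) 0 0.
Definition enorm (n : nat) (x : 'rV[R]_n) : R := Num.sqrt (dotv x x).

(** n-dimensional Lebesgue integral of a nonnegative function on 'rV_n,
    as iterated one-dimensional Lebesgue integrals (Tonelli). *)
Fixpoint ninteg (n : nat) : ('rV[R]_n -> \bar R) -> \bar R :=
  match n with
  | 0 => fun f => f 0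
  | m.+1 => fun f =>
      (\int[@lebesgue_measure R]_(x in [set: R])
          ninteg (fun v : 'rV[R]_m => f (row_mx (\row_(_ < 1) x) v)))%E
  end.

Definition voln (n : nat) (A : set 'rV[R]_n) : \bar R :=
  ninteg (fun x => (\1_A x)%:E).

Definition kappa (m : nat) : R := fine (voln [set x : 'rV[R]_m | enorm x <= 1]).

Definition convex_set (n : nat) (K : set 'rV[R]_n) : Prop :=
  forall x y t, K x -> K y -> 0 <= t <= 1 -> K (t *: x + (1 - t) *: y).

Definition convex_body (n : nat) (K : set 'rV[R]_n) : Prop :=
  compact K /\ convex_set K /\ K !=set0.

Definition origin_symmetric (n : nat) (K : set 'rV[R]_n) : Prop :=
  forall x, K x -> K (- x).

Definition polytope (n : nat) (K : set 'rV[R]_n) : Prop :=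
  exists (k : nat) (p : 'I_k -> 'rV[R]_n),
    K = [set x | exists l : 'I_k -> R, (forall i, 0 <= l i) /\
                  \sum_(i < k) l i = 1 /\ x = \sum_(i < k) l i *: p i].

(** Linear subspaces of R^n are represented by square matrices (row spaces).
    E^perp := row space of kermx E^T = {u | u *m E^T = 0}. *)
Definition perp (n : nat) (E : 'M[R]_n) : 'M[R]_n := kermx E^T.

Definition subsp (n : nat) (E : 'M[R]_n) : set 'rV[R]_n := [set x | (x <= E)%MS].

Definition proj (n : nat) (K : set 'rV[R]_n) (E : 'M[R]_n) : set 'rV[R]_n :=
  [set y | (y <= E)%MS /\ exists x, K x /\ (x - y) *m E^T = 0].

Definition orthonormal (k n : nat) (U : 'M[R]_(k, n)) : Prop := U *m U^T = 1%:M.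

(** k-dimensional volume of a set A contained in a k-dimensional subspace F,
    computed in the orthonormal coordinates given by U (row space of U = F).
    The value does not depend on the choice of U. *)
Definition volk (k n : nat) (U : 'M[R]_(k, n)) (A : set 'rV[R]_n) : \bar R :=
  voln [set z : 'rV[R]_k | A (z *m U)].

Definition jprojection_body (n j : nat) (K L : set 'rV[R]_n) : Prop :=
  forall E : 'M[R]_n, \rank E = (n - j)%N ->
  forall (U : 'M[R]_(j, n)) (W : 'M[R]_(n - j, n)),
    orthonormal U -> (U == perp E)%MS ->
    orthonormal W -> (W == E)%MS ->
    volk U (proj K (perp E)) = volk W (proj L E).

Definition sphere (n : nat) : set 'rV[R]_n := [set u | enorm u = 1].

Definition parallel_body (n : nat) (K : set 'rV[R]_n) (r : R) : set 'rV[R]_n :=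
  [set z | exists x b, K x /\ enorm b <= 1 /\ z = x + r *: b].

Definition local_parallel (n : nat) (K : set 'rV[R]_n) (e : R) (w : set 'rV[R]_n)
  : set 'rV[R]_n :=
  [set x | exists p, K p /\ (forall y, K y -> enorm (x - p) <= enorm (x - y)) /\
     0 < enorm (x - p) <= e /\ w ((enorm (x - p))^-1 *: (x - p))].

(** surface area measure S_{n-1}(K, w) = s (as the derivative at 0 of
    the volume of local parallel sets). *)
Definition surface_area_is (n : nat) (K : set 'rV[R]_n) (w : set 'rV[R]_n) (s : R)
  : Prop :=
  (fun e => fine (voln (local_parallel K e w)) / e) @ (0:R)^'+ --> s.

(** c i = S_i(K, w), i = 0..n-1, defined by
    S_{n-1}(K + rB, w) = sum_{i=0}^{n-1} r^{n-1-i} C(n-1,i) S_i(K,w), r >= 0. *)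
Definition area_measures_at (n : nat) (K : set 'rV[R]_n) (w : set 'rV[R]_n)
  (c : nat -> R) : Prop :=
  forall r : R, 0 <= r ->
    surface_area_is (parallel_body K r) w
      (\sum_(i < n) r ^+ (n.-1 - i) * ('C(n.-1, i))%:R * c i).

(** G has a k-dimensional face whose affine hull is parallel to F
    (faces of polytopes are exposed: G = {x in K | <x,u> = h_K(u)}) *)
Definition has_face_parallel (n : nat) (K : set 'rV[R]_n) (k : nat) (F : 'M[R]_n)
  : Prop :=
  exists u : 'rV[R]_n,
    let G := [set x | K x /\ forall y, K y -> dotv y u <= dotv x u] in
    (forall x y, G x -> G y -> (x - y <= F)%MS) /\
    exists M : 'M[R]_(k, n), (M == F)%MS /\
      forall i, exists x y, G x /\ G y /\ row i M = x - y.

End Convex.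

(* Main.v *)
From HB Require Import structures.
From mathcomp Require Import all_boot all_order all_algebra.
From mathcomp Require Import all_classical all_reals all_analysis.
From mathcomp Require Import measurable_realfun ring lra zify.
(* Last, so that [convex_set] is the one of Defs. *)
Require Import Defs.
Set Implicit Arguments. Unset Strict Implicit. Unset Printing Implicit Defensive.
Import Order.TTheory GRing.Theory Num.Theory.
Import numFieldNormedType.Exports.
Local Open Scope classical_set_scope.
Local Open Scope ring_scope.

(** For an orthonormal frame (W, U) of R^n with rows W (m of them) and U (j of
    them), n = m + j, let psi_P(u) be the volume of the projection along W of the
    face of P with normal u W, and psi_Q(v) that of the face of Q with normal v U.
    Rotating the frame in the plane of u and v and comparing the jumps at the angle 0
    of the derivatives of both sides of the projection identity gives an equality
    between the volumes of the sets of points extremal along lines; for almost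
    every direction of the lines these sets are the projected faces.  Hence
    psi_Q(v) <= psi_P(u) for every u and almost every v, and symmetrically, so both
    functions are almost everywhere equal to the same constant c.

    - Area measures.  The points x = a + u W with |u| <= r and a in the face of P
      with normal u W form a tube whose volume is continuous in r with right
      derivative S_{n-1}(P + r B, E), hence polynomial; it grows like c kappa_m r^m,
      which identifies S_j(P, E) as a multiple of c kappa_m.
    - Polytopes.  If P is a polytope, its projections are governed by linear programs
      whose optimal solutions survive a small rotation avoiding finitely many critical
      directions, so the second difference vanishes exactly.  For Q it is positive
      in the direction of a normal at a point touched by an inner ball.  So Q has
      finitely many such normals, and these suffice to describe it.
    - Faces.  A j-face of P parallel to F makes psi_P positive on an open set, so
      c > 0, and a generic direction v then yields an (n-j)-face of Q. *)

(** * Continuity and compactness for row vectors *)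

Section MatrixContinuity.
Variables (R : realType) (T : topologicalType).
Implicit Types (m n p : nat).

Lemma continuous_id : continuous (fun x : T => x).
Proof. by move=> x A. Qed.

Lemma continuous_add (V : normedModType R) (f g : T -> V) :
  continuous f -> continuous g -> continuous (fun t => f t + g t).
Proof. by move=> cf cg x; apply: cvgD; [exact: cf|exact: cg]. Qed.

Lemma continuous_sub (V : normedModType R) (f g : T -> V) :
  continuous f -> continuous g -> continuous (fun t => f t - g t).
Proof. by move=> cf cg x; apply: cvgB; [exact: cf|exact: cg]. Qed.

Lemma continuous_scale (V : normedModType R) (a : T -> R) (f : T -> V) :
  continuous a -> continuous f -> continuous (fun t => a t *: f t).
Proof. by move=> ca cf x; apply: cvgZ; [exact: ca|exact: cf]. Qed.

Lemma continuous_mx m n (f : T -> 'M[R]_(m, n)) :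
  (forall i j, continuous (fun t => f t i j)) -> continuous f.
Proof.
move=> cf x; apply/cvg_ballP => e e0.
have near_coords : \forall t \near x, forall ij : 'I_m * 'I_n,
    ball (f x ij.1 ij.2) e (f t ij.1 ij.2).
  apply: filter_forall => -[i j] /=.
  by have /cvg_ballP/(_ e e0) := cf i j x.
by apply: filterS near_coords => t fxt; split => // i j; exact: fxt (i, j).
Qed.

Lemma continuous_coord m n (f : T -> 'M[R]_(m, n)) i j :
  continuous f -> continuous (fun t => f t i j).
Proof.
move=> cf x; apply: (@continuous_comp _ _ _ f (fun M : 'M[R]_(m, n) => M i j)).
  exact: cf.
exact: coord_continuous.
Qed.

Lemma continuous_mulmx m n p (f : T -> 'M[R]_(m, n)) (g : T -> 'M[R]_(n, p)) :
  continuous f -> continuous g -> continuous (fun t => f t *m g t).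
Proof.
move=> cf cg; apply: continuous_mx => i j.
rewrite (_ : (fun t => _) = fun t => \sum_k f t i k * g t k j); last first.
  by apply/funext => t; rewrite mxE.
apply: continuous_big => [|k _ x]; first exact: add_continuous.
by apply: cvgM; exact: continuous_coord.
Qed.

Lemma continuous_mulmxr m n p (f : T -> 'M[R]_(m, n)) (A : 'M[R]_(n, p)) :
  continuous f -> continuous (fun t => f t *m A).
Proof. by move=> cf; apply: continuous_mulmx => //; exact: cst_continuous. Qed.

Lemma continuous_row_mx m n p (f : T -> 'M[R]_(m, n)) (g : T -> 'M[R]_(m, p)) :
  continuous f -> continuous g -> continuous (fun t => row_mx (f t) (g t)).
Proof.
move=> cf cg; apply: continuous_mx => i j.
rewrite (_ : (fun t => _) = fun t => match fintype.split j with
  | inl k => f t i k | inr k => g t i k end); last by apply/funext => t; rewrite mxE.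
by case: (fintype.split j) => k; exact: continuous_coord.
Qed.

Lemma continuous_lsubmx m n p (f : T -> 'M[R]_(m, n + p)) :
  continuous f -> continuous (fun t => lsubmx (f t)).
Proof.
move=> cf; apply: continuous_mx => i j; rewrite (_ : (fun t => _) = fun t => f t i (lshift p j)).
  exact: continuous_coord.
by apply/funext => t; rewrite mxE.
Qed.

Lemma continuous_rsubmx m n p (f : T -> 'M[R]_(m, n + p)) :
  continuous f -> continuous (fun t => rsubmx (f t)).
Proof.
move=> cf; apply: continuous_mx => i j; rewrite (_ : (fun t => _) = fun t => f t i (rshift n j)).
  exact: continuous_coord.
by apply/funext => t; rewrite mxE.
Qed.

End MatrixContinuity.

Lemma continuous_fst (T U : topologicalType) : continuous (fun p : T * U => p.1).
Proof. by move=> p; exact: cvg_fst. Qed.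

Lemma continuous_snd (T U : topologicalType) : continuous (fun p : T * U => p.2).
Proof. by move=> p; exact: cvg_snd. Qed.

Section ClosedSets.
Variables (T : topologicalType).

Lemma closed_preimage (U : topologicalType) (f : T -> U) (A : set U) :
  continuous f -> closed A -> closed [set x | A (f x)].
Proof. by move=> cf cA; move/continuous_closedP: cf => /(_ _ cA). Qed.

Lemma closed_eq_fun (R : realType) (V : normedModType R) (f g : T -> V) :
  continuous f -> continuous g -> closed [set x | f x = g x].
Proof.
move=> cf cg; rewrite (_ : mkset _ = [set x | [set (0 : V)] (f x - g x)]).
  apply: closed_preimage; first exact: continuous_sub.
  exact/accessible_closed_set1/hausdorff_accessible/norm_hausdorff.
by apply/seteqP; split => x /=; [move=> ->; rewrite subrr|move/eqP; rewrite subr_eq0 => /eqP].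
Qed.

Lemma closed_le_fun (R : realType) (f g : T -> R) :
  continuous f -> continuous g -> closed [set x | f x <= g x].
Proof.
move=> cf cg; rewrite (_ : mkset _ = [set x | [set y : R | 0 <= y] (g x - f x)]).
  by apply: closed_preimage; [exact: continuous_sub|exact: closed_ge].
by apply/seteqP; split => x /=; rewrite subr_ge0.
Qed.

Lemma closed_exists_compact (U : topologicalType) (K : set U) (C : set (U * T)) :
  compact K -> closed C -> closed [set y | exists2 x, K x & C (x, y)].
Proof.
move=> cK cC; rewrite -openC openE => y0 /= ny0.
have /compact_near_coveringP/(_ T (nbhs y0) (fun y x => ~ C (x, y))) := cK.
case/(_ _ _)/wrap.
  move=> x Kx; have nC : ~ C (x, y0) by move=> Cxy; apply: ny0; exists x.
  have /open_nbhs_nbhs : open_nbhs (x, y0) (~` C) by split => //; exact: closed_openC.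
  by move=> [[A B] [nA nB] AB]; exists (A, B) => // -[a b] Aab; exact: AB.
by apply: filterS => y notC [x Kx Cxy]; exact: notC Kx Cxy.
Qed.

End ClosedSets.

Section CompactRows.
Variable R : realType.
Implicit Types (m n : nat).

Lemma compact_closed_mx m n (K : set 'M[R]_(m, n)) : compact K -> closed K.
Proof. by apply: compact_closed; exact: norm_hausdorff. Qed.

Lemma closed_sub_compact m n (K C : set 'M[R]_(m, n)) :
  compact K -> closed C -> C `<=` K -> compact C.
Proof. by move=> cK cC CK; exact: subclosed_compact cC cK CK. Qed.

Lemma compact_image (T U : topologicalType) (K : set T) (f : T -> U) :
  compact K -> continuous f -> compact (f @` K).
Proof. by move=> cK cf; apply: continuous_compact => //; exact: continuous_subspaceT. Qed.

Lemma compact_argmax n (K : set 'rV[R]_n) (f : 'rV[R]_n -> R) :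
  compact K -> K !=set0 -> continuous f ->
  exists2 x, K x & forall y, K y -> f y <= f x.
Proof.
move=> cK K0 cf.
have [x /set_mem Kx xmax] := @EVT_max_rV R n f K K0 cK (continuous_subspaceT cf).
by exists x => // y Ky; apply: xmax; exact: mem_set.
Qed.

Lemma coord_le_norm n (x : 'rV[R]_n) i : `|x 0 i| <= `|x|.
Proof.
rewrite [leRHS]/Num.norm /= mx_normrE.
by apply/bigmax_geP; right => /=; exists (0, i).
Qed.

Lemma norm_rV_leP n (x : 'rV[R]_n) M : 0 <= M -> `|x| <= M <-> forall i, `|x 0 i| <= M.
Proof.
move=> M0; split=> [xM i|xM]; first exact: le_trans (coord_le_norm x i) xM.
rewrite [leLHS]/Num.norm /= mx_normrE; apply/bigmax_leP; split => //= -[i j] _ /=.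
by rewrite ord1.
Qed.

Lemma norm_row_mx_le m n (x : 'rV[R]_m) (y : 'rV[R]_n) M : 0 <= M ->
  `|x| <= M -> `|y| <= M -> `|row_mx x y| <= M.
Proof.
move=> M0 xM yM; apply/norm_rV_leP => // i; rewrite mxE.
by case: splitP => j _; apply: le_trans (coord_le_norm _ j) _.
Qed.

Lemma closed_norm_ball n (M : R) : closed [set x : 'rV[R]_n | `|x| <= M].
Proof.
by apply: closed_le_fun; [move=> x; exact: norm_continuous|exact: cst_continuous].
Qed.

Lemma compact_norm_ball n (M : R) : compact [set x : 'rV[R]_n | `|x| <= M].
Proof.
apply: bounded_closed_compact; last exact: closed_norm_ball.
by exists M; split; [exact: num_real|move=> N MN x /= /le_trans; apply; exact: ltW].
Qed.

Lemma closed_approx n (A : set 'rV[R]_n) z : closed A ->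
  (forall e, 0 < e -> exists2 a, A a & `|z - a| <= e) -> A z.
Proof.
move=> clA approx; apply: clA => B /nbhs_ballP[e /= e0 zeB].
have [a Aa za] := approx (e / 2) (divr_gt0 e0 (ltr0Sn _ 1)).
exists a; split => //; apply: zeB; rewrite -ball_normE /=.
by apply: (le_lt_trans za); rewrite ltr_pdivrMr// ltr_pMr// ltr1n.
Qed.

Lemma compact_norm_le m n (K : set 'M[R]_(m, n)) : compact K ->
  exists2 M : R, 0 < M & forall x, K x -> `|x| <= M.
Proof.
move=> /compact_bounded[M [_ KM]].
exists (`|M| + 1); first by rewrite ltr_wpDl.
by apply: KM; rewrite (le_lt_trans (ler_norm _))// ltrDl.
Qed.

Lemma ex_natSinv_lt (e : R) : 0 < e -> exists k : nat, k.+1%:R^-1 < e.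
Proof. by move=> /ltr_add_invr[k]; rewrite add0r; exists k. Qed.

End CompactRows.

(** * Lebesgue measure on row vectors *)

Definition mx_display : Type -> measure_display. Proof. exact. Qed.

Section MatrixMeasurable.
Variable R : realType.

Definition mx_cylinder m n : set (set 'M[R]_(m, n)) :=
  [set A | exists i j (B : set R), measurable B /\ A = (fun M : 'M[R]_(m, n) => M i j) @^-1` B].

Definition mx_measurable m n : set (set 'M[R]_(m, n)) := <<s @mx_cylinder m n >>.

Lemma mx_measurable0 m n : @mx_measurable m n set0.
Proof. exact: sigma_algebra0. Qed.

Lemma mx_measurableC m n A : @mx_measurable m n A -> mx_measurable (~` A).
Proof. by move=> mA; rewrite -setTD; exact: sigma_algebraCD. Qed.

Lemma mx_measurable_bigcup m n (F : (set 'M[R]_(m, n))^nat) :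
  (forall i, mx_measurable (F i)) -> mx_measurable (\bigcup_i F i).
Proof. exact: sigma_algebra_bigcup. Qed.

HB.instance Definition _ m n := @isMeasurable.Build (mx_display R) 'M[R]_(m, n)
  (@mx_measurable m n) (@mx_measurable0 m n) (@mx_measurableC m n)
  (@mx_measurable_bigcup m n).

Lemma measurable_mx_coord m n i j D :
  measurable_fun D (fun M : 'M[R]_(m, n) => M i j).
Proof.
move=> mD Y mY; apply: measurableI => //.
by apply: sub_gen_smallest; exists i, j, Y.
Qed.

Lemma measurable_fun_mx d (T : measurableType d) m n (D : set T)
    (f : T -> 'M[R]_(m, n)) :
  (forall i j, measurable_fun D (fun x => f x i j)) -> measurable_fun D f.
Proof.
move=> mf mD; apply: (@measurability _ _ _ _ _ _ (@mx_cylinder m n)) => //.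
by move=> _ [_ [i [j [B [mB ->]]]] <-]; exact: mf.
Qed.

Lemma measurable_row_mx d (T : measurableType d) m n (D : set T)
    (f : T -> 'rV[R]_m) (g : T -> 'rV[R]_n) :
  measurable_fun D f -> measurable_fun D g ->
  measurable_fun D (fun x => row_mx (f x) (g x)).
Proof.
move=> mf mg; apply: measurable_fun_mx => i j.
rewrite (_ : (fun x => _) = fun x => match fintype.split j with
  | inl k => f x i k | inr k => g x i k end); last first.
  by apply/funext => x; rewrite mxE.
case: (fintype.split j) => k.
  by apply: (measurableT_comp (@measurable_mx_coord _ _ i k setT)).
by apply: (measurableT_comp (@measurable_mx_coord _ _ i k setT)).
Qed.

Lemma measurable_row1 d (T : measurableType d) (D : set T) (f : T -> R) :
  measurable_fun D f -> measurable_fun D (fun x => \row_(_ < 1) f x).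
Proof.
move=> mf; apply: measurable_fun_mx => i j.
by rewrite (_ : (fun x => _) = f)//; apply/funext => x; rewrite mxE.
Qed.

Lemma measurable_mulmxr d (T : measurableType d) m n p (D : set T)
    (f : T -> 'M[R]_(m, n)) (M : 'M[R]_(n, p)) :
  measurable_fun D f -> measurable_fun D (fun x => f x *m M).
Proof.
move=> mf; apply: measurable_fun_mx => i j.
rewrite (_ : (fun x => _) = fun x => \sum_k f x i k * M k j); last first.
  by apply/funext => x; rewrite mxE.
apply: measurable_sum => k; apply: measurable_funM => //.
exact: (measurableT_comp (@measurable_mx_coord _ _ i k setT)).
Qed.

Lemma measurable_addmx d (T : measurableType d) m n (D : set T)
    (f g : T -> 'M[R]_(m, n)) :
  measurable_fun D f -> measurable_fun D g ->
  measurable_fun D (fun x => f x + g x).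
Proof.
move=> mf mg; apply: measurable_fun_mx => i j.
rewrite (_ : (fun x => _) = fun x => f x i j + g x i j); last first.
  by apply/funext => x; rewrite mxE.
by apply: measurable_funD;
  exact: (measurableT_comp (@measurable_mx_coord _ _ i j setT)).
Qed.

Lemma measurable_scalemx d (T : measurableType d) m n (D : set T)
    (a : T -> R) (f : T -> 'M[R]_(m, n)) :
  measurable_fun D a -> measurable_fun D f ->
  measurable_fun D (fun x => a x *: f x).
Proof.
move=> ma mf; apply: measurable_fun_mx => i j.
rewrite (_ : (fun x => _) = fun x => a x * f x i j); last first.
  by apply/funext => x; rewrite mxE.
apply: measurable_funM => //.
exact: (measurableT_comp (@measurable_mx_coord _ _ i j setT)).
Qed.

Lemma measurable_lsubmx d (T : measurableType d) m n (D : set T)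
    (f : T -> 'rV[R]_(m + n)) :
  measurable_fun D f -> measurable_fun D (fun x => lsubmx (f x)).
Proof.
move=> mf; apply: measurable_fun_mx => i j.
rewrite (_ : (fun x => _) = fun x => f x i (lshift n j)); last first.
  by apply/funext => x; rewrite mxE.
exact: (measurableT_comp (@measurable_mx_coord _ _ i _ setT)).
Qed.

Lemma measurable_rsubmx d (T : measurableType d) m n (D : set T)
    (f : T -> 'rV[R]_(m + n)) :
  measurable_fun D f -> measurable_fun D (fun x => rsubmx (f x)).
Proof.
move=> mf; apply: measurable_fun_mx => i j.
rewrite (_ : (fun x => _) = fun x => f x i (rshift m j)); last first.
  by apply/funext => x; rewrite mxE.
exact: (measurableT_comp (@measurable_mx_coord _ _ i _ setT)).
Qed.

End MatrixMeasurable.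

Section Borel.
Variable R : realType.
Local Notation leb := (@lebesgue_measure R).

Lemma mx_ballP m n (x : 'M[R]_(m, n)) e y :
  ball x e y <-> 0 < e /\ forall i j, `|x i j - y i j| < e.
Proof. by []. Qed.

Lemma measurable_mx_ball m n (x : 'M[R]_(m, n)) e : measurable (ball x e).
Proof.
have [e0|e0] := leP e 0.
  rewrite (_ : ball x e = set0)//; apply/seteqP; split => // y [+ _].
  by rewrite ltNge e0.
rewrite (_ : ball x e =
  \bigcap_(i in [set: 'I_m]) \bigcap_(j in [set: 'I_n])
    ((fun M => M i j) @^-1` ball (x i j) e)).
  apply: fin_bigcap_measurable => // i _; apply: fin_bigcap_measurable => // j _.
  rewrite -[X in measurable X]setTI; apply: measurable_mx_coord => //.
  exact: measurable_ball.
apply/seteqP; split=> [y [_ xy] i _ j _|y xy]; first exact: xy.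
by split => // i j; exact: xy.
Qed.

Lemma open_measurable_mx m n (A : set 'M[R]_(m, n)) : open A -> measurable A.
Proof.
move=> oA.
pose C (p : 'M[rat]_(m, n) * nat) : set 'M[R]_(m, n) :=
  let B := ball (map_mx ratr p.1 : 'M[R]_(m, n)) (p.2.+1%:R^-1) in
  if `[< B `<=` A >] then B else set0.
have mC p : measurable (C p).
  by rewrite /C; case: ifP => // _; exact: measurable_mx_ball.
rewrite (_ : A = \bigcup_i oapp C set0 (unpickle i)); last first.
  apply/seteqP; split=> [y Ay|y [i _]]; last first.
    case: (unpickle i) => //= p; rewrite /C.
    by case: ifPn => // /asboolP BA; exact: BA.
  have /nbhs_ballP[e /= e0 yeA] : nbhs y A by exact: open_nbhs_nbhs.
  have [k ke] := ex_natSinv_lt (divr_gt0 e0 (ltr0Sn R 1)).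
  have k0 : 0 < k.+1%:R^-1 :> R by rewrite invr_gt0.
  have /choice[f fP] : forall ij : 'I_m * 'I_n, exists q : rat,
      `|ratr q - y ij.1 ij.2| < k.+1%:R^-1 :> R.
    move=> [i j] /=.
    have /rat_in_itvoo[q] : y i j - k.+1%:R^-1 < y i j + k.+1%:R^-1.
      by rewrite ltrBlDr -addrA ltrDl addr_gt0.
    by rewrite in_itv/= => /andP[q1 q2]; exists q; rewrite ltr_distl q1 q2.
  pose p := (\matrix_(i, j) f (i, j), k).
  exists (pickle p) => //=; rewrite pickleK /= /C.
  have pE i j : (map_mx ratr p.1 : 'M[R]_(m, n)) i j = ratr (f (i, j)).
    by rewrite !mxE.
  rewrite ifT; first by split => // i j; rewrite pE; exact: fP (i, j).
  apply/asboolP => z [_ zP]; apply: yeA; split => // i j.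
  change (`|y i j - (z : 'M[R]_(m, n)) i j| < e).
  rewrite (le_lt_trans (ler_distD (ratr (f (i, j))) _ _))//.
  rewrite (splitr e) ltrD//.
    by rewrite distrC (lt_trans (fP (i, j)))//.
  by have := zP i j; rewrite pE => /lt_trans; exact.
apply: bigcupT_measurable => i; case: (unpickle i) => //=.
Qed.

Lemma closed_measurable_mx m n (A : set 'M[R]_(m, n)) :
  closed A -> measurable A.
Proof.
move=> cA; rewrite -[A]setCK; apply: measurableC; apply: open_measurable_mx.
exact: closed_openC.
Qed.

Lemma compact_measurable_mx m n (A : set 'M[R]_(m, n)) :
  compact A -> measurable A.
Proof. by move=> cA; apply: closed_measurable_mx; exact: compact_closed_mx. Qed.

Definition row_cons n (p : measurableTypeR R * 'rV[R]_n) : 'rV[R]_n.+1 :=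
  row_mx (\row_(_ < 1) p.1) p.2.

Lemma measurable_row_cons n : measurable_fun setT (@row_cons n).
Proof.
apply: (@measurable_row_mx R _ _ 1 n); last exact: measurable_snd.
apply: measurable_row1; exact: measurable_fst.
Qed.

Lemma measurable_row_consr n (x : measurableTypeR R) :
  measurable_fun setT (fun v : 'rV[R]_n => row_cons (x, v)).
Proof.
by apply: (measurableT_comp (@measurable_row_cons n)); exact: pair1_measurable.
Qed.

Lemma measurable_row_consl n (v : 'rV[R]_n) :
  measurable_fun setT (fun x : measurableTypeR R => row_cons (x, v)).
Proof.
by apply: (measurableT_comp (@measurable_row_cons n)); exact: pair2_measurable.
Qed.

Lemma row_cons_eta n (x : 'rV[R]_(1 + n)) : row_cons (x 0 0, rsubmx x) = x.
Proof.
rewrite /row_cons /= -[RHS]hsubmxK; congr (@row_mx _ _ 1 n _ _).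
by apply/rowP => i; rewrite ord1 !mxE; congr (x _ _); apply/val_inj.
Qed.

Lemma row_cons_head n (x : measurableTypeR R) (v : 'rV[R]_n) :
  (row_cons (x, v) : 'rV[R]_(1 + n)) 0 0 = x.
Proof. by rewrite /row_cons mxE; case: splitP => //= j _; rewrite mxE. Qed.

Lemma row_cons_tail n (x : measurableTypeR R) (v : 'rV[R]_n) :
  rsubmx (row_cons (x, v) : 'rV[R]_(1 + n)) = v.
Proof. by rewrite /row_cons /= row_mxKr. Qed.

Definition cons_measure n (m : {sigma_finite_measure set 'rV[R]_n -> \bar R})
  : set 'rV[R]_n.+1 -> \bar R := pushforward (leb \x m)%E (@row_cons n).

HB.instance Definition _ n m := Measure.copy (@cons_measure n m)
  (measure_function_pushforward__canonical__measure_function_Measure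
     (leb \x m)%E (@measurable_row_cons n)).

Lemma cons_measure_sigma_finite n m : sigma_finite setT (@cons_measure n m).
Proof.
have /sigma_finiteP[F [TF ndF Foo]] := sigma_finiteT leb.
have /sigma_finiteP[G [TG ndG Goo]] := sigma_finiteT m.
exists (fun k => (fun x : 'rV[R]_(1 + n) => x 0 0) @^-1` F k `&`
                 (fun x : 'rV[R]_(1 + n) => rsubmx x) @^-1` G k).
  apply/esym; rewrite -subTset => x _.
  have [k _ Fk] : (\bigcup_i F i) (x 0 0) by rewrite -TF.
  have [l _ Gl] : (\bigcup_i G i) (rsubmx (x : 'rV[R]_(1 + n))) by rewrite -TG.
  exists (maxn k l) => //; split.
    by have /subsetPset := ndF _ _ (leq_maxl k l); apply.
  by have /subsetPset := ndG _ _ (leq_maxr k l); apply.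
move=> k; have [mF Fy] := Foo k; have [mG Gy] := Goo k; split.
  apply: measurableI; rewrite -[X in measurable X]setTI.
    by apply: measurable_mx_coord.
  exact: (measurable_rsubmx (m := 1) (f := fun x : 'rV[R]_(1 + n) => x)).
rewrite /cons_measure /pushforward.
rewrite (_ : _ @^-1` _ = F k `*` G k).
  by rewrite product_measure1E// lte_mul_pinfty// ge0_fin_numE.
by apply/seteqP; split=> -[x v] /=; rewrite row_cons_head row_cons_tail.
Qed.

HB.instance Definition _ n m := Measure_isSigmaFinite.Build _ _ _
  (@cons_measure n m) (cons_measure_sigma_finite m).

Fixpoint vol n : {sigma_finite_measure set 'rV[R]_n -> \bar R} :=
  match n with
  | 0 => \d_(0 : 'rV[R]_0)
  | m.+1 => cons_measure (vol m)
  end.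

Arguments vol : simpl never.

Lemma nintegE n (f : 'rV[R]_n -> \bar R) : (forall x, 0 <= f x)%E ->
  measurable_fun setT f -> ninteg f = (\int[vol n]_x f x)%E.
Proof.
elim: n f => [|n IH] f f0 mf; first by rewrite /vol integral_dirac// diracT mul1e.
rewrite [RHS](@ge0_integral_pushforward _ _ _ _ _ _ (@measurable_row_cons n)
  [the measure _ _ of (leb \x vol n)%E])// preimage_setT.
have mf_cons : measurable_fun setT (f \o @row_cons n).
  by apply: (measurableT_comp mf); exact: measurable_row_cons.
rewrite (@fubini_tonelli1 _ _ _ _ R leb (vol n) _ mf_cons) => [|x]; last exact: f0.
rewrite /=; apply: eq_integral => x _; rewrite /fubini_F /= IH//.
by apply: (measurableT_comp mf); exact: measurable_row_consr.
Qed.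

Lemma volnE n (A : set 'rV[R]_n) : measurable A -> voln A = vol n A.
Proof.
move=> mA; rewrite /voln nintegE ?integral_indic ?setIT//.
exact/measurable_EFinP/measurable_indic.
Qed.

Lemma integral_vol_cons n (f : 'rV[R]_n.+1 -> \bar R) : (forall x, 0 <= f x)%E ->
  measurable_fun setT f ->
  (\int[vol n.+1]_x f x = \int[leb]_x \int[vol n]_v f (row_cons (x, v)))%E.
Proof.
move=> f0 mf; rewrite -nintegE//=; apply: eq_integral => x _.
rewrite nintegE//; apply: (measurableT_comp mf).
exact: measurable_row_consr.
Qed.

Lemma integral_vol_consC n (f : 'rV[R]_n.+1 -> \bar R) : (forall x, 0 <= f x)%E ->
  measurable_fun setT f ->
  (\int[vol n.+1]_x f x = \int[vol n]_v \int[leb]_x f (row_cons (x, v)))%E.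
Proof.
move=> f0 mf; rewrite integral_vol_cons//.
apply: (@fubini_tonelli _ _ _ _ R leb (vol n) (fun p => f (row_cons p))) => //.
by apply: (measurableT_comp mf); exact: measurable_row_cons.
Qed.

Lemma measurable_integral_row_cons n (f : 'rV[R]_n.+1 -> \bar R) :
  (forall x, 0 <= f x)%E -> measurable_fun setT f ->
  measurable_fun [set: measurableTypeR R]
    (fun x => \int[vol n]_v f (row_cons (x, v)))%E.
Proof.
move=> f0 mf; apply: (@measurable_fun_fubini_tonelli_F _ _ _ _ R (vol n)
  (fun p => f (row_cons p))) => //.
by apply: (measurableT_comp mf); exact: measurable_row_cons.
Qed.

End Borel.

Section LinearChange.
Variable R : realType.
Local Notation leb := (@lebesgue_measure R).
Local Notation Rm := (measurableTypeR R).

Lemma integral_lebesgue_affine (a b : R) (f : Rm -> \bar R) : a != 0 ->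
  (forall x, 0 <= f x)%E -> measurable_fun setT f ->
  (`|a|%:E * \int[leb]_x f (a * x + b)%R = \int[leb]_x f x)%E.
Proof.
move=> a0 f0 mf.
pose phi (x : Rm) : Rm := a * x + b.
have mphi : measurable_fun setT phi.
  by apply: (@measurable_funD _ Rm R setT (fun x => a * x) (cst b)) => //;
    exact: (@mulrl_measurable R setT a).
pose m0 := measure_function_pushforward__canonical__measure_function_Measure leb mphi.
have a0' : 0 <= `|a| by [].
pose m1 := mscale (NngNum a0') m0.
have leb_m1 A : measurable A -> leb A = m1 A.
  move=> mA; apply: lebesgue_measure_unique => // _ [[x y] _ <-] /=.
  rewrite /m1 /mscale /= /pushforward.
  have [a_gt0|a_lt0|/eqP] := ltgtP 0 a; last by rewrite eq_sym (negbTE a0).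
    have -> : phi @^-1` `]x, y] = `](x - b) / a, (y - b) / a]%classic.
      apply/seteqP; split=> z /=; rewrite !in_itv /= /phi ltr_pdivrMr//
        ler_pdivlMr// ltrBlDr lerBrDr (mulrC z); exact.
    rewrite !lebesgue_measure_itv/= !lte_fin ltr_pM2r ?invr_gt0// ltrD2r.
    case: ifPn; last by rewrite mule0.
    rewrite -!EFinD -EFinM gtr0_norm// => _; congr EFin.
    by field.
  have -> : phi @^-1` `]x, y] = `[(y - b) / a, (x - b) / a[%classic.
    apply/seteqP; split=> z /=; rewrite !in_itv /= /phi ltr_ndivlMr//
        ler_ndivrMr// ltrBlDr lerBrDr (mulrC z) andbC; exact.
  rewrite !lebesgue_measure_itv/= !lte_fin ltr_nM2r ?invr_lt0// ltrD2r.
  case: ifPn; last by rewrite mule0.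
  rewrite -!EFinD -EFinM ltr0_norm// => _; congr EFin.
  by field.
rewrite [RHS](@eq_measure_integral _ _ _ _ m1); last first.
  by move=> A mA _; exact: leb_m1.
rewrite ge0_integral_mscale//; congr (_ * _)%E.
by rewrite (ge0_integral_pushforward mphi leb)//.
Qed.

Lemma integral_vol0 (f : 'rV[R]_0 -> \bar R) : (forall x, 0 <= f x)%E ->
  measurable_fun setT f -> (\int[vol R 0]_x f x = f (0 : 'rV[R]_0)%R)%E.
Proof. by move=> f0 mf; rewrite -nintegE. Qed.

Lemma measurable_row_mx2 a b :
  measurable_fun setT (fun p : 'rV[R]_a * 'rV[R]_b => row_mx p.1 p.2).
Proof.
by apply: measurable_row_mx; [exact: measurable_fst|exact: measurable_snd].
Qed.

Lemma measurable_row_mxr a b (x : 'rV[R]_a) :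
  measurable_fun setT (fun v : 'rV[R]_b => row_mx x v).
Proof. by apply: measurable_row_mx. Qed.

Lemma measurable_row_mxl a b (v : 'rV[R]_b) :
  measurable_fun setT (fun x : 'rV[R]_a => row_mx x v).
Proof. by apply: measurable_row_mx. Qed.

Lemma integral_vol_row_mx a b (f : 'rV[R]_(a + b) -> \bar R) :
  (forall x, 0 <= f x)%E -> measurable_fun setT f ->
  (\int[vol R (a + b)]_x f x = \int[vol R a]_x \int[vol R b]_v f (row_mx x v))%E.
Proof.
have mg c (f' : 'rV[R]_(c + b) -> \bar R) : (forall x, 0 <= f' x)%E ->
    measurable_fun setT f' ->
    measurable_fun setT (fun x => \int[vol R b]_v f' (row_mx x v))%E.
  move=> f0 mf.
  apply: (@measurable_fun_fubini_tonelli_F _ _ _ _ R (vol R b)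
    (fun p : 'rV[R]_c * 'rV[R]_b => f' (row_mx p.1 p.2))) => //.
  apply: (measurableT_comp mf); exact: measurable_row_mx2.
elim: a f => [|a IH] f f0 mf.
  rewrite integral_vol0; last 2 first.
  - by move=> x; exact: integral_ge0.
  - exact: mg.
  by apply: eq_integral => v _; rewrite row_thin_mx.
rewrite [RHS]integral_vol_cons; last 2 first.
- by move=> x; exact: integral_ge0.
- exact: mg.
rewrite integral_vol_cons; [|exact: f0|exact: mf]; apply: eq_integral => x _.
rewrite (IH (fun w => f (row_cons (x, w)))); [|by move=> w; exact: f0|]; last first.
  by apply: (measurableT_comp mf); exact: measurable_row_consr.
apply: eq_integral => y _; apply: eq_integral => v _.
by rewrite /row_cons /= row_mxA castmx_id.
Qed.

Lemma integral_vol_row_mxC a b (f : 'rV[R]_(a + b) -> \bar R) :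
  (forall x, 0 <= f x)%E -> measurable_fun setT f ->
  (\int[vol R (a + b)]_x f x = \int[vol R b]_v \int[vol R a]_x f (row_mx x v))%E.
Proof.
move=> f0 mf; rewrite integral_vol_row_mx//.
apply: (@fubini_tonelli _ _ _ _ R (vol R a) (vol R b)
  (fun p : 'rV[R]_a * 'rV[R]_b => f (row_mx p.1 p.2))) => //.
by apply: (measurableT_comp mf); exact: measurable_row_mx2.
Qed.

Lemma integral_vol_shift n (t : 'rV[R]_n) (f : 'rV[R]_n -> \bar R) :
  (forall x, 0 <= f x)%E -> measurable_fun setT f ->
  (\int[vol R n]_x f (x + t)%R = \int[vol R n]_x f x)%E.
Proof.
elim: n t f => [|n IH] t f f0 mf.
  rewrite !integral_vol0//; first by rewrite (_ : 0 + t = 0)//; apply/rowP => -[].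
  by apply: (measurableT_comp mf); apply: measurable_addmx.
have mf' : measurable_fun setT (fun x : 'rV[R]_n.+1 => f (x + t)).
  by apply: (measurableT_comp mf); apply: measurable_addmx.
rewrite integral_vol_cons; [|by move=> x; exact: f0|exact: mf'].
rewrite [RHS]integral_vol_cons; [|exact: f0|exact: mf].
rewrite -[RHS](@integral_lebesgue_affine 1 (t 0 0))//; last 2 first.
- by move=> x; exact: integral_ge0.
- exact: measurable_integral_row_cons.
rewrite normr1 mul1e; apply: eq_integral => x _; rewrite mul1r.
rewrite -[RHS](IH (rsubmx (t : 'rV[R]_(1 + n))))//; last first.
  by apply: (measurableT_comp mf); exact: measurable_row_consr.
apply: eq_integral => v _; congr f.
by rewrite -[in LHS](row_cons_eta (t : 'rV[R]_(1 + n))) /row_cons /=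
  (@add_row_mx _ 1 1 n); congr (@row_mx _ 1 1 n _ _); apply/rowP => i; rewrite !mxE.
Qed.

Definition change_of_variables n (M : 'M[R]_n) :=
  forall f : 'rV[R]_n -> \bar R, (forall x, 0 <= f x)%E ->
  measurable_fun setT f ->
  (`|\det M|%:E * \int[vol R n]_x f (x *m M) = \int[vol R n]_x f x)%E.

Lemma change_of_variablesM n (M N : 'M[R]_n) :
  change_of_variables M -> change_of_variables N -> change_of_variables (M *m N).
Proof.
move=> covM covN f f0 mf; rewrite det_mulmx normrM mulrC EFinM -muleA.
under eq_integral do rewrite mulmxA.
rewrite (covM (fun x => f (x *m N))) ?covN//.
by apply: (measurableT_comp mf); apply: measurable_mulmxr.
Qed.

Lemma change_of_variables_upper n (a : 'M[R]_1) (b : 'rV[R]_n) (S : 'M[R]_n) :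
  a 0 0 != 0 -> change_of_variables S ->
  change_of_variables (block_mx a b 0 S : 'M[R]_(1 + n)).
Proof.
move=> a0 covS f f0 mf.
rewrite (@det_ublock _ 1 n) normrM [a]mx11_scalar det_scalar1 -mx11_scalar.
rewrite EFinM -muleA.
have mf' : measurable_fun setT (fun x : 'rV[R]_(1 + n) => f (x *m block_mx a b 0 S)).
  by apply: (measurableT_comp mf); apply: measurable_mulmxr.
rewrite (@integral_vol_cons R n (fun x => f (x *m (block_mx a b 0 S : 'M[R]_(1 + n)))));
  [|by move=> x; exact: f0|exact: mf'].
rewrite [RHS]integral_vol_cons; [|exact: f0|exact: mf].
rewrite -[RHS](@integral_lebesgue_affine (a 0 0) 0)//; last 2 first.
- by move=> x; exact: integral_ge0.
- exact: measurable_integral_row_cons.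
congr (_ * _)%E; rewrite -ge0_integralZl//; last 2 first.
- exact: (measurable_integral_row_cons _ mf').
- by move=> x _; exact: integral_ge0.
apply: eq_integral => x _; rewrite addr0.
have mfx y : measurable_fun setT (fun v : 'rV[R]_n => f (row_cons (y, v))).
  by apply: (measurableT_comp mf); exact: measurable_row_consr.
rewrite -[RHS](@integral_vol_shift _ (x *: b))//.
rewrite -[RHS]covS//; last first.
  by apply: (measurableT_comp (mfx _)); apply: measurable_addmx.
congr (_ * _)%E; apply: eq_integral => v _; congr f.
rewrite /row_cons /= (@mul_row_block _ 1 1 n 1 n) mulmx0 addr0.
congr (@row_mx _ 1 1 n _ _).
  by apply/rowP => i; rewrite !ord1 !mxE big_ord1 mxE mulrC.
rewrite addrC; congr (_ + _).
by apply/rowP => i; rewrite !mxE big_ord1 mxE.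
Qed.

Lemma change_of_variables_lower n (c : 'cV[R]_n) :
  change_of_variables (block_mx 1%:M 0 c 1%:M : 'M[R]_(1 + n)).
Proof.
move=> f f0 mf.
rewrite (@det_lblock _ 1 n) !det1 mulr1 normr1 mul1e.
have mf' : measurable_fun setT
   (fun x : 'rV[R]_(1 + n) => f (x *m block_mx 1%:M 0 c 1%:M)).
  by apply: (measurableT_comp mf); apply: measurable_mulmxr.
rewrite (@integral_vol_consC R n
  (fun x => f (x *m (block_mx 1%:M 0 c 1%:M : 'M[R]_(1 + n)))));
  [|by move=> x; exact: f0|exact: mf'].
rewrite [RHS]integral_vol_consC; [|exact: f0|exact: mf].
apply: eq_integral => v _.
rewrite -[RHS](@integral_lebesgue_affine 1 ((v *m c) 0 0))//; last first.
  by apply: (measurableT_comp mf); exact: measurable_row_consl.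
rewrite normr1 mul1e; apply: eq_integral => x _; congr f.
rewrite /row_cons /= (@mul_row_block _ 1 1 n 1 n) !mulmx1 mulmx0 add0r mul1r.
by congr (@row_mx _ 1 1 n _ _); apply/rowP => i; rewrite !ord1 !mxE.
Qed.

Lemma change_of_variables1 n : change_of_variables (1%:M : 'M[R]_n).
Proof.
move=> f f0 mf; rewrite det1 normr1 mul1e.
by apply: eq_integral => x _; rewrite mulmx1.
Qed.

Lemma unitmx_col0_neq0 n (M : 'M[R]_(1 + n)) : M \in unitmx ->
  exists i, M i 0 != 0.
Proof.
rewrite unitmxE => uM; apply/existsP; rewrite -negb_forall.
apply: contraL uM => /forallP M0; rewrite (expand_det_col _ 0) big1 ?unitr0// => i _.
by have /eqP -> := M0 i; rewrite mul0r.
Qed.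

Lemma change_of_variables_pivot n (M : 'M[R]_(1 + n)) :
  (forall S : 'M[R]_n, S \in unitmx -> change_of_variables S) ->
  M \in unitmx -> M 0 0 != 0 -> change_of_variables M.
Proof.
move=> IH uM M00.
pose a := ulsubmx M; pose b := ursubmx M; pose c := (a 0 0)^-1 *: dlsubmx M.
have aE : a 0 0 = M 0 0 by rewrite /a !mxE (_ : lshift n 0 = 0)//; exact/val_inj.
pose S := drsubmx M - c *m b.
have ME : M = (block_mx 1%:M 0 c 1%:M : 'M[R]_(1 + n)) *m block_mx a b 0 S.
  rewrite mulmx_block !mul1mx !mul0mx !addr0 /S [c *m b + _]addrC subrK.
  rewrite [a in c *m a]mx11_scalar mul_mx_scalar scalerA divff ?aE// scale1r.
  by rewrite submxK.
have uS : S \in unitmx.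
  move: uM; rewrite ME unitmx_mul => /andP[_].
  by rewrite !unitmxE (@det_ublock _ 1 n) unitrM => /andP[].
rewrite ME; apply: change_of_variablesM; first exact: change_of_variables_lower.
by apply: change_of_variables_upper; [rewrite aE|exact: IH].
Qed.

Lemma integral_vol_linear n (M : 'M[R]_n) : M \in unitmx -> change_of_variables M.
Proof.
elim: n M => [|n IH] M uM.
  by rewrite (_ : M = 1%:M); [exact: change_of_variables1|apply/matrixP => -[]].
have [M00|] := eqVneq (M 0 0) 0; last exact: (@change_of_variables_pivot n M).
have l0 : lshift n (0 : 'I_1) = 0 :> 'I_(1 + n) by exact/val_inj.
have [i Mi] : exists i : 'I_n, M (rshift 1 i) 0 != 0.
  have [i] := @unitmx_col0_neq0 n M uM; case: (@split_ordP 1 n i) => k ->; last by exists k.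
  by rewrite ord1 l0 M00 eqxx.
pose r : 'rV[R]_n := delta_mx 0 i.
have ME : M = (block_mx 1%:M (- r) 0 1%:M : 'M[R]_(1 + n)) *m
    ((block_mx 1%:M r 0 1%:M : 'M[R]_(1 + n)) *m M).
  rewrite mulmxA mulmx_block !mulmx1 !mul1mx !mulmx0 !mul0mx !addr0 add0r.
  by rewrite subrr -scalar_mx_block mul1mx.
rewrite ME; apply: change_of_variablesM.
  by apply: change_of_variables_upper; rewrite ?mxE ?oner_eq0//; exact: change_of_variables1.
apply: (@change_of_variables_pivot n) => //.
  by rewrite unitmx_mul uM andbT unitmxE (@det_ublock _ 1 n) !det1 mulr1 unitr1.
rewrite -[in X in _ *m X](@submxK _ 1 n 1 n M) (@mulmx_block _ 1 n 1 n 1 n) !mul1mx.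
by rewrite -l0 block_mxEul -rowE !mxE l0 M00 add0r.
Qed.

End LinearChange.

(** * Null sets, slices and orthonormal frames *)

Section LimSupMeasure.
Context d (T : measurableType d) (R : realType) (m : {measure set T -> \bar R}).
Variables (F : (set T)^nat) (A B : set T).
Hypotheses (mF : forall k, measurable (F k)) (mA : measurable A) (mB : measurable B).
Hypotheses (mBoo : (m B < +oo)%E) (FB : forall k, F k `<=` B) (FA : lim_sup_set F `<=` A).

Lemma measure_lim_sup_ge c : (forall k, c <= m (F k))%E -> (c <= m A)%E.
Proof.
move=> cF; apply: (@le_trans _ _ (m (lim_sup_set F))); last first.
  apply: le_measure => //; rewrite inE//.
  by apply: bigcap_measurable => // k _; exact: bigcup_measurable.
have cvg_tails : (m (\bigcup_(k >= N) F k) @[N --> \oo] --> m (lim_sup_set F))%E.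
  apply: lim_sup_set_cvg => //.
  apply: le_lt_trans mBoo; apply: le_measure; rewrite ?inE//.
    exact: bigcup_measurable.
  by move=> x [k _ Fkx]; exact: FB Fkx.
rewrite -(cvg_lim _ cvg_tails)//; apply: lime_ge.
  by apply/cvg_ex; eexists; exact: cvg_tails.
apply: nearW => k; apply: le_trans (cF k) _.
apply: le_measure; rewrite ?inE//; first exact: bigcup_measurable.
by move=> x Fkx; exists k => /=.
Qed.

End LimSupMeasure.

Lemma cvg_measure_lim_sup d (T : measurableType d) (R : realType)
    (m : {measure set T -> \bar R}) (F : (set T)^nat) (A B : set T) :
  (forall k, measurable (F k)) -> measurable A -> measurable B ->
  (m B < +oo)%E -> (forall k, F k `<=` B) -> lim_sup_set F `<=` A ->
  (forall k, m A <= m (F k))%E -> fine (m (F k)) @[k --> \oo] --> fine (m A).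
Proof.
move=> mF mA mB mBoo FB FA AF.
have fin_F k : m (F k) \is a fin_num.
  rewrite ge0_fin_numE//; apply: le_lt_trans mBoo; apply: le_measure => //; exact/mem_set.
have fin_A : m A \is a fin_num.
  by rewrite ge0_fin_numE//; apply: le_lt_trans (AF 0%N) _; rewrite -ge0_fin_numE.
have lb k : fine (m A) <= fine (m (F k)) by apply: fine_le.
apply/cvgrPdist_le => e e0.
suff : \forall k \near \oo, fine (m (F k)) <= fine (m A) + e.
  by apply: filterS => k; have := lb k; rewrite ler_norml; lra.
apply: contrapT => frequently_far.
have /choice[s sP] N : exists k, (N <= k)%N /\ fine (m A) + e < fine (m (F k)).
  apply: contrapT => noN; apply: frequently_far; exists N => // k /= Nk.
  by rewrite leNgt; apply/negP => ?; apply: noN; exists k.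
suff : ((fine (m A) + e)%:E <= m A)%E by rewrite -[leRHS]fineK// lee_fin; lra.
apply: (@measure_lim_sup_ge _ _ _ m (F \o s) A B) => //.
- by move=> k; exact: mF.
- by move=> k; exact: FB.
- move=> x Fsx; apply: FA => N _; have [k /= Nk Fskx] := Fsx N I.
  by exists (s k) => //=; apply: (leq_trans Nk); case: (sP k).
- by move=> k; rewrite -(fineK (fin_F _)) lee_fin ltW//; case: (sP k).
Qed.

Lemma ae_exists_in d (T : measurableType d) (R : realType) (m : {measure set T -> \bar R})
    (A B : set T) : {ae m, forall x, A x} -> measurable B -> (0 < m B)%E ->
  exists2 x, B x & A x.
Proof.
move=> [N [mN N0 AN]] mB B0; apply: contrapT => nA.
move: B0; rewrite ltNge => /negP; apply; rewrite -N0; apply: le_measure; rewrite ?inE//.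
by move=> x Bx; apply: AN => /= Ax; apply: nA; exists x.
Qed.

Section SetMeasure.
Variable R : realType.
Local Notation leb := (@lebesgue_measure R).
Local Notation Rm := (measurableTypeR R).
Local Notation vol := (vol R).

Lemma measurable_preimage d d' (T : measurableType d) (T' : measurableType d')
    (f : T -> T') (A : set T') :
  measurable_fun setT f -> measurable A -> measurable [set x | A (f x)].
Proof. by move=> mf mA; rewrite -[X in measurable X]setTI; exact: mf. Qed.

Lemma measurable_EFin_indic d (T : measurableType d) (A : set T) :
  measurable A -> measurable_fun setT (fun x => (\1_A x)%:E : \bar R).
Proof. by move=> mA; exact/measurable_EFinP/measurable_indic. Qed.

Lemma measure_integral_indic d (T : measurableType d) (m : {measure set T -> \bar R})
    (A : set T) : measurable A -> m A = (\int[m]_x (\1_A x)%:E)%E.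
Proof. by move=> mA; rewrite integral_indic// setIT. Qed.

Lemma indic_preimage (T T' : Type) (f : T -> T') (A : set T') x :
  \1_A (f x) = \1_[set y | A (f y)] x :> R.
Proof. by rewrite !indicE; congr (_%:R); apply/asbool_equiv_eq. Qed.

Lemma vol_linear n (T : 'M[R]_n) A : T \in unitmx -> measurable A ->
  (`|\det T|%:E * vol n [set x | A (x *m T)] = vol n A)%E.
Proof.
move=> uT mA; rewrite [RHS]measure_integral_indic// -(integral_vol_linear uT)//; last first.
  exact: measurable_EFin_indic.
rewrite measure_integral_indic//; last first.
  by apply: measurable_preimage => //; apply: measurable_mulmxr.
Qed.

Lemma vol_orthogonal n (T : 'M[R]_n) A : orthonormal T -> measurable A ->
  vol n [set x | A (x *m T)] = vol n A.
Proof.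
move=> TT mA; have uT : T \in unitmx by case: (mulmx1_unit TT).
rewrite -(vol_linear uT mA).
suff -> : `|\det T| = 1 by rewrite mul1e.
have : `|\det T| ^+ 2 = 1.
  by rewrite -normrX expr2 -{2}det_tr -det_mulmx TT det1 normr1.
by move=> /eqP; rewrite sqrp_eq1// => /eqP.
Qed.

Lemma vol_scale n (a : R) (A : set 'rV[R]_n) : a != 0 -> measurable A ->
  ((`|a| ^+ n)%:E * vol n [set x : 'rV[R]_n | A (a *: x)%R] = vol n A)%E.
Proof.
move=> a0 mA; have uT : (a%:M : 'M[R]_n) \in unitmx.
  by rewrite unitmxE det_scalar unitrX// unitfE.
rewrite -(vol_linear uT mA) det_scalar normrX; congr (_ * vol n _)%E.
by apply/seteqP; split=> x /=; rewrite mul_mx_scalar.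
Qed.

Lemma vol_shift n (t : 'rV[R]_n) A : measurable A ->
  vol n [set x | A (x + t)] = vol n A.
Proof.
move=> mA; rewrite [RHS]measure_integral_indic// -(@integral_vol_shift _ _ t)//; last first.
  exact: measurable_EFin_indic.
rewrite (measure_integral_indic (vol n)); last first.
  by apply: measurable_preimage => //; apply: measurable_addmx.
by apply: eq_integral => x _; rewrite (indic_preimage (fun x => x + t)).
Qed.

Lemma measurable_slice a b (A : set 'rV[R]_(a + b)) (x : 'rV[R]_a) :
  measurable A -> measurable [set v | A (row_mx x v)].
Proof. by apply: measurable_preimage; exact: measurable_row_mxr. Qed.

Lemma measurable_sliceC a b (A : set 'rV[R]_(a + b)) (v : 'rV[R]_b) :
  measurable A -> measurable [set x | A (row_mx x v)].
Proof. by apply: measurable_preimage; exact: measurable_row_mxl. Qed.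

Lemma measurable_vol_slice a b (A : set 'rV[R]_(a + b)) : measurable A ->
  measurable_fun setT (fun x => vol b [set v | A (row_mx x v)]).
Proof.
move=> mA.
have mB : measurable [set p : 'rV[R]_a * 'rV[R]_b | A (row_mx p.1 p.2)].
  by apply: measurable_preimage => //; exact: measurable_row_mx2.
rewrite (_ : (fun x => _) = vol b \o xsection [set p | A (row_mx p.1 p.2)]).
  exact: measurable_fun_xsection.
by apply/funext => x /=; congr (vol b _); apply/seteqP; split => v /=;
  rewrite xsectionE /=.
Qed.

Lemma measurable_vol_sliceC a b (A : set 'rV[R]_(a + b)) : measurable A ->
  measurable_fun setT (fun v => vol a [set x | A (row_mx x v)]).
Proof.
move=> mA.
have mB : measurable [set p : 'rV[R]_a * 'rV[R]_b | A (row_mx p.1 p.2)].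
  by apply: measurable_preimage => //; exact: measurable_row_mx2.
rewrite (_ : (fun x => _) = vol a \o ysection [set p | A (row_mx p.1 p.2)]).
  exact: measurable_fun_ysection.
by apply/funext => x /=; congr (vol a _); apply/seteqP; split => v /=;
  rewrite ysectionE /=.
Qed.

Lemma vol_row_mx a b (A : set 'rV[R]_(a + b)) : measurable A ->
  vol (a + b) A = (\int[vol a]_x vol b [set v | A (row_mx x v)])%E.
Proof.
move=> mA; rewrite measure_integral_indic// integral_vol_row_mx//; last first.
  exact: measurable_EFin_indic.
apply: eq_integral => x _; rewrite measure_integral_indic; last exact: measurable_slice.
by apply: eq_integral => v _; rewrite indic_preimage.
Qed.

Lemma vol_row_mxC a b (A : set 'rV[R]_(a + b)) : measurable A ->
  vol (a + b) A = (\int[vol b]_v vol a [set x | A (row_mx x v)])%E.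
Proof.
move=> mA; rewrite measure_integral_indic// integral_vol_row_mxC//; last first.
  exact: measurable_EFin_indic.
apply: eq_integral => x _; rewrite measure_integral_indic; last exact: measurable_sliceC.
by apply: eq_integral => v _; rewrite (indic_preimage (fun v => row_mx v x)).
Qed.

Lemma measurable_row_cons_slice n (A : set 'rV[R]_n.+1) (v : 'rV[R]_n) :
  measurable A -> measurable [set x : Rm | A (row_cons (x, v))].
Proof. by apply: measurable_preimage; exact: measurable_row_consl. Qed.

Lemma measurable_lebesgue_slice n (A : set 'rV[R]_n.+1) : measurable A ->
  measurable_fun setT (fun v => leb [set x | A (row_cons (x, v))]).
Proof.
move=> mA.
have mB : measurable [set p : Rm * 'rV[R]_n | A (row_cons p)].
  by apply: measurable_preimage => //; exact: measurable_row_cons.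
rewrite (_ : (fun x => _) = leb \o ysection [set p | A (row_cons p)]).
  exact: measurable_fun_ysection.
by apply/funext => x /=; congr (leb _); apply/seteqP; split => v /=;
  rewrite ysectionE /=.
Qed.

Lemma vol_cons n (A : set 'rV[R]_n.+1) : measurable A ->
  vol n.+1 A = (\int[vol n]_v leb [set x | A (row_cons (x, v))])%E.
Proof.
move=> mA; rewrite measure_integral_indic// integral_vol_consC//; last exact: measurable_EFin_indic.
apply: eq_integral => v _.
rewrite [RHS]measure_integral_indic; last exact: measurable_row_cons_slice.
by apply: eq_integral => x _; rewrite (indic_preimage (fun x => row_cons (x, v))).
Qed.

Lemma measurable_norm_ball n (M : R) : measurable [set x : 'rV[R]_n | `|x| <= M].
Proof. by apply: closed_measurable_mx; exact: closed_norm_ball. Qed.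

Lemma norm_row_cons_le n (x : Rm) (v : 'rV[R]_n) (M : R) : 0 <= M ->
  (`|row_cons (x, v)| <= M) = (`|x| <= M) && (`|v| <= M).
Proof.
move=> M0; apply/idP/andP => [xvM|[xM vM]].
  have coord i := le_trans (coord_le_norm (row_cons (x, v)) i) xvM.
  split; first by rewrite -(row_cons_head x v).
  apply/norm_rV_leP => // i; have := coord (rshift 1 i).
  by rewrite /row_cons /= (@row_mxEr _ 1 1 n).
apply: (@norm_row_mx_le R 1 n) => //.
by apply/norm_rV_leP => // i; rewrite mxE.
Qed.

Lemma lebesgue_norm_ball (M : R) : 0 <= M -> leb [set x : Rm | `|x| <= M] = (2 * M)%:E.
Proof.
move=> M0; rewrite (_ : mkset _ = `[- M, M]%classic); last first.
  by apply/seteqP; split => x /=; rewrite in_itv /= -ler_norml.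
rewrite lebesgue_measure_itv/= lte_fin; case: ltP => h.
  by rewrite -EFinD; congr EFin; lra.
by congr EFin; lra.
Qed.

Lemma vol_norm_ball n (M : R) : 0 <= M ->
  vol n [set x | `|x| <= M] = ((2 * M) ^+ n)%:E.
Proof.
move=> M0; elim: n => [|n IH].
  rewrite (_ : mkset _ = setT); last first.
    by apply/seteqP; split => // x _; apply/norm_rV_leP => // -[].
  rewrite measure_integral_indic// integral_vol0//; last exact: measurable_EFin_indic.
  by rewrite indicE in_setT expr0.
have mB := @measurable_norm_ball n M.
rewrite vol_cons; last exact: measurable_norm_ball.
transitivity (\int[vol n]_v ((2 * M)%:E * (\1_[set v | (`|v| <= M)%R] v)%:E))%E.
  apply: eq_integral => v _; rewrite indicE.
  have [/set_mem /= vM|/negP vM] := boolP (v \in _).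
    rewrite mule1 -(lebesgue_norm_ball M0); congr (leb _).
    by apply/seteqP; split => x /=; rewrite norm_row_cons_le// vM andbT.
  rewrite mule0 (_ : mkset _ = set0) ?measure0//; apply/seteqP; split => // x /=.
  by rewrite norm_row_cons_le// => /andP[_ ?]; apply: vM; exact/mem_set.
rewrite ge0_integralZl//; last 2 first.
- exact: measurable_EFin_indic.
- by rewrite lee_fin mulr_ge0.
by rewrite integral_indic// setIT exprS [RHS]EFinM; congr (_ * _)%E; exact: IH.
Qed.

Lemma vol_norm_ball_lty n (M : R) : (vol n [set x | (`|x| <= M)%R] < +oo)%E.
Proof.
apply: (@le_lt_trans _ _ (vol n [set x | `|x| <= `|M|])); last by rewrite vol_norm_ball// ltry.
apply: le_measure; rewrite ?inE; [exact: measurable_norm_ball..|].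
by move=> x /le_trans; apply; exact: ler_norm.
Qed.

Lemma vol_compact_lty n (A : set 'rV[R]_n) : compact A -> (vol n A < +oo)%E.
Proof.
move=> cA; have [M _ AM] := compact_norm_le cA.
apply: le_lt_trans (vol_norm_ball_lty n M); apply: le_measure; rewrite ?inE//.
  exact: compact_measurable_mx.
exact: measurable_norm_ball.
Qed.

Lemma vol_compact_fin_num n (A : set 'rV[R]_n) : compact A -> vol n A \is a fin_num.
Proof. by move=> cA; rewrite ge0_fin_numE//; exact: vol_compact_lty. Qed.

Lemma vol_interior_gt0 n (A : set 'rV[R]_n) : measurable A -> A° !=set0 ->
  (0 < vol n A)%E.
Proof.
move=> mA [x /nbhs_ballP[e /= e0 xeA]].
rewrite -(vol_shift x)//.
apply: (@lt_le_trans _ _ (vol n [set y | `|y| <= e / 2])).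
  by rewrite vol_norm_ball ?divr_ge0 ?ltW// lte_fin exprn_gt0// mulr_gt0// divr_gt0.
apply: le_measure; rewrite ?inE; first exact: measurable_norm_ball.
  by apply: measurable_preimage => //; apply: measurable_addmx.
move=> y /= ye; apply: xeA; rewrite -ball_normE /= opprD addrCA subrr addr0 normrN.
by rewrite (le_lt_trans ye)// ltr_pdivrMr// ltr_pMr// ltr1n.
Qed.

Lemma ae_vol_exists n (A : set 'rV[R]_n) : {ae vol n, forall x, A x} -> exists x, A x.
Proof.
move=> aeA; have [] := ae_exists_in aeA measurableT; last by move=> x _; exists x.
by apply: vol_interior_gt0 => //; exists 0; exact: filterT.
Qed.

Lemma vol0_segments n (S : set 'rV[R]_n) (a : 'rV[R]_n) : measurable S ->
  (forall v, leb [set l : Rm | (0 <= l <= 1)%R /\ S (v + l *: a)%R] = 0%E) ->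
  vol n S = 0%E.
Proof.
move=> mS S0.
pose X : set (Rm * 'rV[R]_n) := [set p | (0 <= p.1 <= 1) /\ S (p.2 + p.1 *: a)].
have mX : measurable X.
  apply: measurableI.
    rewrite [X in measurable X](_ : _ = [set p : Rm * 'rV[R]_n | `[0, 1]%classic p.1]).
      by apply: measurable_preimage; [exact: measurable_fst|].
    by apply/seteqP; split => p /=; rewrite in_itv/=.
  apply: measurable_preimage => //.
  apply: measurable_addmx; first exact: measurable_snd.
  by apply: measurable_scalemx => //; exact: measurable_fst.
have := @fubini_tonelli _ _ _ _ R leb (vol n) (fun p => (\1_X p)%:E) (measurable_EFin_indic mX).
move=> /(_ (fun x => ltac:(by rewrite lee_fin))) E.
transitivity (\int[leb]_x \int[vol n]_v (\1_X (x, v))%:E)%E; last first.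
  rewrite E; apply: integral0_eq => v _; rewrite -[RHS](S0 v).
  rewrite (measure_integral_indic leb); last first.
    rewrite (_ : mkset _ = [set l : Rm | X (l, v)])//.
    by apply: measurable_preimage => //; exact: pair2_measurable.
  by apply: eq_integral => l _; rewrite (indic_preimage (fun l => (l, v))).
transitivity (\int[leb]_x ((\1_(`[0%R, 1%R]%classic : set Rm) x)%:E * vol n S))%E.
  rewrite ge0_integralZr//; last exact: measurable_EFin_indic.
  rewrite [X in (_ = X * _)%E](_ : _ = 1%E) ?mul1e// integral_indic// setIT.
  have : leb (`[0%R, 1%R]%classic : set R) = 1%E.
    by rewrite lebesgue_measure_itv/= lte01 -EFinD subr0.
  exact.
apply: eq_integral => l _; rewrite indicE.
have [/set_mem /=|/negP] := boolP (l \in (`[0, 1]%classic : set Rm)).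
  rewrite in_itv/= => l01; rewrite mul1e -(vol_shift (l *: a))//.
  rewrite measure_integral_indic//; last first.
    by apply: measurable_preimage => //; apply: measurable_addmx.
  apply: eq_integral => v _; congr (_%:E); rewrite !indicE; congr (_%:R).
  by congr nat_of_bool; apply/idP/idP => /set_mem h; apply/mem_set => //; case: h.
rewrite inE/= in_itv/= => l01; rewrite mul0e integral0_eq// => v _.
by rewrite indicE memNset//; case.
Qed.

Lemma mulmx_tr_eq0C m j n (W : 'M[R]_(m, n)) (U : 'M[R]_(j, n)) :
  W *m U^T = 0 -> U *m W^T = 0.
Proof. by move=> WU; apply: trmx_inj; rewrite trmx_mul trmxK WU trmx0. Qed.

Definition frame m j n (W : 'M[R]_(m, n)) (U : 'M[R]_(j, n)) : Prop :=
  [/\ orthonormal W, orthonormal U & W *m U^T = 0].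

Lemma frameC m j n (W : 'M[R]_(m, n)) (U : 'M[R]_(j, n)) :
  frame W U -> frame U W.
Proof. by move=> [WW UU /mulmx_tr_eq0C]. Qed.

Lemma frame_col_mx m j n (W : 'M[R]_(m, n)) (U : 'M[R]_(j, n)) :
  frame W U -> orthonormal (col_mx W U).
Proof.
move=> [WW UU WU]; rewrite /orthonormal tr_col_mx mul_col_row WW UU WU.
by rewrite (mulmx_tr_eq0C WU) -scalar_mx_block.
Qed.

Lemma frame_resolution m j n (W : 'M[R]_(m, n)) (U : 'M[R]_(j, n)) :
  n = (m + j)%N -> frame W U -> W^T *m W + U^T *m U = 1%:M.
Proof.
move=> nE fr; subst n.
by have := mulmx1C (frame_col_mx fr); rewrite tr_col_mx mul_row_col.
Qed.

Lemma frame_decomp m j n (W : 'M[R]_(m, n)) (U : 'M[R]_(j, n)) (x : 'rV[R]_n) :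
  n = (m + j)%N -> frame W U -> x *m W^T *m W + x *m U^T *m U = x.
Proof.
by move=> nE fr; rewrite -!mulmxA -mulmxDr (frame_resolution nE fr) mulmx1.
Qed.

Lemma measurable_frame_map m j n (W : 'M[R]_(m, n)) (U : 'M[R]_(j, n))
    (t : 'rV[R]_j) :
  measurable_fun setT (fun y : 'rV[R]_m => y *m W + t *m U).
Proof. by apply: measurable_addmx => //; exact: measurable_mulmxr. Qed.

Lemma vol_frame_coords m j n (W : 'M[R]_(m, n)) (U : 'M[R]_(j, n)) (A : set 'rV[R]_n) :
  n = (m + j)%N -> frame W U -> measurable A ->
  vol n A = vol (m + j) [set z | A (lsubmx z *m W + rsubmx z *m U)].
Proof.
move=> nE fr mA; subst n; rewrite -(vol_orthogonal (frame_col_mx fr) mA).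
have zE (z : 'rV[R]_(m + j)) : z *m col_mx W U = lsubmx z *m W + rsubmx z *m U.
  by rewrite -{1}[z]hsubmxK mul_row_col.
by congr (vol _ _); apply/seteqP; split => z /=; rewrite zE.
Qed.

Lemma measurable_frame_coords m j n (W : 'M[R]_(m, n)) (U : 'M[R]_(j, n)) (A : set 'rV[R]_n) :
  measurable A -> measurable [set z : 'rV[R]_(m + j) | A (lsubmx z *m W + rsubmx z *m U)].
Proof.
apply: measurable_preimage; apply: measurable_addmx; apply: measurable_mulmxr.
  exact: (measurable_lsubmx (f := fun z : 'rV[R]_(m + j) => z)).
exact: (measurable_rsubmx (f := fun z : 'rV[R]_(m + j) => z)).
Qed.

Lemma vol_frame m j n (W : 'M[R]_(m, n)) (U : 'M[R]_(j, n)) (A : set 'rV[R]_n) :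
  n = (m + j)%N -> frame W U -> measurable A ->
  vol n A = (\int[vol j]_t vol m [set y | A (y *m W + t *m U)%R])%E.
Proof.
move=> nE fr mA; rewrite (vol_frame_coords nE fr mA) vol_row_mxC; last first.
  exact: measurable_frame_coords.
by apply: eq_integral => t _; congr (vol m _); apply/seteqP; split => y /=;
  rewrite row_mxKl row_mxKr.
Qed.

Lemma measurable_vol_frame m j n (W : 'M[R]_(m, n)) (U : 'M[R]_(j, n))
  (A : set 'rV[R]_n) : measurable A ->
  measurable_fun setT (fun t => vol m [set y | A (y *m W + t *m U)%R]).
Proof.
move=> mA; apply: eq_measurable_fun (measurable_vol_sliceC (measurable_frame_coords W U mA)) => t _.
by congr (vol m _); apply/seteqP; split => y /=; rewrite row_mxKl row_mxKr.
Qed.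

Lemma vol_dilate_left m j (r : R) (A : set 'rV[R]_(m + j)) : 0 < r -> measurable A ->
  ((r ^+ m)%:E * vol (m + j) [set z | A (row_mx (r *: lsubmx z) (rsubmx z))] =
   vol (m + j) A)%E.
Proof.
move=> r0 mA; pose T : 'M[R]_(m + j) := block_mx r%:M 0 0 1%:M.
have detT : \det T = r ^+ m by rewrite det_ublock det_scalar det1 mulr1.
have uT : T \in unitmx by rewrite unitmxE detT unitfE expf_neq0// gt_eqF.
rewrite -(vol_linear uT mA) detT ger0_norm ?exprn_ge0 ?ltW//; congr (_ * vol _ _)%E.
apply/seteqP; split => z /=; rewrite -[z in z *m T]hsubmxK mul_row_block;
  by rewrite !mulmx0 addr0 add0r mulmx1 mul_mx_scalar.
Qed.

End SetMeasure.

(** * Euclidean geometry *)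

Section Euclid.
Variable R : realType.
Implicit Types (m n : nat).

Lemma dotvE n (x y : 'rV[R]_n) : dotv x y = \sum_i x 0 i * y 0 i.
Proof. by rewrite /dotv mxE; apply: eq_bigr => i _; rewrite mxE. Qed.

Lemma dotvC n (x y : 'rV[R]_n) : dotv x y = dotv y x.
Proof. by rewrite !dotvE; apply: eq_bigr => i _; rewrite mulrC. Qed.

Lemma dotvDl n (x y z : 'rV[R]_n) : dotv (x + y) z = dotv x z + dotv y z.
Proof. by rewrite /dotv mulmxDl mxE. Qed.

Lemma dotvDr n (x y z : 'rV[R]_n) : dotv x (y + z) = dotv x y + dotv x z.
Proof. by rewrite dotvC dotvDl !(dotvC _ x). Qed.

Lemma dotvZl n a (x y : 'rV[R]_n) : dotv (a *: x) y = a * dotv x y.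
Proof. by rewrite /dotv -scalemxAl mxE. Qed.

Lemma dotvZr n a (x y : 'rV[R]_n) : dotv x (a *: y) = a * dotv x y.
Proof. by rewrite dotvC dotvZl dotvC. Qed.

Lemma dotvNl n (x y : 'rV[R]_n) : dotv (- x) y = - dotv x y.
Proof. by rewrite -scaleN1r dotvZl mulN1r. Qed.

Lemma dotvNr n (x y : 'rV[R]_n) : dotv x (- y) = - dotv x y.
Proof. by rewrite dotvC dotvNl dotvC. Qed.

Lemma dotvBl n (x y z : 'rV[R]_n) : dotv (x - y) z = dotv x z - dotv y z.
Proof. by rewrite dotvDl dotvNl. Qed.

Lemma dotvBr n (x y z : 'rV[R]_n) : dotv x (y - z) = dotv x y - dotv x z.
Proof. by rewrite dotvDr dotvNr. Qed.

Lemma dotv0l n (x : 'rV[R]_n) : dotv 0 x = 0.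
Proof. by rewrite /dotv mul0mx mxE. Qed.

Lemma dotv0r n (x : 'rV[R]_n) : dotv x 0 = 0.
Proof. by rewrite dotvC dotv0l. Qed.

Lemma dotv_suml n I (r : seq I) (P : pred I) (f : I -> 'rV[R]_n) (z : 'rV[R]_n) :
  dotv (\sum_(i <- r | P i) f i) z = \sum_(i <- r | P i) dotv (f i) z.
Proof.
elim/big_rec2: _ => [|i y x _ <-]; first exact: dotv0l.
by rewrite dotvDl.
Qed.

Definition dotvD := (dotvDl, dotvDr, dotvBl, dotvBr, dotvZl, dotvZr, dotvNl, dotvNr).

Lemma dotv_mulmx m n (x : 'rV[R]_m) (A : 'M[R]_(m, n)) (y : 'rV[R]_n) :
  dotv (x *m A) y = dotv x (y *m A^T).
Proof. by rewrite /dotv trmx_mul trmxK mulmxA. Qed.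

Lemma dotv_mulmxr m n (x : 'rV[R]_n) (A : 'M[R]_(m, n)) (y : 'rV[R]_m) :
  dotv x (y *m A) = dotv (x *m A^T) y.
Proof. by rewrite dotvC dotv_mulmx dotvC. Qed.

Lemma mul_trmx_dotv n (x y : 'rV[R]_n) : x *m y^T = (dotv x y)%:M.
Proof. by rewrite [LHS]mx11_scalar. Qed.

Lemma dotv_ge0 n (x : 'rV[R]_n) : 0 <= dotv x x.
Proof. by rewrite dotvE sumr_ge0// => i _; rewrite -expr2 sqr_ge0. Qed.

Lemma dotv_eq0 n (x : 'rV[R]_n) : (dotv x x == 0) = (x == 0).
Proof.
apply/eqP/eqP => [|->]; last by rewrite dotv0l.
rewrite dotvE => /eqP; rewrite psumr_eq0; last first.
  by move=> i _; rewrite -expr2 sqr_ge0.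
move=> /allP h; apply/rowP => i; rewrite mxE.
by have /= := h i (mem_index_enum _); rewrite -expr2 sqrf_eq0 => /eqP.
Qed.

Lemma dotv_gt0 n (x : 'rV[R]_n) : (0 < dotv x x) = (x != 0).
Proof. by rewrite lt_neqAle dotv_ge0 andbT eq_sym dotv_eq0. Qed.

Lemma enorm_ge0 n (x : 'rV[R]_n) : 0 <= enorm x.
Proof. exact: sqrtr_ge0. Qed.

Lemma enorm_sq n (x : 'rV[R]_n) : enorm x ^+ 2 = dotv x x.
Proof. by rewrite /enorm sqr_sqrtr// dotv_ge0. Qed.

Lemma enorm_eq0 n (x : 'rV[R]_n) : (enorm x == 0) = (x == 0).
Proof. by rewrite -dotv_eq0 -enorm_sq sqrf_eq0. Qed.

Lemma enorm_gt0 n (x : 'rV[R]_n) : (0 < enorm x) = (x != 0).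
Proof. by rewrite lt_neqAle enorm_ge0 andbT eq_sym enorm_eq0. Qed.

Lemma enorm0 n : enorm (0 : 'rV[R]_n) = 0.
Proof. by apply/eqP; rewrite enorm_eq0. Qed.

Lemma enormZ n a (x : 'rV[R]_n) : enorm (a *: x) = `|a| * enorm x.
Proof.
by rewrite /enorm dotvZl dotvZr mulrA -expr2 sqrtrM ?sqr_ge0// sqrtr_sqr.
Qed.

Lemma enormN n (x : 'rV[R]_n) : enorm (- x) = enorm x.
Proof. by rewrite -scaleN1r enormZ normrN normr1 mul1r. Qed.

Lemma cauchy_schwarz_sq n (x y : 'rV[R]_n) :
  dotv x y ^+ 2 <= dotv x x * dotv y y.
Proof.
have [->|y0] := eqVneq y 0; first by rewrite !dotv0r expr2 !mulr0.
have yy : 0 < dotv y y by rewrite dotv_gt0.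
have := dotv_ge0 (dotv y y *: x - dotv x y *: y).
rewrite !dotvD (dotvC y x) => h.
rewrite -(ler_pM2l yy).
have -> : dotv y y * (dotv x y ^+ 2) = dotv x y * dotv x y * dotv y y by ring.
nra.
Qed.

Lemma cauchy_schwarz n (x y : 'rV[R]_n) : dotv x y <= enorm x * enorm y.
Proof.
rewrite (le_trans (ler_norm _))// -sqrtr_sqr /enorm -sqrtrM ?dotv_ge0//.
by rewrite ler_wsqrtr// cauchy_schwarz_sq.
Qed.

Lemma ler_enormD n (x y : 'rV[R]_n) : enorm (x + y) <= enorm x + enorm y.
Proof.
rewrite -(@ler_pXn2r _ 2)//; last 2 first.
- by rewrite nnegrE enorm_ge0.
- by rewrite nnegrE addr_ge0// enorm_ge0.
rewrite enorm_sq sqrrD !enorm_sq !dotvD (dotvC y x).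
have := cauchy_schwarz x y; lra.
Qed.

Lemma enorm_dotv1 n (x : 'rV[R]_n) : enorm x = 1 -> dotv x x = 1.
Proof. by move=> x1; rewrite -enorm_sq x1 expr1n. Qed.

Lemma ler_enorm n (x y : 'rV[R]_n) : (enorm x <= enorm y) = (dotv x x <= dotv y y).
Proof. by rewrite ler_sqrt// dotv_ge0. Qed.

Lemma abs_dotv_le n (x y : 'rV[R]_n) : `|dotv x y| <= enorm x * enorm y.
Proof.
rewrite ler_norml cauchy_schwarz andbT lerNl -dotvNl.
by rewrite (le_trans (cauchy_schwarz _ _))// enormN.
Qed.

Lemma dotv_le_unit n (x w : 'rV[R]_n) : enorm w = 1 -> dotv x w <= enorm x.
Proof. by move=> w1; rewrite (le_trans (cauchy_schwarz _ _))// w1 mulr1. Qed.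

Lemma dotv_delta n (x : 'rV[R]_n) i : dotv x (delta_mx 0 i) = x 0 i.
Proof.
rewrite dotvE (bigD1 i)//= mxE !eqxx mulr1 big1 ?addr0// => k /negbTE ki.
by rewrite mxE ki andbF mulr0.
Qed.

Lemma norm_le_enorm n (x : 'rV[R]_n) : `|x| <= enorm x.
Proof.
apply/norm_rV_leP => [|i]; first exact: enorm_ge0.
rewrite -sqrtr_sqr /enorm ler_wsqrtr// dotvE (bigD1 i)//= -expr2 lerDl.
by rewrite sumr_ge0// => k _; rewrite -expr2 sqr_ge0.
Qed.

Lemma enorm_le_norm n (x : 'rV[R]_n) : enorm x <= n%:R * `|x|.
Proof.
have nx : 0 <= n%:R * `|x| by rewrite mulr_ge0.
rewrite -(@ler_pXn2r _ 2)// ?nnegrE ?enorm_ge0// enorm_sq dotvE.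
case: n x nx => [|n] x nx; first by rewrite big_ord0 mul0r expr2 mul0r.
apply: (@le_trans _ _ (\sum_(i < n.+1) `|x| ^+ 2)).
  apply: ler_sum => i _; rewrite -expr2.
  rewrite -[x 0 i ^+ 2]ger0_norm ?sqr_ge0// normrX ler_pXn2r// ?nnegrE//.
  exact: coord_le_norm.
rewrite sumr_const card_ord exprMn -(mulr_natl (`|x| ^+ 2)) ler_wpM2r ?sqr_ge0//.
by rewrite -natrX ler_nat -{1}(expn1 n.+1) leq_pexp2l.
Qed.

Definition normalize n (x : 'rV[R]_n) : 'rV[R]_n := (enorm x)^-1 *: x.

Lemma normalizeK n (x : 'rV[R]_n) : enorm x *: normalize x = x.
Proof.
have [->|x0] := eqVneq x 0; first by rewrite /normalize !scaler0.
by rewrite scalerA mulfV ?scale1r// enorm_eq0.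
Qed.

Lemma enorm_normalize n (x : 'rV[R]_n) : x != 0 -> enorm (normalize x) = 1.
Proof.
by move=> x0; rewrite enormZ ger0_norm ?invr_ge0 ?enorm_ge0// mulVf// enorm_eq0.
Qed.

Lemma orthonormal_rV n (u : 'rV[R]_n) : orthonormal u <-> enorm u = 1.
Proof.
rewrite /orthonormal mul_trmx_dotv; split=> [/matrixP/(_ 0 0)|/enorm_dotv1 -> //].
by rewrite !mxE eqxx !mulr1n /enorm => ->; rewrite sqrtr1.
Qed.

Lemma mulmx_tr_dotv0 n (x y : 'rV[R]_n) : x *m y^T = 0 -> dotv x y = 0.
Proof. by rewrite /dotv => ->; rewrite mxE. Qed.

Lemma dotv_orthonormal m n (W : 'M[R]_(m, n)) (u v : 'rV[R]_m) : orthonormal W ->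
  dotv (u *m W) (v *m W) = dotv u v.
Proof. by move=> WW; rewrite dotv_mulmx -mulmxA WW mulmx1. Qed.

Lemma enorm_orthonormal m n (W : 'M[R]_(m, n)) (u : 'rV[R]_m) : orthonormal W ->
  enorm (u *m W) = enorm u.
Proof. by move=> WW; rewrite /enorm dotv_orthonormal. Qed.

Lemma dotv_frame m j n (W : 'M[R]_(m, n)) (U : 'M[R]_(j, n)) (y : 'rV[R]_m) (t : 'rV[R]_j) :
  frame W U -> dotv (y *m W) (t *m U) = 0.
Proof. by move=> [_ _ /mulmx_tr_eq0C UW]; rewrite dotv_mulmx -mulmxA UW mulmx0 dotv0r. Qed.

Lemma frame_coordl m j n (W : 'M[R]_(m, n)) (U : 'M[R]_(j, n)) y t : frame W U ->
  (y *m W + t *m U : 'rV[R]_n) *m W^T = y.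
Proof.
by move=> [WW _ /mulmx_tr_eq0C UW]; rewrite mulmxDl -!mulmxA WW UW mulmx1 mulmx0 addr0.
Qed.

Lemma frame_coordr m j n (W : 'M[R]_(m, n)) (U : 'M[R]_(j, n)) y t : frame W U ->
  (y *m W + t *m U : 'rV[R]_n) *m U^T = t.
Proof. by move=> [_ UU WU]; rewrite mulmxDl -!mulmxA UU WU mulmx1 mulmx0 add0r. Qed.

Lemma continuous_dotv (T : topologicalType) n (f g : T -> 'rV[R]_n) :
  continuous f -> continuous g -> continuous (fun t => dotv (f t) (g t)).
Proof.
move=> cf cg; apply: continuous_coord; apply: continuous_mulmx => //.
apply: continuous_mx => i j; rewrite (_ : (fun t => _) = fun t => g t j i).
  exact: continuous_coord.
by apply/funext => t; rewrite mxE.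
Qed.

Lemma continuous_dotvl n (u : 'rV[R]_n) : continuous (fun x => dotv x u).
Proof. by apply: continuous_dotv; [exact: continuous_id|exact: cst_continuous]. Qed.

Lemma continuous_enorm (T : topologicalType) n (f : T -> 'rV[R]_n) :
  continuous f -> continuous (fun t => enorm (f t)).
Proof.
move=> cf x; apply: (@continuous_comp _ _ _ (fun t => dotv (f t) (f t)) Num.sqrt).
  exact: (continuous_dotv cf cf).
exact: sqrt_continuous.
Qed.

Lemma lipschitz_enorm_continuous n (f : 'rV[R]_n -> R) B : 0 < B ->
  (forall x y, `|f x - f y| <= B * enorm (x - y)) -> continuous f.
Proof.
move=> B0 lip x; apply/(@cvgrPdist_le R R^o _ (nbhs x) (nbhs_filter x)) => e e0.
have c_dist : continuous (fun y : 'rV[R]_n => enorm (x - y)).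
  by apply: continuous_enorm; apply: continuous_sub; [exact: cst_continuous|exact: continuous_id].
have lt_e : enorm (x - x) < e / B by rewrite subrr enorm0 divr_gt0.
have near_x := c_dist x _ (lt_nbhsl lt_e).
apply: (@filterS _ (nbhs x) (nbhs_filter x) _ _ _ near_x) => y /ltW.
by rewrite ler_pdivlMr// mulrC => xy; exact: le_trans xy.
Qed.

Lemma compact_enorm_le n (X : set 'rV[R]_n) : compact X ->
  exists2 B : R, 0 < B & forall x, X x -> enorm x <= B.
Proof.
move=> cX; have [M M0 MX] := compact_norm_le cX.
exists (n%:R * M + 1); first by rewrite ltr_wpDl// mulr_ge0// ltW.
move=> x Xx; apply: (le_trans (enorm_le_norm x)).
by rewrite -[leLHS]addr0 lerD// ler_wpM2l// MX.
Qed.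

Definition eball n (r : R) : set 'rV[R]_n := [set x | enorm x <= r].

Lemma compact_eball n (r : R) : compact (@eball n r).
Proof.
apply: (closed_sub_compact (@compact_norm_ball R n r)).
  by apply: closed_le_fun; [exact/continuous_enorm/continuous_id|exact: cst_continuous].
by move=> u ur; exact: le_trans (norm_le_enorm u) ur.
Qed.

Lemma measurable_eball n (r : R) : measurable (@eball n r).
Proof. by apply: compact_measurable_mx; exact: compact_eball. Qed.

Lemma vol_eball_at_gt0 n (a : 'rV[R]_n) (d : R) : 0 < d ->
  (0 < vol R n [set x | eball d (x - a)%R])%E.
Proof.
move=> d0; rewrite (vol_shift (- a) (@measurable_eball n d)).
apply: vol_interior_gt0; first exact: measurable_eball.
exists 0; have /(_ 0) c0 := @continuous_enorm _ n _ (@continuous_id 'rV[R]_n).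
have : nbhs (enorm (0 : 'rV[R]_n)) [set r : R | r < d].
  by rewrite enorm0; exact: open_nbhs_nbhs (conj (@open_lt R d) d0).
move=> /c0 near0.
apply: (@filterS _ (nbhs (0 : 'rV[R]_n)) (nbhs_filter _) _ (eball d) _ near0) => x.
by move=> /ltW.
Qed.

Lemma kappaE n : vol R n (eball 1) = (kappa R n)%:E.
Proof.
rewrite /kappa volnE; last exact: measurable_eball.
by rewrite fineK// vol_compact_fin_num//; exact: compact_eball.
Qed.

Lemma kappa_gt0 n : 0 < kappa R n.
Proof.
rewrite -lte_fin -kappaE; have := @vol_eball_at_gt0 n 0 1 ltr01.
by rewrite (_ : mkset _ = eball 1)//; apply/seteqP; split => x /=; rewrite subr0.
Qed.

Lemma closed_hyperplane n (a c : 'rV[R]_n) : closed [set x : 'rV[R]_n | dotv (x - a) c = 0].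
Proof.
apply: (@closed_preimage _ _ (fun x : 'rV[R]_n => dotv (x - a) c) [set r | r = 0]);
  last exact: closed_eq.
apply: continuous_dotv; last exact: cst_continuous.
by apply: continuous_sub; [exact: continuous_id|exact: cst_continuous].
Qed.

Lemma vol_hyperplane0 n (a c : 'rV[R]_n) : c != 0 ->
  vol R n [set x | dotv (x - a) c = 0] = 0%E.
Proof.
move=> c0; apply: (@vol0_segments R n _ c).
  by apply: closed_measurable_mx; exact: closed_hyperplane.
move=> v; apply: countable_lebesgue_measure0; apply: finite_set_countable.
apply: (@sub_finite_set _ _ [set - dotv (v - a) c / dotv c c]) => // l [_ /=].
rewrite addrAC dotvDl dotvZl => lE.
have -> : dotv (v - a) c = - (l * dotv c c) by lra.
by rewrite opprK mulfK// gt_eqF// dotv_gt0.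
Qed.

Lemma ae_neq0 n : {ae vol R n.+1, forall x : 'rV[R]_n.+1, x != 0}.
Proof.
pose c : 'rV[R]_n.+1 := const_mx 1.
have c0 : c != 0.
  by apply/eqP => /rowP/(_ 0); rewrite !mxE; apply/eqP; exact: oner_neq0.
exists [set x | dotv (x - 0) c = 0]; split.
- by apply: closed_measurable_mx; exact: closed_hyperplane.
- exact: vol_hyperplane0.
- by move=> x /= /negP; rewrite negbK => /eqP ->; rewrite subr0 dotv0l.
Qed.

End Euclid.

Section SupportFunction.
Variables (R : realType) (n : nat).
Implicit Types (K X : set 'rV[R]_n) (u v c x y : 'rV[R]_n).

Definition face K u : set 'rV[R]_n :=
  [set x | K x /\ forall y, K y -> dotv y u <= dotv x u].

Lemma face_nonempty K u : compact K -> K !=set0 -> face K u !=set0.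
Proof.
move=> cK K0; have [x Kx xm] := compact_argmax cK K0 (@continuous_dotvl R n u).
by exists x.
Qed.

Lemma convex_face K u : convex_set K -> convex_set (face K u).
Proof.
move=> cK x y t [Kx xm] [Ky ym] t01; split; first exact: cK.
move=> z Kz; rewrite dotvDl !dotvZl.
have := xm _ Kz; have := ym _ Kz; case/andP: t01 => t0 t1; nra.
Qed.

Lemma faceZ K u (a : R) : 0 < a -> face K (a *: u) = face K u.
Proof.
move=> a0; apply/seteqP; split => x [Kx xm]; split => // y Ky; have := xm y Ky;
  by rewrite !dotvZr ler_pM2l.
Qed.

Lemma face_normalize K u : u != 0 -> face K (normalize u) = face K u.
Proof. by move=> u0; rewrite faceZ// invr_gt0 enorm_gt0. Qed.

Definition support_fun K c : R := sup [set dotv x c | x in K].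

Lemma support_fun_face K c x : face K c x -> support_fun K c = dotv x c.
Proof.
move=> [Kx xm]; apply/eqP; rewrite eq_le; apply/andP; split.
  by apply: ge_sup; [exists (dotv x c), x|move=> _ [y Ky <-]; exact: xm].
apply: ub_le_sup; last by exists x.
by exists (dotv x c) => _ [y Ky <-]; exact: xm.
Qed.

Lemma support_fun_ge K c x : compact K -> K x -> dotv x c <= support_fun K c.
Proof.
move=> cK Kx; have [y fy] : face K c !=set0 by apply: face_nonempty => //; exists x.
by rewrite (support_fun_face fy); case: fy => _; exact.
Qed.

Lemma support_fun_attained K c : compact K -> K !=set0 ->
  exists2 x, K x & support_fun K c = dotv x c.
Proof.
move=> cK K0; have [x fx] := face_nonempty c cK K0.
by exists x; [case: fx|exact: support_fun_face].
Qed.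

Lemma faceP K u x : compact K -> K !=set0 ->
  face K u x <-> K x /\ support_fun K u <= dotv x u.
Proof.
move=> cK K0; split => [fx|[Kx xu]].
  by case: (fx) => Kx _; rewrite (support_fun_face fx).
by split => // y Ky; exact: (le_trans (support_fun_ge u cK Ky)).
Qed.

(* The supremum of the empty set is 0 by convention. *)
Lemma support_fun_set0 c : support_fun set0 c = 0.
Proof. by rewrite /support_fun image_set0 sup0. Qed.

Lemma support_funZ X c (a : R) : compact X -> 0 < a ->
  support_fun X (a *: c) = a * support_fun X c.
Proof.
move=> cX a0; have [->|/set0P X0] := eqVneq X set0; first by rewrite !support_fun_set0 mulr0.
have [x fx] := face_nonempty c cX X0.
have fx' : face X (a *: c) x by rewrite faceZ.
by rewrite (support_fun_face fx') (support_fun_face fx) dotvZr.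
Qed.

Lemma support_fun_midpoint X u v : compact X ->
  2 * support_fun X u <= support_fun X (u + v) + support_fun X (u - v).
Proof.
move=> cX; have [->|/set0P X0] := eqVneq X set0.
  by rewrite !support_fun_set0 mulr0 addr0.
have [x Xx ->] := support_fun_attained u cX X0.
have := support_fun_ge (u + v) cX Xx; have := support_fun_ge (u - v) cX Xx.
rewrite !dotvD; lra.
Qed.

Lemma support_fun_lipschitz X u v (s B : R) : compact X -> X !=set0 ->
  (forall x, X x -> `|dotv x v| <= B) ->
  `|support_fun X (u + s *: v) - support_fun X u| <= `|s| * B.
Proof.
move=> cX X0 XB.
have [x Xx xE] := support_fun_attained u cX X0.
have [y Xy yE] := support_fun_attained (u + s *: v) cX X0.
have xy := support_fun_ge (u + s *: v) cX Xx; have yx := support_fun_ge u cX Xy.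
have bx : `|s * dotv x v| <= `|s| * B by rewrite normrM ler_wpM2l// XB.
have bY : `|s * dotv y v| <= `|s| * B by rewrite normrM ler_wpM2l// XB.
move: xy yx bx bY; rewrite yE xE !dotvD !ler_norml.
by move=> ? ? /andP[? ?] /andP[? ?]; apply/andP; split; lra.
Qed.

Lemma support_fun_dist X u v (B : R) : compact X -> X !=set0 ->
  (forall x, X x -> enorm x <= B) ->
  `|support_fun X u - support_fun X v| <= B * enorm (u - v).
Proof.
move=> cX X0 XB.
have := @support_fun_lipschitz X v (u - v) 1 (B * enorm (u - v)) cX X0.
rewrite scale1r [v + _]addrC subrK normr1 mul1r; apply => // x Xx.
by apply: (le_trans (abs_dotv_le _ _)); rewrite ler_wpM2r ?enorm_ge0// XB.
Qed.

Lemma continuous_support_fun X : compact X -> X !=set0 -> continuous (support_fun X).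
Proof.
move=> cX X0; have [B B0 XB] := compact_enorm_le cX.
by apply: (lipschitz_enorm_continuous B0) => u v; exact: support_fun_dist.
Qed.

Lemma closed_face (T : topologicalType) K (f g : T -> 'rV[R]_n) :
  compact K -> K !=set0 -> continuous f -> continuous g ->
  closed [set t | face K (f t) (g t)].
Proof.
move=> cK K0 cf cg.
rewrite (_ : mkset _ = [set t | K (g t)] `&` [set t | support_fun K (f t) <= dotv (g t) (f t)]).
  apply: closedI; first exact: (closed_preimage cg (compact_closed_mx cK)).
  apply: closed_le_fun; last exact: (continuous_dotv cg cf).
  by move=> p; apply: continuous_comp; [exact: cf|exact: continuous_support_fun].
by apply/seteqP; split => p /=; [move=> /(faceP _ _ cK K0)|move=> ?; apply/(faceP _ _ cK K0)].
Qed.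

Lemma compact_face K u : compact K -> compact (face K u).
Proof.
move=> cK; have [->|/set0P K0] := eqVneq K set0.
  by rewrite (_ : face _ _ = set0); [exact: compact0|apply/seteqP; split => // x []].
apply: (closed_sub_compact cK); last by move=> x [].
by apply: closed_face => //; [exact: cst_continuous|exact: continuous_id].
Qed.

Definition width K c : R := support_fun K c + support_fun K (- c).

Lemma width_set0 c : width set0 c = 0.
Proof. by rewrite /width !support_fun_set0 addr0. Qed.

Lemma lebesgue_dotv_image K c : compact K -> convex_set K ->
  @lebesgue_measure R [set dotv x c | x in K] = (width K c)%:E.
Proof.
move=> cK vK; have [->|/set0P K0] := eqVneq K set0.
  by rewrite image_set0 measure0 width_set0.
have [x Kx xE] := support_fun_attained c cK K0.
have [y Ky yE] := support_fun_attained (- c) cK K0.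
have yx : dotv y c <= dotv x c by rewrite -xE; exact: support_fun_ge.
rewrite (_ : _ @` _ = `[dotv y c, dotv x c]%classic).
  rewrite lebesgue_measure_itv/= lte_fin /width xE yE dotvNr.
  by case: ltP => ?; rewrite -?EFinD//; congr EFin; lra.
apply/seteqP; split => [_ [z Kz <-]|a] /=; rewrite in_itv/=.
  rewrite -xE (support_fun_ge _ cK)// andbT.
  by have := support_fun_ge (- c) cK Kz; rewrite yE !dotvNr lerN2.
move=> /andP[ya ax]; have [e|ne] := eqVneq (dotv y c) (dotv x c).
  by exists x => //; lra.
have d0 : 0 < dotv x c - dotv y c by rewrite subr_gt0 lt_neqAle ne.
pose t := (a - dotv y c) / (dotv x c - dotv y c).
exists (t *: x + (1 - t) *: y).
  apply: vK => //; apply/andP; split; first by rewrite divr_ge0 ?subr_ge0// ltW.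
  by rewrite ler_pdivrMr// mul1r lerD2r.
by rewrite !dotvD /t; field; rewrite gt_eqF.
Qed.

(* If K contains a point y beyond the hyperplane through p orthogonal to x - p, then
   moving from p towards y first decreases the distance to x. *)
Lemma nearest_face K x p : convex_set K -> K p ->
  (forall y, K y -> enorm (x - p) <= enorm (x - y)) -> face K (x - p) p.
Proof.
move=> vK Kp pm; split => // y Ky; rewrite leNgt; apply/negP => lt_py.
pose a := dotv (y - p) (x - p); pose b := dotv (y - p) (y - p).
have a0 : 0 < a by rewrite /a dotvBl subr_gt0.
have b0 : 0 <= b by exact: dotv_ge0.
pose t := a / (a + b).
have t0 : 0 < t by rewrite divr_gt0// ltr_pwDl.
have t1 : t <= 1 by rewrite ler_pdivrMr ?ltr_pwDl// mul1r lerDl.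
have := pm _ (vK _ _ t Ky Kp _); rewrite (ltW t0) t1 => /(_ isT).
have -> : x - (t *: y + (1 - t) *: p) = (x - p) - t *: (y - p).
  by apply/rowP => i; rewrite !mxE; ring.
have sq_dist (z w : 'rV[R]_n) : dotv (z - t *: w) (z - t *: w) =
    dotv z z - 2 * t * dotv w z + t * t * dotv w w.
  by rewrite !dotvBl !dotvBr !dotvZl !dotvZr [dotv z w]dotvC; ring.
rewrite ler_enorm sq_dist -/a -/b => dist_le.
have two_a_le : 2 * a <= t * b by rewrite -(ler_pM2l t0); lra.
have tb_le : t * b <= a.
  by rewrite /t mulrAC ler_pdivrMr ?ltr_pwDl// ler_pM2l// lerDr ltW.
lra.
Qed.

Lemma face_nearest K w p y : face K w p -> K y -> enorm w <= enorm (p + w - y).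
Proof.
move=> [Kp pm] Ky; have [->|w0] := eqVneq w 0; first by rewrite enorm0 enorm_ge0.
rewrite -(ler_pM2r (_ : 0 < enorm w)) ?enorm_gt0// -expr2 enorm_sq.
apply: le_trans (cauchy_schwarz _ _); have := pm _ Ky.
by rewrite !dotvBl dotvDl; lra.
Qed.

Lemma separation K y : compact K -> convex_set K -> K !=set0 -> ~ K y ->
  exists2 nu, enorm nu = 1 & support_fun K nu < dotv y nu.
Proof.
move=> cK vK K0 nKy.
have cf : continuous (fun x : 'rV[R]_n => - enorm (y - x)).
  have cd : continuous (fun x : 'rV[R]_n => enorm (y - x)).
    by apply: continuous_enorm; apply: continuous_sub; [exact: cst_continuous|exact: continuous_id].
  by move=> x; exact: (@cvgN R R^o _ (nbhs x) (nbhs_filter x) _ _ (cd x)).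
have [x Kx xm] := compact_argmax cK K0 cf.
have fx : face K (y - x) x.
  by apply: nearest_face => // z Kz; rewrite -lerN2; exact: xm.
have w0 : y - x != 0 by rewrite subr_eq0; apply: contra_notN nKy => /eqP ->.
exists (normalize (y - x)); first exact: enorm_normalize.
rewrite -(face_normalize K w0) in fx; rewrite (support_fun_face fx) -subr_gt0 -dotvBl.
by rewrite dotvZr mulr_gt0 ?dotv_gt0// invr_gt0 enorm_gt0.
Qed.

End SupportFunction.

Section OrthonormalFamilies.
Variable R : realType.
Implicit Types (m n k j : nat).

Lemma mulmx_tr_eq0 m n (x : 'rV[R]_n) (A : 'M[R]_(m, n)) :
  (x *m A^T == 0) = [forall i, dotv x (row i A) == 0].
Proof.
have entry i : (x *m A^T) 0 i = dotv x (row i A).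
  by rewrite dotvE mxE; apply: eq_bigr => k _; rewrite !mxE.
apply/eqP/forallP => [xA0 i|xA0]; first by rewrite -entry xA0 mxE.
by apply/rowP => i; rewrite entry mxE; exact/eqP.
Qed.

Lemma orthonormal_rank m n (W : 'M[R]_(m, n)) : orthonormal W -> \rank W = m.
Proof.
move=> WW; apply/eqP; rewrite eqn_leq rank_leq_row /=.
by rewrite -{1}(@mxrank1 R m) -WW mxrankM_maxl.
Qed.

Lemma orthonormal_rowsub r k n (A : 'M[R]_(k, n)) (w : 'rV[R]_n) (W : 'M[R]_(r, n)) :
  \rank A = r.+1 -> (w <= A)%MS -> orthonormal w ->
  (W == A :&: kermx w^T)%MS -> orthonormal W ->
  orthonormal (col_mx w W) /\ (col_mx w W == A)%MS.
Proof.
move=> rA wA ww /eqmxP WB WW.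
have Ww : W *m w^T = 0 by apply/sub_kermxP; rewrite WB capmxSr.
have wW : orthonormal (col_mx w W).
  by apply: (@frame_col_mx R 1 r); split => //; exact: mulmx_tr_eq0C.
split => //; have sub : (col_mx w W <= A)%MS by rewrite col_mx_sub wA WB capmxSl.
by rewrite sub /= -(geq_leqif (mxrank_leqif_sup sub)) rA (orthonormal_rank wW).
Qed.

Lemma ex_orthonormal_basis r k n (A : 'M[R]_(k, n)) : \rank A = r ->
  exists2 W : 'M[R]_(r, n), orthonormal W & (W == A)%MS.
Proof.
elim: r k A => [|r IH] k A rA.
  exists 0; first by apply/matrixP => -[].
  by move/eqP: rA; rewrite mxrank_eq0 => /eqP ->; rewrite !sub0mx.
have a0 : nz_row A != 0 by rewrite nz_row_eq0 -mxrank_eq0 rA.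
pose w := normalize (nz_row A).
have ww : orthonormal w by apply/orthonormal_rV; exact: enorm_normalize.
have wA : (w <= A)%MS by rewrite scalemx_sub// nz_row_sub.
have Aw : A *m w^T != 0.
  apply/eqP => Aw0; have /submxP[D wE] := wA.
  have := ww; rewrite /orthonormal {1}wE -mulmxA Aw0 mulmx0 => /matrixP/(_ 0 0)/eqP.
  by rewrite !mxE eq_sym oner_eq0.
have rB : \rank (A :&: kermx w^T)%MS = r.
  have := mxrank_mul_ker A w^T; rewrite rA.
  have -> : \rank (A *m w^T) = 1%N.
    by apply/eqP; rewrite eqn_leq rank_leq_col /= lt0n mxrank_eq0.
  by rewrite add1n => -[].
have [W WW WB] := IH _ _ rB.
have [wW wWA] := orthonormal_rowsub rA wA ww WB WW.
by exists (col_mx w W).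
Qed.

Lemma ex_frame m j n (W : 'M[R]_(m, n)) : n = (m + j)%N -> orthonormal W ->
  exists U : 'M[R]_(j, n), frame W U.
Proof.
move=> nE WW.
have rk : \rank (kermx W^T) = j.
  by rewrite mxrank_ker mxrank_tr (orthonormal_rank WW) nE addKn.
have [U UU /eqmxP UK] := ex_orthonormal_basis rk.
by exists U; apply: frameC; split => //; apply/sub_kermxP; rewrite UK.
Qed.

Lemma frame_perp m j n (W : 'M[R]_(m, n)) (U : 'M[R]_(j, n)) (F : 'M[R]_n) :
  n = (m + j)%N -> frame W U -> (U == F)%MS -> (W == perp F)%MS.
Proof.
move=> nE [WW UU WU] /eqmxP UF.
have WF : W *m F^T = 0.
  have /submxP[D ->] : (F <= U)%MS by rewrite UF.
  by rewrite trmx_mul mulmxA WU mul0mx.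
have sub : (W <= perp F)%MS by apply/sub_kermxP.
have rF : \rank F = j by rewrite -UF (orthonormal_rank UU).
have eq_rank : \rank W = \rank (perp F).
  by rewrite (orthonormal_rank WW) mxrank_ker mxrank_tr rF nE addnK.
by have := mxrank_leqif_eq sub; rewrite eq_rank => -[_ <-].
Qed.

Lemma frame_col_mxl p q k n (a : 'M[R]_(p, n)) (b : 'M[R]_(q, n)) (c : 'M[R]_(k, n)) :
  frame (col_mx a b) c <-> [/\ frame a b, frame a c & frame b c].
Proof.
rewrite /frame /orthonormal tr_col_mx mul_col_row mul_col_mx; split.
  rewrite scalar_mx_block => -[/eq_block_mx[aa ab ba bb] cc].
  by rewrite -[RHS]col_mx0 => /eq_col_mx[ac bc].
move=> [[aa bb ab] [_ cc ac] [_ _ bc]].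
by rewrite aa bb ab (mulmx_tr_eq0C ab) ac bc -scalar_mx_block col_mx0.
Qed.

Lemma frame_col_mxP p q k l n (a : 'M[R]_(p, n)) (A : 'M[R]_(q, n)) (b : 'M[R]_(k, n))
    (B : 'M[R]_(l, n)) : frame (col_mx a A) (col_mx b B) <->
  [/\ frame a A, frame b B & [/\ a *m b^T = 0, a *m B^T = 0, A *m b^T = 0
    & A *m B^T = 0]].
Proof.
split; rewrite /frame /orthonormal.
  move=> []; rewrite !tr_col_mx !mul_col_row scalar_mx_block => /eq_block_mx[aa aA Aa AA].
  rewrite scalar_mx_block => /eq_block_mx[bb bB Bb BB].
  by rewrite -[RHS]block_mx0 => /eq_block_mx[ab aB Ab AB].
move=> [[aa AA aA] [bb BB bB] [ab aB Ab AB]].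
have Aa := mulmx_tr_eq0C aA; have Bb := mulmx_tr_eq0C bB.
by split; rewrite !tr_col_mx !mul_col_row ?aa ?aA ?Aa ?AA ?bb ?bB ?Bb ?BB ?ab ?aB ?Ab ?AB
  -?scalar_mx_block ?block_mx0.
Qed.

End OrthonormalFamilies.

(** * Volumes of projections and their second differences *)

Section SupportDerivative.
Variables (R : realType) (n : nat).
Implicit Types (X : set 'rV[R]_n) (u v : 'rV[R]_n).

Lemma dotv_bounded X v : compact X ->
  exists2 B : R, 0 < B & forall x, X x -> `|dotv x v| <= B.
Proof.
move=> cX; have [M M0 XM] := compact_enorm_le cX.
exists (M * enorm v + 1); first by rewrite ltr_wpDl// mulr_ge0 ?enorm_ge0// ltW.
move=> x Xx; rewrite (le_trans (abs_dotv_le _ _))// ler_wpDr//.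
by rewrite ler_wpM2r ?enorm_ge0// XM.
Qed.

Lemma face_perturbed_lt X u v s B c x y : 0 < s ->
  (forall z, X z -> `|dotv z v| <= B) -> face X u y ->
  dotv x u < support_fun X u - c -> 2 * B * s < c -> ~ face X (u + s *: v) x.
Proof.
move=> s0 XB fy xu sc [Xx xm]; have [Xy _] := fy; have := xm y Xy.
rewrite !dotvD -(support_fun_face fy).
have := XB _ Xy; have := XB _ Xx; rewrite !ler_norml => /andP[x1 x2] /andP[y1 y2].
nra.
Qed.

Lemma near_perturbed_face X u v e : compact X -> 0 < e ->
  \forall s \near 0^'+, forall x, face X (u + s *: v) x ->
    dotv x v <= support_fun (face X u) v + e.
Proof.
move=> cX e0; have [->|/set0P X0] := eqVneq X set0.
  by apply: filterE => s x [].
have cF := compact_face (u := u) cX; have [y fy] := face_nonempty u cX X0.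
have [B B0 XB] := dotv_bounded v cX.
have /compact_near_coveringP/(_ R (0 : R)^'+ (fun s x =>
  face X (u + s *: v) x -> dotv x v <= support_fun (face X u) v + e)) := cX.
case/(_ _ _)/wrap; last by apply: filterS => s Xs x fx; apply: Xs => //; case: fx.
move=> x Xx; have [xu|xu] := eqVneq (dotv x u) (support_fun X u).
  have fx : face X u x by apply/faceP => //; rewrite xu.
  have xv : dotv x v < support_fun (face X u) v + e.
    by rewrite (le_lt_trans (support_fun_ge v cF fx))// ltrDl.
  exists ([set x' | dotv x' v < support_fun (face X u) v + e], setT) => /=.
    split; last exact: filterT.
    exact: (cvgr_lt _ (@continuous_dotvl R n v x)).
  by move=> [a s] [/= /ltW].
set c := (support_fun X u - dotv x u) / 2.
have c0 : 0 < c by rewrite divr_gt0// subr_gt0 lt_neqAle xu support_fun_ge.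
exists ([set x' | dotv x' u < support_fun X u - c], [set s | 0 < s < c / (2 * B)]) => /=.
  split; first by apply: (cvgr_lt _ (@continuous_dotvl R n u x)); move: c0; rewrite /c; lra.
  near=> s; apply/andP; split; first by near: s; exact: nbhs_right_gt.
  by near: s; apply: nbhs_right_lt; rewrite divr_gt0// mulr_gt0.
move=> [a s] [/= au /andP[s0]]; rewrite ltr_pdivlMr ?mulr_gt0// mulrC => sc.
by move=> /(face_perturbed_lt s0 XB fy au sc).
Unshelve. all: by end_near. Qed.

Lemma cvg_support_fun_deriv X u v : compact X ->
  (support_fun X (u + s *: v) - support_fun X u) / s @[s --> 0^'+]
   --> support_fun (face X u) v.
Proof.
move=> cX; have [->|/set0P X0] := eqVneq X set0.
  rewrite (_ : face _ _ = set0); last by apply/seteqP; split => // x [].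
  under eq_fun do rewrite !support_fun_set0 subrr mul0r.
  by rewrite support_fun_set0; exact: cvg_cst.
have cF := compact_face (u := u) cX.
have [y fy yv] := support_fun_attained v cF (face_nonempty u cX X0).
have [Xy _] := fy; have yu := support_fun_face fy.
apply/cvgrPdist_le => e e0; near=> s.
have s0 : 0 < s by near: s; exact: nbhs_right_gt.
have [x fx] := face_nonempty (u + s *: v) cX X0; have [Xx _] := fx.
have xv : dotv x v <= support_fun (face X u) v + e.
  by move: x {Xx} fx; near: s; exact: near_perturbed_face.
have sE := support_fun_face fx; have xu := support_fun_ge u cX Xx.
have ys := support_fun_ge (u + s *: v) cX Xy.
rewrite distrC ger0_norm.
  rewrite lerBlDl ler_pdivrMr// sE !dotvD; nra.
rewrite subr_ge0 ler_pdivlMr// yv yu.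
move: ys; rewrite !dotvD; lra.
Unshelve. all: by end_near. Qed.

Definition width_second_diff X u v : R :=
  width X (u + v) + width X (u - v) - 2 * width X u.

Lemma width_second_diff_set0 u v : width_second_diff set0 u v = 0.
Proof. by rewrite /width_second_diff !width_set0 mulr0 subr0 addr0. Qed.

Lemma width_second_diff_ge0 X u v : compact X -> 0 <= width_second_diff X u v.
Proof.
move=> cX; have := support_fun_midpoint u v cX; have := support_fun_midpoint (- u) v cX.
rewrite /width_second_diff /width !opprD opprK; lra.
Qed.

Lemma width_second_diff_le X u v B : compact X -> 0 <= B ->
  (forall x, X x -> `|dotv x v| <= B) -> width_second_diff X u v <= 4 * B.
Proof.
move=> cX B0 XB; have [->|/set0P X0] := eqVneq X set0.
  by rewrite width_second_diff_set0 mulr_ge0.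
have XBN x : X x -> `|dotv x (- v)| <= B by move=> /XB; rewrite dotvNr normrN.
have := support_fun_lipschitz u 1 cX X0 XB; have := support_fun_lipschitz u 1 cX X0 XBN.
have := support_fun_lipschitz (- u) 1 cX X0 XB; have := support_fun_lipschitz (- u) 1 cX X0 XBN.
rewrite /width_second_diff /width !scale1r !opprD !opprK !ler_norml normr1.
by move=> /andP[_ ?] /andP[_ ?] /andP[_ ?] /andP[_ ?]; lra.
Qed.

Lemma cvg_width_second_diff X u v : compact X ->
  width_second_diff X u (s *: v) / s @[s --> 0^'+] -->
  width (face X u) v + width (face X (- u)) v.
Proof.
move=> cX; pose q a b s := (support_fun X (a + s *: b) - support_fun X a) / s.
rewrite (_ : (fun s => _) = fun s => (q u v s + q u (- v) s) + (q (- u) v s + q (- u) (- v) s)).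
  by rewrite /width; apply: cvgD; apply: cvgD; exact: cvg_support_fun_deriv.
by apply/funext => s; rewrite /q /width_second_diff /width !scalerN !opprD !opprK; ring.
Qed.

End SupportDerivative.

Section Shadows.
Variable R : realType.
Local Notation leb := (@lebesgue_measure R).
Local Notation Rm := (measurableTypeR R).
Local Notation vol := (vol R).
Implicit Types (k n : nat).

(* The orthogonal projection of P onto the span of the rows of A, in the coordinates
   given by A when these rows are orthonormal. *)
Definition shadow k n (P : set 'rV[R]_n) (A : 'M[R]_(k, n)) : set 'rV[R]_k :=
  [set x *m A^T | x in P].

Lemma compact_shadow k n (P : set 'rV[R]_n) (A : 'M[R]_(k, n)) :
  compact P -> compact (shadow P A).
Proof. by move=> cP; apply: compact_image => //; exact/continuous_mulmxr/continuous_id. Qed.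

Lemma measurable_shadow k n (P : set 'rV[R]_n) (A : 'M[R]_(k, n)) :
  compact P -> measurable (shadow P A).
Proof. by move=> cP; apply: compact_measurable_mx; exact: compact_shadow. Qed.

Lemma vol_shadow_fin_num k n (P : set 'rV[R]_n) (A : 'M[R]_(k, n)) :
  compact P -> vol k (shadow P A) \is a fin_num.
Proof. by move=> cP; apply: vol_compact_fin_num; exact: compact_shadow. Qed.

Definition fiber k n (P : set 'rV[R]_n) (e : 'M[R]_(k, n)) (z : 'rV[R]_k) :=
  [set x | P x /\ x *m e^T = z].

Lemma compact_fiber k n (P : set 'rV[R]_n) (e : 'M[R]_(k, n)) z :
  compact P -> compact (fiber P e z).
Proof.
move=> cP; apply: (closed_sub_compact cP);
  last by move=> x [].
apply: closedI; first exact: compact_closed_mx.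
by apply: closed_eq_fun; [exact/continuous_mulmxr/continuous_id|exact: cst_continuous].
Qed.

Lemma convex_fiber k n (P : set 'rV[R]_n) (e : 'M[R]_(k, n)) z :
  convex_set P -> convex_set (fiber P e z).
Proof.
move=> vP x y t [Px xz] [Py yz] t01; split; first exact: vP.
by rewrite mulmxDl -!scalemxAl xz yz -scalerDl addrC subrK scale1r.
Qed.

Lemma fiber_nonempty k n (P : set 'rV[R]_n) (e : 'M[R]_(k, n)) z :
  shadow P e z -> fiber P e z !=set0.
Proof. by move=> [x Px xz]; exists x. Qed.

Lemma fiber_set0 k n (P : set 'rV[R]_n) (e : 'M[R]_(k, n)) z :
  ~ shadow P e z -> fiber P e z = set0.
Proof. by move=> nz; apply/seteqP; split => // x [Px xz]; apply: nz; exists x. Qed.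

Lemma mulmx_tr_col_mx k n (x c : 'rV[R]_n) (e : 'M[R]_(k, n)) :
  x *m (col_mx c e)^T = row_cons (dotv x c, x *m e^T).
Proof.
rewrite tr_col_mx mul_mx_row /row_cons /=; congr (@row_mx _ 1 1 k _ _).
by apply/rowP => i; rewrite !ord1 [RHS]mxE.
Qed.

Lemma row_cons_inj k (a b : Rm) (z w : 'rV[R]_k) :
  row_cons (a, z) = row_cons (b, w) -> a = b /\ z = w.
Proof.
move=> E; split; first by rewrite -(row_cons_head a z) E row_cons_head.
by rewrite -(row_cons_tail a z) E row_cons_tail.
Qed.

Lemma shadow_slice k n (P : set 'rV[R]_n) (c : 'rV[R]_n) (e : 'M[R]_(k, n)) z :
  [set a : Rm | shadow P (col_mx c e) (row_cons (a, z))] = [set dotv x c | x in fiber P e z].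
Proof.
apply/seteqP; split => a /= [x].
  by move=> Px; rewrite mulmx_tr_col_mx => /row_cons_inj[<- xz]; exists x.
by move=> [Px xz] <-; exists x => //; rewrite mulmx_tr_col_mx xz.
Qed.

Section FiberWidths.
Variables (k n : nat) (P : set 'rV[R]_n) (e : 'M[R]_(k, n)) (c : 'rV[R]_n).
Hypotheses (cF : forall z, compact (fiber P e z)) (vF : forall z, convex_set (fiber P e z)).
Hypothesis mS : measurable (shadow P (col_mx c e)).

Lemma lebesgue_shadow_slice z :
  leb [set a : Rm | shadow P (col_mx c e) (row_cons (a, z))] = (width (fiber P e z) c)%:E.
Proof. by rewrite shadow_slice lebesgue_dotv_image. Qed.

Lemma width_fiber_ge0 z : 0 <= width (fiber P e z) c.
Proof. by rewrite -lee_fin -lebesgue_shadow_slice. Qed.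

Lemma measurable_width_fiber : measurable_fun setT (fun z => width (fiber P e z) c).
Proof.
apply/measurable_EFinP; rewrite (_ : EFin \o _ =
  fun z => leb [set a : Rm | shadow P (col_mx c e) (row_cons (a, z))]).
  exact: measurable_lebesgue_slice.
by apply/funext => z; rewrite lebesgue_shadow_slice.
Qed.

Lemma vol_shadow : vol k.+1 (shadow P (col_mx c e)) =
  (\int[vol k]_z (width (fiber P e z) c)%:E)%E.
Proof. by rewrite vol_cons//; apply: eq_integral => z _; rewrite lebesgue_shadow_slice. Qed.

End FiberWidths.

Lemma vol_shadow_scale k n P (e : 'M[R]_(k, n)) (c : 'rV[R]_n) (a : R) :
  compact P -> convex_set P -> 0 < a ->
  (vol k.+1 (shadow P (col_mx (a *: c) e)) = a%:E * vol k.+1 (shadow P (col_mx c e)))%E.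
Proof.
move=> cP vP a0.
have cF z := compact_fiber (e := e) (z := z) cP.
have vF z := convex_fiber (e := e) (z := z) vP.
have mS b := measurable_shadow (col_mx b e) cP.
rewrite !vol_shadow// -ge0_integralZl//.
- by apply: eq_integral => z _; rewrite -EFinM /width -scalerN !support_funZ// mulrDr.
- by apply/measurable_EFinP; exact: measurable_width_fiber.
- by move=> z _; rewrite lee_fin width_fiber_ge0.
- by rewrite lee_fin ltW.
Qed.

End Shadows.

Section LineMaxima.
Variables (R : realType) (j n : nat) (P : set 'rV[R]_n) (U : 'M[R]_(j, n)) (w : 'rV[R]_n).
Hypothesis cP : compact P.

Definition line_maxima (v : 'rV[R]_j) : set 'rV[R]_n :=
  [set x | P x /\ forall y l, P y -> y *m U^T = x *m U^T + l *: v -> dotv y w <= dotv x w].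

Let superlevel_shadow (q : R) : set 'rV[R]_j := shadow [set x | P x /\ q <= dotv x w] U.

Let closed_superlevel_shadow q : closed (superlevel_shadow q).
Proof.
apply: compact_closed_mx; apply: compact_shadow; apply: (closed_sub_compact cP);
  last by move=> x [].
apply: closedI; first exact: compact_closed_mx.
by apply: closed_le_fun; [exact: cst_continuous|exact: continuous_dotvl].
Qed.

Let segment_meets_superlevel (q : R) (N : nat) : set 'rV[R]_(j + j) :=
  [set y | exists2 l : R, `[- N%:R, N%:R]%classic l &
     superlevel_shadow q (lsubmx y + l *: rsubmx y)].

Let closed_segment_meets_superlevel q N : closed (segment_meets_superlevel q N).
Proof.
apply: (@closed_exists_compact 'rV[R]_(j + j) R `[- N%:R, N%:R]%classic
  [set p | superlevel_shadow q (lsubmx p.2 + p.1 *: rsubmx p.2)]).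
  exact: segment_compact.
apply: closed_preimage; last exact: closed_superlevel_shadow.
apply: continuous_add; first exact/continuous_lsubmx/continuous_snd.
by apply: continuous_scale; [exact: continuous_fst|exact/continuous_rsubmx/continuous_snd].
Qed.

Let measurable_lsub (A : set 'rV[R]_j) : measurable A ->
  measurable [set y : 'rV[R]_(j + j) | A (lsubmx y)].
Proof.
apply: measurable_preimage.
exact: (measurable_lsubmx (f := fun y : 'rV[R]_(j + j) => y)).
Qed.

(* A point t fails to be optimal along its line iff some rational level is attained on
   the line but not above t. *)
Lemma measurable_line_maxima_graph :
  measurable [set y : 'rV[R]_(j + j) | shadow (line_maxima (rsubmx y)) U (lsubmx y)].
Proof.
rewrite (_ : mkset _ = [set y | shadow P U (lsubmx y)] `\`
  \bigcup_(q : rat) \bigcup_(N : nat)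
    ([set y | ~ superlevel_shadow (ratr q) (lsubmx y)] `&` segment_meets_superlevel (ratr q) N)).
  apply: measurableD; first by apply: measurable_lsub; exact: measurable_shadow.
  apply: bigcupT_measurable_rat => q; apply: bigcupT_measurable => N.
  apply: measurableI; last by apply: closed_measurable_mx; exact: closed_segment_meets_superlevel.
  apply: measurableC; apply: measurable_lsub.
  by apply: closed_measurable_mx; exact: closed_superlevel_shadow.
apply/seteqP; split => y /=.
  move=> [x [Px xm] xt]; split; first by exists x.
  move=> [q _ [N _ [/= below_q [l _ [x' [Px' qx'] x't]]]]]; apply: below_q.
  exists x => //; split => //; apply: le_trans qx' _.
  by apply: (xm _ l) => //; rewrite x't xt.
move=> [/fiber_nonempty F0 no_level].
have [x [Px xt] xm] := compact_argmax (compact_fiber (e := U) (z := lsubmx y) cP) F0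
  (@continuous_dotvl R n w).
exists x => //; split=> // x' l Px' x't; rewrite leNgt; apply/negP => lt_xx'.
have [q] := rat_in_itvoo lt_xx'; rewrite in_itv/= => /andP[xq qx'].
apply: no_level; exists q => //; exists (Num.bound `|l|) => //; split => /=.
  move=> [z [Pz qz] zt].
  by have := xm z (conj Pz zt); rewrite leNgt (lt_le_trans xq qz).
exists l; first by rewrite /= in_itv /= -ler_norml ltW// archi_boundP.
by exists x'; [split => //; exact: ltW|rewrite x't xt].
Qed.

Lemma measurable_line_maxima v : measurable (shadow (line_maxima v) U).
Proof.
have := @measurable_sliceC R j j _ v measurable_line_maxima_graph.
rewrite (_ : mkset _ = shadow (line_maxima v) U)//.
by apply/seteqP; split => t /=; rewrite row_mxKl row_mxKr.
Qed.

Lemma face_sub_line_maxima v : face P w `<=` line_maxima v.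
Proof. by move=> x [Px xm]; split => // y l Py _; exact: xm. Qed.

End LineMaxima.

Lemma line_maximaZl (R : realType) j n P (U : 'M[R]_(j, n)) w v (a : R) : 0 < a ->
  line_maxima P U (a *: w) v = line_maxima P U w v.
Proof.
move=> a0; apply/seteqP; split => x [Px xm]; split => // y l Py yE.
  by have := xm y l Py yE; rewrite !dotvZr ler_pM2l.
by rewrite !dotvZr ler_pM2l//; exact: (xm y l).
Qed.

Lemma line_maximaZr (R : realType) j n P (U : 'M[R]_(j, n)) w v (a : R) : a != 0 ->
  line_maxima P U w (a *: v) = line_maxima P U w v.
Proof.
move=> a0; apply/seteqP; split => x [Px xm]; split => // y l Py yE.
  by apply: (xm y (l / a)) => //; rewrite scalerA mulfVK.
by apply: (xm y (l * a)) => //; rewrite -scalerA.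
Qed.

Section FiberFaces.
Variables (R : realType) (k n : nat) (P : set 'rV[R]_n) (e : 'M[R]_(k, n)).
Local Notation vol := (vol R).
Hypotheses (cP : compact P) (vP : convex_set P).
Implicit Types (u v c : 'rV[R]_n).

Definition fiber_faces u : set 'rV[R]_n := [set x | face (fiber P e (x *m e^T)) u x].

Lemma fiber_fiber_faces u z : fiber (fiber_faces u) e z = face (fiber P e z) u.
Proof.
apply/seteqP; split => x; first by move=> [/= + xz]; rewrite /fiber_faces /= xz.
by move=> fx; case: (fx) => -[_ xz] _; split => //; rewrite /fiber_faces /= xz.
Qed.

Lemma line_maxima_fiber_faces u v :
  line_maxima P (col_mx v e) u (row_cons (1, 0)) = fiber_faces u.
Proof.
apply/seteqP; split => x.
  move=> [Px xm]; split => // y [Py ye]; apply: (xm y (dotv y v - dotv x v)) => //.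
  rewrite !mulmx_tr_col_mx ye /row_cons /= (@scale_row_mx _ 1 1 k) (@add_row_mx _ 1 1 k).
  congr (@row_mx _ 1 1 k _ _); last by rewrite scaler0 addr0.
  by apply/rowP => i; rewrite !mxE mulr1 addrC subrK.
move=> [[Px _] xm]; split => // y l Py yE; apply: xm; split => //.
move: yE; rewrite !mulmx_tr_col_mx => /(congr1 (fun y : 'rV[R]_(1 + k) => rsubmx y)).
by rewrite linearD linearZ /= !row_cons_tail scaler0 addr0.
Qed.

Lemma measurable_fiber_faces u v : measurable (shadow (fiber_faces u) (col_mx v e)).
Proof. by rewrite -(line_maxima_fiber_faces u v); exact: measurable_line_maxima. Qed.

Lemma vol_fiber_faces_fin_num u v :
  vol k.+1 (shadow (fiber_faces u) (col_mx v e)) \is a fin_num.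
Proof.
rewrite ge0_fin_numE//; apply: le_lt_trans (vol_compact_lty (compact_shadow (A := col_mx v e) cP)).
apply: le_measure; rewrite ?inE; [exact: measurable_fiber_faces|exact: measurable_shadow|].
by move=> y [x [[Px _] _] <-]; exists x.
Qed.

Let cF z : compact (fiber P e z). Proof. exact: compact_fiber. Qed.
Let vF z : convex_set (fiber P e z). Proof. exact: convex_fiber. Qed.
Let mS c : measurable (shadow P (col_mx c e)). Proof. exact: measurable_shadow. Qed.
Let cFF u z : compact (fiber (fiber_faces u) e z).
Proof. by rewrite fiber_fiber_faces; exact: compact_face. Qed.
Let vFF u z : convex_set (fiber (fiber_faces u) e z).
Proof. by rewrite fiber_fiber_faces; exact: convex_face. Qed.

Let mwidth c : measurable_fun setT (fun z => width (fiber P e z) c).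
Proof. exact: measurable_width_fiber. Qed.

Lemma measurable_width_second_diff u v :
  measurable_fun setT (fun z => width_second_diff (fiber P e z) u v).
Proof.
apply: measurable_funB; first exact: measurable_funD.
by apply: measurable_funM => //; exact: measurable_cst.
Qed.

Definition shadow_second_diff u v : R :=
  fine (vol k.+1 (shadow P (col_mx (u + v) e))) +
  fine (vol k.+1 (shadow P (col_mx (u - v) e))) -
  2 * fine (vol k.+1 (shadow P (col_mx u e))).

Lemma integral_width_second_diff u v :
  (\int[vol k]_z (width_second_diff (fiber P e z) u v)%:E = (shadow_second_diff u v)%:E)%E.
Proof.
have fin_shadow c := vol_shadow_fin_num (col_mx c e) cP.
rewrite /shadow_second_diff EFinB EFinD EFinM !fineK//.
have fin2 : (2%:E * vol k.+1 (shadow P (col_mx u e)) \is a fin_num)%E by rewrite fin_numM.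
rewrite -(addeK (\int[vol k]_z _)%E fin2); congr (_ - _)%E.
have mE (f : 'rV[R]_k -> R) : measurable_fun setT f -> measurable_fun setT (EFin \o f).
  by move=> mf; exact/measurable_EFinP.
rewrite !vol_shadow// -ge0_integralZl//; last 2 first.
- exact: mE.
- by move=> z _; rewrite lee_fin width_fiber_ge0.
rewrite -!ge0_integralD//; do ?[exact: mE].
- by apply: eq_integral => z _; rewrite -EFinM -!EFinD /width_second_diff subrK.
- by move=> z _; rewrite lee_fin width_fiber_ge0.
- by move=> z _; rewrite lee_fin width_fiber_ge0.
- by move=> z _; rewrite lee_fin width_second_diff_ge0.
- by apply: mE; exact: measurable_width_second_diff.
- by move=> z _; rewrite -EFinM lee_fin mulr_ge0// width_fiber_ge0.
- by apply/measurable_EFinP; apply: measurable_funM.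
Qed.

Lemma integral_width_fiber_faces u v :
  (\int[vol k]_z (width (face (fiber P e z) u) v + width (face (fiber P e z) (- u)) v)%:E =
   (fine (vol k.+1 (shadow (fiber_faces u) (col_mx v e))) +
    fine (vol k.+1 (shadow (fiber_faces (- u)) (col_mx v e))))%:E)%E.
Proof.
have mFF c := measurable_fiber_faces c v.
rewrite EFinD !fineK ?vol_fiber_faces_fin_num// !vol_shadow// -ge0_integralD//.
- by apply: eq_integral => z _; rewrite !fiber_fiber_faces.
- by move=> z _; rewrite lee_fin width_fiber_ge0.
- by apply/measurable_EFinP; exact: measurable_width_fiber.
- by move=> z _; rewrite lee_fin width_fiber_ge0.
- by apply/measurable_EFinP; exact: measurable_width_fiber.
Qed.

Let measurable_width_face u v : measurable_fun setT (fun z => width (face (fiber P e z) u) v).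
Proof.
rewrite (_ : (fun z => _) = fun z => width (fiber (fiber_faces u) e z) v); last first.
  by apply/funext => z; rewrite fiber_fiber_faces.
by apply: measurable_width_fiber => //; exact: measurable_fiber_faces.
Qed.

Lemma width_second_diff_dominated v : exists2 B, 0 <= B & forall u s z, 0 < s ->
  `|width_second_diff (fiber P e z) u (s *: v) / s| <= B * \1_(shadow P e) z.
Proof.
have [B B0 PB] := dotv_bounded v cP; exists (4 * B); first by rewrite mulr_ge0// ltW.
move=> u s z s0; rewrite indicE.
have [_|/negP] := boolP (z \in shadow P e); last first.
  rewrite inE => /fiber_set0 ->.
  by rewrite width_second_diff_set0 mul0r normr0 mulr0.
rewrite mulr1 normrM ger0_norm ?width_second_diff_ge0// gtr0_norm ?invr_gt0//.
rewrite ler_pdivrMr// -mulrA; apply: width_second_diff_le => //.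
  by rewrite mulr_ge0// ltW.
by move=> x [Px _]; rewrite dotvZr normrM (gtr0_norm s0) mulrC ler_wpM2r ?PB// ltW.
Qed.

(* Fibrewise this is [cvg_width_second_diff]; dominated convergence passes to the integral. *)
Lemma cvg_shadow_second_diff u v :
  shadow_second_diff u (s *: v) / s @[s --> 0^'+] -->
  fine (vol k.+1 (shadow (fiber_faces u) (col_mx v e))) +
  fine (vol k.+1 (shadow (fiber_faces (- u)) (col_mx v e))).
Proof.
apply/cvg_at_rightP => s_ s_cvg; have [s_gt0 _] := s_cvg.
have [B B0 domB] := width_second_diff_dominated v.
pose f_ l z : \bar R := (width_second_diff (fiber P e z) u (s_ l *: v) / s_ l)%:E.
pose f z : \bar R := (width (face (fiber P e z) u) v + width (face (fiber P e z) (- u)) v)%:E.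
have mf_ l : measurable_fun setT (f_ l).
  apply/measurable_EFinP; apply: measurable_funM => //.
  exact: measurable_width_second_diff.
have mf : measurable_fun setT f.
  by apply/measurable_EFinP; apply: measurable_funD; exact: measurable_width_face.
have int_dom : (vol k).-integrable setT (fun z => (B * \1_(shadow P e) z)%:E).
  apply/integrableP; split.
    apply/measurable_EFinP; apply: measurable_funM => //.
    by apply: measurable_indic; exact: measurable_shadow.
  under eq_integral => z _ do rewrite abse_EFin ger0_norm ?mulr_ge0// EFinM.
  have mD := measurable_shadow e cP.
  rewrite ge0_integralZl//; last exact: measurable_EFin_indic.
  rewrite integral_indic// setIT lte_mul_pinfty ?lee_fin//.
  by apply: vol_compact_lty; exact: compact_shadow.
have int_f_ l : (\int[vol k]_z f_ l z = (shadow_second_diff u (s_ l *: v) / s_ l)%:E)%E.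
  rewrite /f_; under eq_integral do rewrite mulrC EFinM.
  rewrite ge0_integralZl//; last 3 first.
  - by apply/measurable_EFinP; exact: measurable_width_second_diff.
  - by move=> z _; rewrite lee_fin width_second_diff_ge0.
  - by rewrite lee_fin invr_ge0 ltW.
  by rewrite integral_width_second_diff -EFinM mulrC.
have [||_ _] := @dominated_convergence _ _ R (vol k) setT measurableT f_ f _ mf_ mf _ int_dom.
- apply: aeW => z _; apply: cvg_EFin; first exact: nearW.
  by move/cvg_at_rightP: (@cvg_width_second_diff _ _ _ u v (@cF z)); exact.
- by apply: aeW => z l _; rewrite abse_EFin lee_fin domB.
rewrite integral_width_fiber_faces (_ : [sequence _]_l = fun l =>
    (shadow_second_diff u (s_ l *: v) / s_ l)%:E); first by move=> /fine_cvgP[].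
by apply/funext => l; exact: int_f_.
Qed.

End FiberFaces.

(** * Almost everywhere constancy of the face volumes *)

Lemma countable_interval_boundary (R : realType) (S : set R) : is_interval S ->
  countable [set l | S l /\ forall k, ~ (S (l + k.+1%:R^-1) /\ S (l - k.+1%:R^-1))].
Proof.
move=> iS; pose mins := [set l | S l /\ forall l', S l' -> l <= l'].
pose maxs := [set l | S l /\ forall l', S l' -> l' <= l].
apply: (@sub_countable _ _ _ (mins `|` maxs)); last first.
  apply: finite_set_countable; rewrite finite_setU; split.
    have [[a [Sa am]]|no_min] := pselect (mins !=set0).
      apply: (@sub_finite_set _ _ [set a]) => // l [Sl lm] /=.
      by apply/eqP; rewrite eq_le lm//= am.
    by apply: (@sub_finite_set _ _ set0) => // l minl; apply: no_min; exists l.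
  have [[a [Sa am]]|no_max] := pselect (maxs !=set0).
    apply: (@sub_finite_set _ _ [set a]) => // l [Sl lm] /=.
    by apply/eqP; rewrite eq_le lm//= am.
  by apply: (@sub_finite_set _ _ set0) => // l maxl; apply: no_max; exists l.
apply: subset_card_le => l [Sl notint].
apply: contrapT => /not_orP[notmin notmax].
have [l1 Sl1 l1l] : exists2 l1, S l1 & l1 < l.
  apply: contrapT => no_lt; apply: notmin; split => // l' Sl'.
  by rewrite leNgt; apply/negP => ?; apply: no_lt; exists l'.
have [l2 Sl2 ll2] : exists2 l2, S l2 & l < l2.
  apply: contrapT => no_gt; apply: notmax; split => // l' Sl'.
  by rewrite leNgt; apply/negP => ?; apply: no_gt; exists l'.
have [k] : exists k : nat, k.+1%:R^-1 < Num.min (l - l1) (l2 - l).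
  by apply: ex_natSinv_lt; rewrite lt_min !subr_gt0 l1l ll2.
have k0 : 0 < k.+1%:R^-1 :> R by rewrite invr_gt0.
rewrite lt_min => /andP[kl1 kl2]; apply: (notint k).
move: k0 kl1 kl2; set s := k.+1%:R^-1 => s0 sl1 sl2.
by split; apply: (iS l1 l2) => //; apply/andP; split; lra.
Qed.

Section LineMaximaAlmostEverywhere.
Variables (R : realType) (j n : nat) (P : set 'rV[R]_n) (U : 'M[R]_(j, n)) (w : 'rV[R]_n).
Hypotheses (cP : compact P) (vP : convex_set P).
Local Notation vol := (vol R).
Local Notation optimal v := (shadow (line_maxima P U w v) U).

Lemma is_interval_line_maxima v t : is_interval [set l | optimal v (t + l *: v)].
Proof.
move=> l1 l2 [x1 [Px1 m1] x1E] [x2 [Px2 m2] x2E] l /andP[l1l ll2].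
have shift a b c : a + b *: v + c *: v = a + (b + c) *: v by rewrite scalerDl addrA.
have le21 : dotv x2 w <= dotv x1 w.
  by apply: (m1 _ (l2 - l1)) => //; rewrite x1E shift x2E; congr (_ + _ *: _); ring.
have le12 : dotv x1 w <= dotv x2 w.
  by apply: (m2 _ (l1 - l2)) => //; rewrite x2E shift x1E; congr (_ + _ *: _); ring.
have [e|ne] := eqVneq l1 l2.
  by rewrite (_ : l = l1); [exists x1|lra].
have d0 : 0 < l2 - l1 by rewrite subr_gt0 lt_neqAle ne (le_trans l1l).
pose a := (l2 - l) / (l2 - l1).
have xE : (a *: x1 + (1 - a) *: x2) *m U^T = t + l *: v.
  rewrite mulmxDl -!scalemxAl x1E x2E !scalerDr addrACA -scalerDl.
  rewrite [a + _]addrC subrK scale1r !scalerA -scalerDl; congr (_ + _ *: _).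
  by rewrite /a; field; rewrite gt_eqF.
exists (a *: x1 + (1 - a) *: x2) => //; split.
  apply: vP => //; rewrite divr_ge0 ?subr_ge0//=; last exact: (le_trans l1l).
  by rewrite ler_pdivrMr// mul1r lerD2l lerN2.
move=> y k Py; rewrite xE shift !dotvD => yE.
have := m1 y (l + k - l1) Py; rewrite x1E shift yE.
have -> : l1 + (l + k - l1) = l + k by ring.
by move=> /(_ erefl); rewrite (_ : dotv x2 w = dotv x1 w); [nra|lra].
Qed.

(* t lies strictly between t + a and a point between the projections of x1 and x2. *)
Lemma ex_fiber_gt t v a (l1 l2 s1 s2 c : R) x1 x2 z :
  P x1 -> P x2 -> P z -> 0 < s1 -> 0 < s2 -> l1 < l2 ->
  x1 *m U^T = t + s1 *: (v + l1 *: a) -> x2 *m U^T = t - s2 *: (v + l2 *: a) ->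
  z *m U^T = t + a -> c <= dotv x1 w -> c <= dotv x2 w -> c < dotv z w ->
  exists2 x, fiber P U t x & c < dotv x w.
Proof.
move=> Px1 Px2 Pz s10 s20 l12 x1E x2E zE cx1 cx2 cz.
have s12 : 0 < s1 + s2 by exact: addr_gt0.
pose d := s1 * s2 / (s1 + s2) * (l2 - l1).
have d0 : 0 < d by rewrite mulr_gt0 ?subr_gt0// divr_gt0// mulr_gt0.
pose b := s2 / (s1 + s2).
have b01 : 0 <= b <= 1.
  apply/andP; split; first by rewrite divr_ge0// ltW.
  by rewrite ler_pdivrMr// mul1r lerDr ltW.
pose y := b *: x1 + (1 - b) *: x2.
have Py : P y by exact: vP.
have cy : c <= dotv y w by rewrite !dotvD; case/andP: b01 => ? ?; nra.
have yE : y *m U^T = t - d *: a.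
  rewrite mulmxDl -!scalemxAl x1E x2E.
  by apply/rowP => i; rewrite !mxE /d /b; field; exact: lt0r_neq0.
have d1 : 0 < 1 + d by rewrite addr_gt0.
pose r := (1 + d)^-1; have r0 : 0 < r by rewrite invr_gt0.
have r1 : r < 1 by rewrite invf_lt1// ltrDl.
exists (r *: y + (1 - r) *: z); last first.
  rewrite dotvDl !dotvZl.
  have : 0 <= r * (dotv y w - c) by rewrite mulr_ge0 ?subr_ge0// ltW.
  have : 0 < (1 - r) * (dotv z w - c) by rewrite mulr_gt0 ?subr_gt0.
  lra.
split; first by apply: vP => //; rewrite !ltW.
rewrite mulmxDl -!scalemxAl yE zE.
by apply/rowP => i; rewrite !mxE /r; field; exact: lt0r_neq0.
Qed.

(* Pairs (t, v), coded as concatenated rows. *)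
Let graph := [set y : 'rV[R]_(j + j) | optimal (rsubmx y) (lsubmx y)].
Let shifted_graph (s : R) := [set y : 'rV[R]_(j + j) |
  optimal (rsubmx y) (lsubmx y + s *: rsubmx y)].
Let two_sided (k : nat) := shifted_graph k.+1%:R^-1 `&` shifted_graph (- k.+1%:R^-1).
Let off_face := [set y : 'rV[R]_(j + j) | ~ shadow (face P w) U (lsubmx y)].

Let measurable_graph : measurable graph.
Proof. exact: measurable_line_maxima_graph. Qed.

Let measurable_two_sided : measurable (\bigcup_k two_sided k).
Proof.
suff measurable_shifted s : measurable (shifted_graph s).
  by apply: bigcupT_measurable => k; exact: measurableI.
rewrite (_ : shifted_graph s = [set y : 'rV[R]_(j + j) |
    graph (row_mx (lsubmx y + s *: rsubmx y) (rsubmx y))]).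
  apply: measurable_preimage => //.
  have ml := measurable_lsubmx (D := setT) (f := fun y : 'rV[R]_(j + j) => y)
    (@measurable_id _ _ setT).
  have mr := measurable_rsubmx (D := setT) (f := fun y : 'rV[R]_(j + j) => y)
    (@measurable_id _ _ setT).
  apply: measurable_row_mx => //; apply: measurable_addmx => //.
  exact: measurable_scalemx.
by apply/seteqP; split => y; rewrite /graph /shifted_graph /= row_mxKl row_mxKr.
Qed.

Let measurable_face_shadow : measurable (shadow (face P w) U).
Proof. by apply: measurable_shadow; exact: compact_face. Qed.

Let measurable_off_face : measurable off_face.
Proof.
apply: measurableC; apply: measurable_preimage; last exact: measurable_face_shadow.
exact: (measurable_lsubmx (f := fun y : 'rV[R]_(j + j) => y)).
Qed.

Let vol0_one_sided : vol (j + j) (graph `\` \bigcup_k two_sided k) = 0%E.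
Proof.
have mD : measurable (graph `\` \bigcup_k two_sided k) by exact: measurableD.
rewrite vol_row_mxC//; apply: integral0_eq => v _.
apply: (@vol0_segments R _ _ v) => [|t]; first exact: measurable_sliceC.
apply: countable_lebesgue_measure0.
apply: (sub_countable _ (countable_interval_boundary (@is_interval_line_maxima v t))).
apply: subset_card_le => l [_ []]; rewrite /graph /= row_mxKl row_mxKr => opt_l one_sided.
split => // k [opt_r opt_l']; apply: one_sided; exists k => //.
by rewrite /two_sided /shifted_graph /= row_mxKl row_mxKr -!addrA -!scalerDl.
Qed.

Let vol0_two_sided_off_face : P !=set0 ->
  vol (j + j) (graph `&` (\bigcup_k two_sided k) `&` off_face) = 0%E.
Proof.
move=> P0; have mI : measurable (graph `&` (\bigcup_k two_sided k) `&` off_face).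
  by apply: measurableI => //; exact: measurableI.
rewrite vol_row_mx//; apply: integral0_eq => t _.
have [z [Pz zmax]] := face_nonempty w cP P0.
apply: (@vol0_segments R _ _ (z *m U^T - t)) => [|v]; first exact: measurable_slice.
apply: countable_lebesgue_measure0; apply: finite_set_countable.
set Z := mkset _.
have Z_not_lt l1 l2 : Z l1 -> Z l2 -> ~ l1 < l2.
  move=> [_ [[X1 [k1 _ [A1 _]]] off]] [_ [[_ [k2 _ [_ A2]]] _]] l12.
  move: X1 A1 A2 off; rewrite /graph /off_face /shifted_graph /= !row_mxKl !row_mxKr scaleNr.
  move=> [x0 [Px0 x0m] x0t] [x1 [Px1 m1] x1E] [x2 [Px2 m2] x2E] off.
  have x1c : dotv x0 w <= dotv x1 w.
    by apply: (m1 _ (- k1.+1%:R^-1)) => //; rewrite x1E x0t scaleNr addrK.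
  have x2c : dotv x0 w <= dotv x2 w.
    by apply: (m2 _ k2.+1%:R^-1) => //; rewrite x2E x0t subrK.
  have zc : dotv x0 w < dotv z w.
    rewrite ltNge; apply/negP => z_le; apply: off; exists x0 => //; split => // y Py.
    exact: (le_trans (zmax _ Py)).
  have zE : z *m U^T = t + (z *m U^T - t) by rewrite addrC subrK.
  have [|| x [Px xt]] := ex_fiber_gt Px1 Px2 Pz _ _ l12 x1E x2E zE x1c x2c zc.
  - by rewrite invr_gt0.
  - by rewrite invr_gt0.
  by rewrite ltNge (x0m _ 0)// xt x0t scale0r addr0.
have Z_uniq l1 l2 : Z l1 -> Z l2 -> l1 = l2.
  by move=> Z1 Z2; case: (ltgtP l1 l2) => // /Z_not_lt; [case/(_ Z1 Z2)|case/(_ Z2 Z1)].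
have [[l Zl]|nZ] := pselect (Z !=set0).
  by apply: (@sub_finite_set _ _ [set l]) => // l' Zl'; exact: Z_uniq.
by apply: (@sub_finite_set _ _ set0) => // l Zl; apply: nZ; exists l.
Qed.

Let vol0_graph_off_face : P !=set0 -> vol (j + j) (graph `&` off_face) = 0%E.
Proof.
move=> P0; have mtwo := measurable_two_sided.
apply/eqP; rewrite eq_le measure_ge0 andbT.
rewrite -[leRHS]adde0 -{1}vol0_one_sided -(vol0_two_sided_off_face P0).
apply: le_trans (measureU2 _ _ _) => /=.
- apply: le_measure; rewrite ?inE; first exact: measurableI.
    apply: measurableU; first exact: measurableD.
    by apply: measurableI => //; exact: measurableI.
  move=> y [gy offy]; have [Ay|nA] := pselect ((\bigcup_k two_sided k) y); last by left.
  by right.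
- exact: measurableD.
- by apply: measurableI => //; exact: measurableI.
Qed.

(* Along almost every direction, the optimal points of a line that are not optimal
   globally are isolated: they form a null set. *)
Lemma ae_vol_line_maxima :
  {ae vol j, forall v, vol j (optimal v) = vol j (shadow (face P w) U)}.
Proof.
have [P_empty|/set0P P0] := eqVneq P set0.
  apply: filterE => v; congr (vol j _); apply/seteqP.
  by split => t [x []]; rewrite P_empty.
have mX : measurable (graph `&` off_face) by exact: measurableI.
pose f v := vol j [set t | (graph `&` off_face) (row_mx t v)].
have mf : measurable_fun setT f by exact: measurable_vol_sliceC.
have : (\int[vol j]_v `|f v| = 0)%E.
  transitivity (\int[vol j]_v f v)%E; first by apply: eq_integral => v _; rewrite gee0_abs.
  by rewrite -vol_row_mxC// vol0_graph_off_face.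
move=> /(ae_eq_integral_abs (vol j) measurableT mf).
apply: filterS => v /(_ I) fv0.
have -> : optimal v = shadow (face P w) U `|` [set t | (graph `&` off_face) (row_mx t v)].
  apply/seteqP; split => t; rewrite /graph /off_face /= row_mxKl row_mxKr.
    by move=> opt_t; have [?|?] := pselect (shadow (face P w) U t); [left|right].
  by move=> [[x fx xt]|[]//]; exists x => //; exact: face_sub_line_maxima.
rewrite measureU//; last 2 first.
- exact: measurable_sliceC.
- by apply/seteqP; split => // t [ft]; rewrite /off_face /= row_mxKl => -[_].
by rewrite -[RHS]adde0; congr (_ + _)%E.
Qed.

End LineMaximaAlmostEverywhere.

Section ComplementaryShadows.
Variable R : realType.
Local Notation vol := (vol R).
Implicit Types (n : nat).

Definition complementary_shadows m j n (P Q : set 'rV[R]_n) := forall (W : 'M[R]_(m, n))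
  (U : 'M[R]_(j, n)), frame W U -> vol j (shadow P U) = vol m (shadow Q W).

Lemma complementary_shadowsC m j n (P Q : set 'rV[R]_n) :
  complementary_shadows m j P Q -> complementary_shadows j m Q P.
Proof. by move=> PQ W U /frameC/PQ ->. Qed.

Lemma dotv_rotate n (u v : 'rV[R]_n) (s : R) : enorm u = 1 -> enorm v = 1 -> dotv u v = 0 ->
  [/\ dotv (u + s *: v) (u + s *: v) = 1 + s ^+ 2,
      dotv (v - s *: u) (v - s *: u) = 1 + s ^+ 2 & dotv (v - s *: u) (u + s *: v) = 0].
Proof.
move=> /enorm_dotv1 uu /enorm_dotv1 vv uv.
by rewrite !dotvD [dotv v u]dotvC uu vv uv; split; ring.
Qed.

Lemma frame_rotate k l n (u v : 'rV[R]_n) (e1 : 'M[R]_(k, n)) (e2 : 'M[R]_(l, n)) (s : R) :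
  frame (col_mx u e1) (col_mx v e2) ->
  frame (col_mx (normalize (v - s *: u)) e1) (col_mx (normalize (u + s *: v)) e2).
Proof.
move=> /frame_col_mxP[[/orthonormal_rV u1 e11 ue1] [/orthonormal_rV v1 e22 ve2]].
move=> [uv ue2 e1v e12]; have ve1 := mulmx_tr_eq0C e1v.
have [uu vv vu] := dotv_rotate s u1 v1 (mulmx_tr_dotv0 uv).
have N0 : 1 + s ^+ 2 != 0 by rewrite gt_eqF// ltr_wpDr// sqr_ge0.
have u0 : u + s *: v != 0 by rewrite -dotv_eq0 uu.
have v0 : v - s *: u != 0 by rewrite -dotv_eq0 vv.
apply/frame_col_mxP; split.
- split => //; first by apply/orthonormal_rV; exact: enorm_normalize.
  by rewrite -scalemxAl mulmxBl -scalemxAl ue1 ve1 scaler0 subrr scaler0.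
- split => //; first by apply/orthonormal_rV; exact: enorm_normalize.
  by rewrite -scalemxAl mulmxDl -scalemxAl ue2 ve2 scaler0 addr0 scaler0.
- split => //.
  + by rewrite mul_trmx_dotv dotvZl dotvZr vu !mulr0 raddf0.
  + by rewrite -scalemxAl mulmxBl -scalemxAl ue2 ve2 scaler0 subrr scaler0.
  + apply: mulmx_tr_eq0C; rewrite -scalemxAl mulmxDl -scalemxAl ue1 ve1.
    by rewrite scaler0 addr0 scaler0.
Qed.

Lemma vol_shadow_rotate k l n (P Q : set 'rV[R]_n) (u v : 'rV[R]_n) (e1 : 'M[R]_(k, n))
    (e2 : 'M[R]_(l, n)) (s : R) :
  compact P -> convex_set P -> compact Q -> convex_set Q ->
  complementary_shadows k.+1 l.+1 P Q -> frame (col_mx u e1) (col_mx v e2) ->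
  vol l.+1 (shadow P (col_mx (u + s *: v) e2)) = vol k.+1 (shadow Q (col_mx (v - s *: u) e1)).
Proof.
move=> cP vP cQ vQ PQ fr; have := PQ _ _ (frame_rotate s fr).
have [[/orthonormal_rV u1 _ _] [/orthonormal_rV v1 _ _] [uv _ _ _]] := (frame_col_mxP _ _ _ _).1 fr.
have [uu vv _] := dotv_rotate s u1 v1 (mulmx_tr_dotv0 uv).
have N0 : 0 < (Num.sqrt (1 + s ^+ 2))^-1.
  by rewrite invr_gt0 sqrtr_gt0 ltr_wpDr// sqr_ge0.
rewrite /normalize /enorm uu vv !vol_shadow_scale//.
rewrite -(fineK (vol_shadow_fin_num (col_mx (u + s *: v) e2) cP)).
rewrite -(fineK (vol_shadow_fin_num (col_mx (v - s *: u) e1) cQ)).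
by rewrite -!EFinM => -[eq_vol]; congr EFin; apply: mulfI eq_vol; rewrite gt_eqF.
Qed.

Lemma shadow_second_diff_rotate k l n (P Q : set 'rV[R]_n) (u v : 'rV[R]_n)
    (e1 : 'M[R]_(k, n)) (e2 : 'M[R]_(l, n)) (s : R) :
  compact P -> convex_set P -> compact Q -> convex_set Q ->
  complementary_shadows k.+1 l.+1 P Q -> frame (col_mx u e1) (col_mx v e2) ->
  shadow_second_diff P e2 u (s *: v) = shadow_second_diff Q e1 v (s *: u).
Proof.
move=> cP vP cQ vQ PQ fr.
have rotate r := vol_shadow_rotate r cP vP cQ vQ PQ fr.
have := rotate (- s); have := rotate 0; rewrite !scaleNr opprK !scale0r addr0 subr0.
by rewrite /shadow_second_diff (rotate s) => -> ->; rewrite [X in X - _ = _]addrC.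
Qed.

Lemma fiber_facesN k n P (e : 'M[R]_(k, n)) (u : 'rV[R]_n) : origin_symmetric P ->
  fiber_faces P e (- u) = [set x | fiber_faces P e u (- x)].
Proof.
move=> sP; have opp (a : 'rV[R]_n) x : fiber_faces P e (- a) x -> fiber_faces P e a (- x).
  move=> [[Px _] xm]; split; first by split; [exact: sP|].
  move=> y [Py yE]; rewrite dotvNl -dotvNr.
  have := xm (- y); rewrite dotvNl dotvNr opprK; apply; split; first exact: sP.
  by rewrite mulNmx yE mulNmx opprK.
apply/seteqP; split => x /= ?; first exact: opp.
by rewrite -[x]opprK; apply: opp; rewrite opprK.
Qed.

Lemma vol_fiber_facesN k n P (e : 'M[R]_(k, n)) (u v : 'rV[R]_n) :
  compact P -> origin_symmetric P ->
  vol k.+1 (shadow (fiber_faces P e (- u)) (col_mx v e)) =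
  vol k.+1 (shadow (fiber_faces P e u) (col_mx v e)).
Proof.
move=> cP sP; have mF := measurable_fiber_faces e cP u v.
have N1 : (-1 : R) != 0 by rewrite oppr_eq0 oner_eq0.
have := vol_scale N1 mF; rewrite normrN normr1 expr1n mul1e => <-.
congr (vol _ _); rewrite fiber_facesN//; apply/seteqP; split => y /=.
  by move=> [x fx <-]; exists (- x) => //; rewrite scaleN1r mulNmx.
by move=> [x fx xy]; exists (- x); rewrite /= ?opprK// mulNmx xy scaleN1r opprK.
Qed.

(* Compare the jumps at 0 of the derivatives in s of both sides of
   [shadow_second_diff_rotate]. *)
Lemma vol_fiber_faces_eq k l n P Q (u v : 'rV[R]_n) (e1 : 'M[R]_(k, n)) (e2 : 'M[R]_(l, n)) :
  compact P -> convex_set P -> origin_symmetric P ->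
  compact Q -> convex_set Q -> origin_symmetric Q ->
  complementary_shadows k.+1 l.+1 P Q -> frame (col_mx u e1) (col_mx v e2) ->
  vol l.+1 (shadow (fiber_faces P e2 u) (col_mx v e2)) =
  vol k.+1 (shadow (fiber_faces Q e1 v) (col_mx u e1)).
Proof.
move=> cP vP sP cQ vQ sQ PQ fr.
have jumpP := cvg_shadow_second_diff (e := e2) cP vP (u := u) (v := v).
have jumpQ := cvg_shadow_second_diff (e := e1) cQ vQ (u := v) (v := u).
rewrite !vol_fiber_facesN// in jumpP jumpQ.
move: jumpP; rewrite (_ : (fun s => _) =
    fun s => shadow_second_diff Q e1 v (s *: u) / s); last first.
  by apply/funext => s; rewrite (shadow_second_diff_rotate s cP vP cQ vQ PQ fr).
move=> jumpP; have eq_jumps := cvg_unique (@norm_hausdorff R R^o) jumpP jumpQ.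
rewrite -(fineK (vol_fiber_faces_fin_num e2 cP u v)).
rewrite -(fineK (vol_fiber_faces_fin_num e1 cQ v u)); congr EFin.
by have := eq_jumps (fmap_proper_filter _ (at_right_proper_filter _)); lra.
Qed.

Lemma line_maxima_rotate k n P (U : 'M[R]_(k, n)) w (O : 'M[R]_k) v : orthonormal O ->
  line_maxima P (O *m U) w (v *m O^T) = line_maxima P U w v.
Proof.
move=> OO; have OO' := mulmx1C OO.
apply/seteqP; split => x [Px xm]; split=> // y l Py yE; apply: (xm _ l) => //.
  by rewrite trmx_mul !mulmxA yE mulmxDl -scalemxAl.
have := congr1 (fun z => z *m O) yE.
by rewrite trmx_mul mulmxDl -scalemxAl -!mulmxA OO' !mulmx1.
Qed.

Lemma shadow_rotate k n X (U : 'M[R]_(k, n)) (O : 'M[R]_k) : orthonormal O ->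
  shadow X (O *m U) = [set t | shadow X U (t *m O)].
Proof.
move=> OO; have OO' := mulmx1C OO; apply/seteqP; split => t [x Xx].
  by rewrite trmx_mul => <-; exists x => //; rewrite -!mulmxA OO' mulmx1.
by move=> xE; exists x => //; rewrite trmx_mul mulmxA xE -mulmxA OO mulmx1.
Qed.

Lemma vol_line_maxima_unit k n P (U : 'M[R]_(k.+1, n)) w (v : 'rV[R]_k.+1) :
  compact P -> orthonormal v ->
  exists (T : 'M[R]_k.+1) (e : 'M[R]_(k, n)),
    [/\ orthonormal T, T *m U = col_mx (v *m U) e &
    vol k.+1 (shadow (line_maxima P U w v) U) =
    vol k.+1 (shadow (fiber_faces P e w) (col_mx (v *m U) e))].
Proof.
move=> cP vv; have [V fr] := @ex_frame R 1 k k.+1 v erefl vv.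
pose T : 'M[R]_k.+1 := col_mx v V; have TT : orthonormal T := frame_col_mx fr.
have TU : T *m U = col_mx (v *m U) (V *m U) by rewrite -(@mul_col_mx _ 1 k).
have vT : v *m T^T = row_cons (1, 0).
  have [_ _ vV] := fr; rewrite /T (@tr_col_mx _ 1 k) (@mul_mx_row _ 1 _ 1 k) vv vV.
  by rewrite /row_cons /=; congr (@row_mx _ 1 1 k _ _); apply/rowP => i; rewrite !mxE !ord1.
exists T, (V *m U); split => //.
rewrite -(line_maxima_fiber_faces _ _ w (v *m U)) -TU -vT line_maxima_rotate//.
by rewrite shadow_rotate// vol_orthogonal//; exact: measurable_line_maxima.
Qed.

Lemma vol_line_maxima_eq m j n P Q (W : 'M[R]_(m.+1, n)) (U : 'M[R]_(j.+1, n)) u v :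
  compact P -> convex_set P -> origin_symmetric P ->
  compact Q -> convex_set Q -> origin_symmetric Q ->
  complementary_shadows m.+1 j.+1 P Q -> frame W U -> u != 0 -> v != 0 ->
  vol j.+1 (shadow (line_maxima P U (u *m W) v) U) =
  vol m.+1 (shadow (line_maxima Q W (v *m U) u) W).
Proof.
move=> cP vP sP cQ vQ sQ PQ [WW UU WU] u0 v0.
have au : 0 < (enorm u)^-1 by rewrite invr_gt0 enorm_gt0.
have av : 0 < (enorm v)^-1 by rewrite invr_gt0 enorm_gt0.
rewrite -(line_maximaZl _ _ _ _ au) -(line_maximaZr _ _ _ _ (lt0r_neq0 av)).
rewrite -(line_maximaZl _ _ (v *m U) _ av) -(line_maximaZr _ _ _ u (lt0r_neq0 au)).
rewrite 2!scalemxAl -/(normalize u) -/(normalize v).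
have /orthonormal_rV nu := enorm_normalize u0; have /orthonormal_rV nv := enorm_normalize v0.
have [T [e2 [TT TU ->]]] := vol_line_maxima_unit U (normalize u *m W) cP nv.
have [T' [e1 [TT' TW ->]]] := vol_line_maxima_unit W (normalize v *m U) cQ nu.
apply: vol_fiber_faces_eq => //; rewrite -TU -TW; split.
- by rewrite /orthonormal trmx_mul mulmxA -[T' *m W *m W^T]mulmxA WW mulmx1.
- by rewrite /orthonormal trmx_mul mulmxA -[T *m U *m U^T]mulmxA UU mulmx1.
- by rewrite trmx_mul mulmxA -[T' *m W *m U^T]mulmxA WU mulmx0 mul0mx.
Qed.

End ComplementaryShadows.

Lemma ae_le_ereal_inf d (T : measurableType d) (R : realType) (m : {measure set T -> \bar R})
    I (D : set I) (F : I -> \bar R) (G : T -> \bar R) : (forall i, 0 <= F i)%E ->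
  (forall i, D i -> {ae m, forall x, (G x <= F i)%E}) ->
  {ae m, forall x, (G x <= ereal_inf [set F i | i in D])%E}.
Proof.
move=> F0 GF; set a := ereal_inf _.
have a0 : (0 <= a)%E by apply: le_ereal_inf_tmp => _ [i _ <-].
have [->|aoo] := eqVneq a +oo%E; first by apply: filterE => x; exact: leey.
have afin : a \is a fin_num by rewrite ge0_fin_numE// ltey.
have /choice[i_ i_P] k : exists i, D i /\ (F i < a + (k.+1%:R^-1)%:E)%E.
  have k0 : 0 < k.+1%:R^-1 :> R by rewrite invr_gt0.
  have [_ [i Di <-] ?] := lb_ereal_inf_adherent (S := [set F i | i in D]) k0 afin.
  by exists i.
have : {ae m, forall x, forall k, (G x <= F (i_ k))%E}.
  by apply: ae_foralln => k; apply: GF; case: (i_P k).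
apply: filterS => x Gx; apply/lee_addgt0Pr => e e0.
have [k ke] := ex_natSinv_lt e0.
apply: (le_trans (Gx k)); apply: (le_trans (ltW (i_P k).2)).
by rewrite leeD2l// lee_fin ltW.
Qed.

Lemma ae_common_value (R : realType) m j (f : 'rV[R]_m.+1 -> \bar R) (g : 'rV[R]_j.+1 -> \bar R) :
  (forall u, 0 <= f u)%E -> (forall v, 0 <= g v)%E -> (forall u, f u < +oo)%E ->
  (forall u, u != 0 -> {ae vol R j.+1, forall v, (g v <= f u)%E}) ->
  (forall v, v != 0 -> {ae vol R m.+1, forall u, (f u <= g v)%E}) ->
  exists c : R, {ae vol R m.+1, forall u, f u = c%:E} /\
    {ae vol R j.+1, forall v, g v = c%:E}.
Proof.
move=> f0 g0 foo gf fg.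
have := ae_le_ereal_inf (D := [set u | u != 0]) f0 gf.
have := ae_le_ereal_inf (D := [set v | v != 0]) g0 fg.
set c := ereal_inf [set g _ | _ in _]; set c' := ereal_inf [set f _ | _ in _] => fc gc'.
have c_lb v : v != 0 -> (c <= g v)%E by move=> v0; apply: ereal_inf_lbound; exists v.
have c'_lb u : u != 0 -> (c' <= f u)%E by move=> u0; apply: ereal_inf_lbound; exists u.
have [u [u0 fuc]] := ae_vol_exists (filterI (@ae_neq0 R m) fc).
have [v [v0 gvc']] := ae_vol_exists (filterI (@ae_neq0 R j) gc').
have cE : c = c'.
  by apply/eqP; rewrite eq_le (le_trans (c_lb _ v0) gvc') (le_trans (c'_lb _ u0) fuc).
rewrite -cE in gc' c'_lb; exists (fine c).
have -> : (fine c)%:E = c.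
  rewrite fineK// ge0_fin_numE; first exact: le_lt_trans (c'_lb _ u0) (foo u).
  by apply: le_ereal_inf_tmp => _ [x _ <-].
split; [apply: filterS2 (@ae_neq0 R m) fc|apply: filterS2 (@ae_neq0 R j) gc'] => x x0 xc.
  by apply/eqP; rewrite eq_le xc c'_lb.
by apply/eqP; rewrite eq_le xc c_lb.
Qed.

Lemma ae_vol_face_shadow_le (R : realType) m j n (P Q : set 'rV[R]_n) (W : 'M[R]_(m.+1, n))
    (U : 'M[R]_(j.+1, n)) u :
  compact P -> convex_set P -> origin_symmetric P ->
  compact Q -> convex_set Q -> origin_symmetric Q ->
  complementary_shadows m.+1 j.+1 P Q -> frame W U -> u != 0 ->
  {ae vol R j.+1, forall v,
    (vol R m.+1 (shadow (face Q (v *m U)) W) <= vol R j.+1 (shadow (face P (u *m W)) U))%E}.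
Proof.
move=> cP vP sP cQ vQ sQ PQ fr u0.
apply: filterS2 (@ae_neq0 R j) (ae_vol_line_maxima U (u *m W) cP vP) => v v0 <-.
rewrite (vol_line_maxima_eq cP vP sP cQ vQ sQ PQ)//; apply: le_measure; rewrite ?inE.
- by apply: measurable_shadow; exact: compact_face.
- exact: measurable_line_maxima.
- by move=> t [x fx <-]; exists x => //; exact: face_sub_line_maxima.
Qed.

Lemma ae_vol_face_shadow (R : realType) m j n (P Q : set 'rV[R]_n) (W : 'M[R]_(m.+1, n))
    (U : 'M[R]_(j.+1, n)) :
  compact P -> convex_set P -> origin_symmetric P ->
  compact Q -> convex_set Q -> origin_symmetric Q ->
  complementary_shadows m.+1 j.+1 P Q -> frame W U ->
  exists c : R,
    {ae vol R m.+1, forall u, vol R j.+1 (shadow (face P (u *m W)) U) = c%:E} /\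
    {ae vol R j.+1, forall v, vol R m.+1 (shadow (face Q (v *m U)) W) = c%:E}.
Proof.
move=> cP vP sP cQ vQ sQ PQ fr; apply: ae_common_value => //.
- by move=> u; apply: vol_compact_lty; apply: compact_shadow; exact: compact_face.
- by move=> u u0; exact: ae_vol_face_shadow_le.
- by move=> v v0; apply: ae_vol_face_shadow_le => //;
    [exact: complementary_shadowsC|exact: frameC].
Qed.

(** * One-sided derivatives and growth of polynomials *)

Section OneSidedCalculus.
Variable R : realType.

Lemma real_induction (A : R -> Prop) (a b : R) :
  (forall t, a <= t <= b -> (forall s, a <= s < t -> A s) -> A t) ->
  (forall t, a <= t < b -> (forall s, a <= s <= t -> A s) -> \forall s \near t^'+, A s) ->
  forall t, a <= t <= b -> A t.
Proof.
move=> left_step right_step t0 /andP[at0 t0b]; have ab := le_trans at0 t0b.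
pose S := [set t | a <= t <= b /\ forall s, a <= s <= t -> A s].
have closed_step t : a <= t <= b -> (forall s, a <= s < t -> A s) -> S t.
  move=> atb As; split => // s /andP[a_s]; rewrite le_eqVlt => /predU1P[->|st].
    exact: left_step.
  by apply: As; rewrite a_s.
have Sa : S a.
  by apply: closed_step => [|s /andP[/le_lt_trans/[apply]]]; rewrite ?lexx ?ltxx.
have sup_S : has_sup S by split; [exists a|exists b => t [/andP[]]].
have aT : a <= sup S by apply: ub_le_sup => //; case: sup_S.
have Tb : sup S <= b by apply: ge_sup => [|t [/andP[]]]; first by exists a.
have ST : S (sup S).
  apply: closed_step => [|s /andP[a_s sT]]; first by rewrite aT.
  by have [t [_ At] st] := sup_gt (ex_intro _ _ Sa) sT; apply: At; rewrite a_s ltW.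
suff TE : sup S = b by case: ST => _; apply; rewrite at0 TE.
apply/eqP; rewrite eq_le Tb leNgt; apply/negP => Tltb.
have := right_step (sup S); rewrite aT Tltb => /(_ isT ST.2).
rewrite near_withinE => -[d /= d0 dA]; pose s := Num.min b (sup S + d / 2).
have Ts : sup S < s by rewrite lt_min Tltb ltrDl divr_gt0.
have sb : s <= b by rewrite ge_min lexx.
have sd : s <= sup S + d / 2 by rewrite ge_min lexx orbT.
have Ss : S s.
  split=> [|r /andP[ar rs]]; first by rewrite (le_trans aT (ltW Ts)).
  have [rT|Tr] := leP r (sup S); first by case: ST => _; apply; rewrite ar.
  by apply: dA => //; rewrite /ball /= ltr_norml; lra.
by have := ub_le_sup sup_S.2 Ss; rewrite leNgt Ts.
Qed.

Lemma right_derivative0_cst (g : R -> R) :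
  (forall r, 0 <= r -> (g (r + e) - g r) / e @[e --> 0^'+] --> 0) ->
  (forall r, 0 < r -> g s @[s --> r^'-] --> g r) ->
  forall r, 0 <= r -> g r = g 0.
Proof.
move=> rd lc b b0.
suff small (eps : R) : 0 < eps -> `|g b - g 0| <= eps * b.
  apply/eqP; rewrite -subr_eq0 -normr_le0; apply/ler_addgt0Pr => e e0; rewrite add0r.
  have b1 : 0 < b + 1 by rewrite ltr_wpDl.
  apply: (le_trans (small (e / (b + 1)) _)); first by rewrite divr_gt0.
  by rewrite mulrAC ler_pdivrMr// ler_pM2l// lerDl.
move=> eps0; apply: (@real_induction (fun t => `|g t - g 0| <= eps * t) 0 b).
- move=> t /andP[t0 _] At; have [->|tn0] := eqVneq t 0; first by rewrite subrr normr0 mulr0.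
  have tp : 0 < t by rewrite lt_neqAle eq_sym tn0.
  apply: (@ler_cvg_to R t^'- _ R (fun s => `|g s - g 0|) (fun s => eps * s)).
  + by apply: cvg_norm; apply: cvgB; [exact: lc|exact: cvg_cst].
  + by apply: cvgM; [exact: cvg_cst|apply: cvg_at_left_filter; exact: cvg_id].
  + near=> s; apply: At; apply/andP; split; near: s; [exact: nbhs_left_ge|exact: nbhs_left_lt].
- move=> t /andP[t0 _] At; rewrite nbhs_right0P.
  have /cvgrPdist_le/(_ _ eps0) := rd t t0; apply: filterS2 (nbhs_right_gt 0) => e e0.
  rewrite sub0r normrN normrM normfV (gtr0_norm e0) ler_pdivrMr// => le_step.
  have -> : g (t + e) - g 0 = (g (t + e) - g t) + (g t - g 0) by ring.
  apply: (le_trans (ler_normD _ _)); rewrite mulrDr addrC lerD// At//.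
  by rewrite t0 lexx.
- by rewrite b0 lexx.
Unshelve. all: by end_near. Qed.

Lemma eq_horner_right_derivative (f : R -> R) (p : {poly R}) :
  (forall r, 0 <= r -> (f (r + e) - f r) / e @[e --> 0^'+] --> (p^`()%R).[r]) ->
  (forall r, 0 < r -> f s @[s --> r^'-] --> f r) ->
  forall r, 0 <= r -> f r = f 0 + p.[r] - p.[0].
Proof.
move=> rd lc r r0.
have rdp s : (p.[s + e] - p.[s]) / e @[e --> 0^'+] --> (p^`()%R).[s].
  have : h^-1 *: (p.[h *: 1 + s] - p.[s]) @[h --> 0^'] --> (p^`()%R).[s].
    by rewrite derivE derive1E; exact: (@derivable_horner R p s).
  move=> cvg_p; apply/cvgrPdist_le => eps eps0.
  have /cvgrPdist_le/(_ _ eps0) := cvg_p; rewrite !near_withinE.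
  apply: filterS => e near_e e0; have := near_e (lt0r_neq0 e0).
  by rewrite [e *: 1]mulr1 [e + s]addrC mulrC.
suff : f r - p.[r] = f 0 - p.[0] by lra.
apply: (@right_derivative0_cst (fun s => f s - p.[s])) r0 => {}r r0.
  rewrite (_ : (fun e => _) = fun e => (f (r + e) - f r) / e - (p.[r + e] - p.[r]) / e).
    by rewrite -[X in _ --> X](subrr (p^`()%R).[r]); apply: cvgB; [exact: rd|exact: rdp].
  by apply/funext => e; rewrite -mulrBl; congr (_ / _); ring.
apply: cvgB; first exact: lc.
by apply: cvg_at_left_filter; exact: continuous_horner.
Qed.

Lemma cvg_horner_divXn (p : {poly R}) N : (size p <= N.+1)%N ->
  p.[k.+1%:R] / k.+1%:R ^+ N @[k --> \oo] --> p`_N.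
Proof.
move=> sp; pose q : {poly R} := \sum_(i < N.+1) p`_i *: 'X^(N - i).
have qE x : q.[x] = \sum_(i < N.+1) p`_i * x ^+ (N - i).
  by rewrite horner_sum; apply: eq_bigr => i _; rewrite hornerZ hornerXn.
have q0 : q.[0] = p`_N.
  rewrite qE big_ord_recr /= subnn expr0 mulr1 big1 ?add0r// => i _.
  by rewrite expr0n subn_eq0 leqNgt ltn_ord mulr0.
have -> : (fun k : nat => p.[k.+1%:R] / k.+1%:R ^+ N) = (fun k => q.[k.+1%:R^-1]).
  apply/funext => k; rewrite qE (horner_coef_wide _ sp) mulr_suml.
  apply: eq_bigr => i _; rewrite -mulrA; congr (_ * _).
  have iN : (i <= N)%N by rewrite -ltnS.
  move: (nat_of_ord i) iN => {}i iN.
  by rewrite -{1}(subnK iN) exprD invfM mulrCA mulfV ?mulr1 ?exprVn.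
rewrite -q0; apply: continuous_cvg; first exact: continuous_horner.
exact: cvg_harmonic.
Qed.

Lemma coef_cvg_horner_divXn (p : {poly R}) m (A : R) :
  p.[k.+1%:R] / k.+1%:R ^+ m @[k --> \oo] --> A -> p`_m = A.
Proof.
move=> pA; suff : forall d, (size p <= (m + d).+1)%N -> p`_m = A.
  by move=> /(_ (size p)); apply; rewrite leqW// leq_addl.
elim=> [|d IH] sp.
  rewrite addn0 in sp.
  exact: (cvg_unique (@norm_hausdorff R R^o) (cvg_horner_divXn sp) pA).
apply: IH; rewrite leq_eqVlt in sp; case/orP: sp => [/eqP sp|]; last by rewrite addnS.
have := @cvg_horner_divXn p (m + d.+1); rewrite sp => /(_ (leqnn _)) to_lead.
have to_0 : p.[k.+1%:R] / k.+1%:R ^+ m * (k.+1%:R^-1) ^+ d.+1 @[k --> \oo] --> A * 0 ^+ d.+1.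
  apply: cvgM => //; rewrite -hornerXn.
  under eq_fun do rewrite -hornerXn.
  by apply: continuous_cvg; [exact: continuous_horner|exact: cvg_harmonic].
move: to_0; rewrite (_ : (fun k : nat => _) = (fun k => p.[k.+1%:R] / k.+1%:R ^+ (m + d.+1))).
  move=> /(cvg_unique (@norm_hausdorff R R^o) to_lead); rewrite expr0n mulr0 => p0.
  have /eqP : lead_coef p = 0 by rewrite lead_coefE sp /= p0.
  by rewrite lead_coef_eq0 => /eqP pz; rewrite pz size_poly0 in sp.
by apply/funext => k; rewrite exprD invfM mulrA exprVn.
Qed.

End OneSidedCalculus.

(** * Sums of normals and maximisers *)

Lemma compact_face_pairs (R : realType) n (T : topologicalType) (K : set 'rV[R]_n) (D : set T)
    (f : T -> 'rV[R]_n) : compact K -> compact D -> continuous f ->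
  compact [set p : T * 'rV[R]_n | D p.1 /\ face K (f p.1) p.2].
Proof.
move=> cK cD cf; have [->|/set0P K0] := eqVneq K set0.
  by rewrite (_ : mkset _ = set0); [exact: compact0|apply/seteqP; split => // p [_ []]].
rewrite (_ : mkset _ = (D `*` K) `&` [set p | face K (f p.1) p.2]).
  apply: compact_closedI; first exact: compact_setX.
  apply: closed_face => //; last exact: continuous_snd.
  by move=> p; apply: continuous_comp; [exact: cvg_fst|exact: cf].
by apply/seteqP; split => p [/=]; [move=> Dp fp; case: (fp)|move=> [Dp _] fp].
Qed.

Section NormalSum.
Variables (R : realType) (m : nat).
Local Notation vol := (vol R).
Implicit Types (K D : set 'rV[R]_m) (s : seq 'rV[R]_m).

Definition normal_sum K D : set 'rV[R]_m := [set x | exists2 n, D n & face K n (x - n)].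

Lemma compact_normal_sum K D : compact K -> compact D -> compact (normal_sum K D).
Proof.
move=> cK cD.
rewrite (_ : normal_sum K D = (fun p => p.1 + p.2) @` [set p | D p.1 /\ face K p.1 p.2]).
  apply: compact_image; last first.
    by apply: continuous_add; [exact: continuous_fst|exact: continuous_snd].
  by apply: (compact_face_pairs (f := fun n => n)) => //; exact: continuous_id.
apply/seteqP; split => x; first by move=> [n Dn fn]; exists (n, x - n); rewrite //= addrC subrK.
by move=> [[n a] [/= Dn fa] <-]; exists n => //; rewrite [n + a]addrC addrK.
Qed.

Lemma measurable_normal_sum K D : compact K -> compact D -> measurable (normal_sum K D).
Proof. by move=> cK cD; apply: compact_measurable_mx; exact: compact_normal_sum. Qed.

(* The map sending n to a maximiser of <., n> is monotone. *)
Lemma face_sub_inj K (n n' a a' : 'rV[R]_m) :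
  face K n a -> face K n' a' -> n + a = n' + a' -> n = n'.
Proof.
move=> [Ka am] [Ka' am'] E; have {}E : a' = a + (n - n').
  by rewrite addrA [a + n]addrC E [n' + a']addrC addrK.
apply/eqP; rewrite -subr_eq0 -dotv_eq0 eq_le dotv_ge0 andbT.
have := am _ Ka'; have := am' _ Ka; rewrite E !dotvD [dotv n' n]dotvC; lra.
Qed.

(* The pieces of D on which a given point of s is the first maximiser are translated by
   that point, and their translates are still disjoint. *)
Lemma vol_normal_sum_finite s D : s != [::] -> compact D ->
  (vol m D <= vol m (normal_sum [set` s] D))%E.
Proof.
move=> s0 cD; have cs : compact [set` s] by apply: finite_compact; exact: finite_seq.
pose E i := D `&` [set n | (i < size s)%N /\ face [set` s] n s`_i].
have mE i : measurable (E i).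
  apply: measurableI; first exact: compact_measurable_mx.
  have [i_s|s_i] := ltnP i (size s); last first.
    by rewrite (_ : mkset _ = set0)//; apply/seteqP; split => // n [].
  rewrite (_ : mkset _ = [set n | face [set` s] n s`_i]).
    apply: closed_measurable_mx; apply: closed_face => //; last exact: cst_continuous.
      by exists s`_0; exact: mem_nth (leq_ltn_trans _ i_s).
    exact: continuous_id.
  by apply/seteqP; split => n /=; [case|].
have mDU i : measurable (seqDU E i).
  by apply: measurableD => //; apply: bigsetU_measurable.
have DE : D = \bigcup_i seqDU E i.
  rewrite -seqDU_bigcup_eq; apply/seteqP; split => [n Dn|n [i _ []]//].
  have s_nonempty : [set` s] !=set0.
    by case: s s0 {cs E mE mDU} => // b s _; exists b; rewrite /= mem_head.
  have [b fb] := face_nonempty n cs s_nonempty.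
  have bs : b \in s by case: fb.
  by exists (index b s) => //; split => //=; rewrite index_mem nth_index.
pose Z i := [set x | seqDU E i (x - s`_i)].
have mZ i : measurable (Z i).
  apply: measurable_preimage; last exact: mDU.
  by apply: measurable_addmx; [exact: measurable_id|exact: measurable_cst].
have -> : vol m D = vol m (\bigcup_i Z i).
  transitivity (\sum_(i <oo | i \in setT) vol m (seqDU E i))%E.
    by rewrite [in LHS]DE; apply: measure_bigcup.
  rewrite measure_bigcup//.
    by apply: eq_eseriesr => i _; exact: esym (vol_shift _ (mDU i)).
  move=> i i' _ _ [x [Zx Z'x]].
  have [[[_ [_ fi]] _] [[_ [_ fi']] _]] := (Zx, Z'x).
  have nE : x - s`_i = x - s`_i' by apply: (face_sub_inj fi fi'); rewrite !subrK.
  have := @trivIset_seqDU _ E i i'; apply => //; exists (x - s`_i).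
  by split => //; rewrite nE.
apply: le_measure; rewrite ?inE; first exact: bigcupT_measurable.
  exact: measurable_normal_sum.
move=> x [i _ [[Dn [_ fn]] _]]; exists (x - s`_i) => //.
by rewrite subKr.
Qed.

Lemma finite_net K (e : R) : compact K -> K !=set0 -> 0 < e ->
  exists s, [/\ s != [::], forall b, b \in s -> K b &
    forall a, K a -> exists2 b, b \in s & enorm (a - b) <= e].
Proof.
move=> cK [a0 Ka0] e0; have := cK; rewrite compact_cover.
move=> /(_ _ K (fun b => [set a | enorm (a - b) < e])) [].
- move=> b _.
  have : continuous (fun a : 'rV[R]_m => enorm (a - b)).
    by apply: continuous_enorm; apply: continuous_sub; [exact: continuous_id|exact: cst_continuous].
  by move=> /continuousP/(_ _ (@open_lt R e)).
- by move=> a Ka; exists a => //=; rewrite subrr enorm0.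
move=> D DK Kc; exists (finmap.enum_fset D); split.
- by have [b /= bD _] := Kc _ Ka0; apply: contraTneq (bD : b \in finmap.enum_fset D) => ->.
- by move=> b bD; have := DK b bD; rewrite inE.
- by move=> a /Kc[b /= bD ab]; exists b => //; exact: ltW.
Qed.

Lemma normal_sum_approx K D x : compact K -> K !=set0 -> compact D ->
  (forall e, 0 < e -> exists2 n, D n & K (x - n) /\ support_fun K n <= dotv (x - n) n + e) ->
  normal_sum K D x.
Proof.
move=> cK K0 cD approx.
pose Dx := D `&` [set n | K (x - n)].
have c_sub : continuous (fun n : 'rV[R]_m => x - n).
  by apply: continuous_sub; [exact: cst_continuous|exact: continuous_id].
have cDx : compact Dx.
  apply: compact_closedI => //; apply: closed_preimage => //; exact: compact_closed_mx.
have Dx0 : Dx !=set0 by have [n Dn [Kn _]] := approx 1 ltr01; exists n.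
have cf : continuous (fun n : 'rV[R]_m => dotv (x - n) n - support_fun K n).
  have cd : continuous (fun n : 'rV[R]_m => dotv (x - n) n).
    by apply: continuous_dotv; [exact: c_sub|exact: continuous_id].
  exact: (@continuous_sub R _ R^o _ _ cd (continuous_support_fun cK K0)).
have [n [Dn Kn] nm] := compact_argmax cDx Dx0 cf.
exists n => //; apply/faceP => //; split => //.
apply/ler_addgt0Pr => e e0; have [n' Dn' [Kn' n'e]] := approx e e0.
by have := nm _ (conj Dn' Kn'); lra.
Qed.

(* K is replaced by finer and finer finite nets. *)
Lemma vol_normal_sum_ge K D : compact K -> K !=set0 -> compact D ->
  (vol m D <= vol m (normal_sum K D))%E.
Proof.
move=> cK K0 cD; have [B B0 DB] := compact_enorm_le cD.
have natSinv_gt0 (k : nat) : 0 < k.+1%:R^-1 :> R by rewrite invr_gt0.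
have /choice[s s_net] k := finite_net cK K0 (natSinv_gt0 k).
have cs k : compact [set` s k] by apply: finite_compact; exact: finite_seq.
have [M M0 KDM] := compact_norm_le (compact_image (compact_setX cD cK)
  (@continuous_add R _ 'rV[R]_m _ _ (@continuous_fst _ _) (@continuous_snd _ _))).
apply: (@measure_lim_sup_ge _ _ _ _ (fun k => normal_sum [set` s k] D) _
  [set x | `|x| <= M]).
- by move=> k; exact: measurable_normal_sum.
- exact: measurable_normal_sum.
- exact: measurable_norm_ball.
- exact: vol_norm_ball_lty.
- move=> k x [n Dn [sn _]]; apply: KDM; exists (n, x - n); last by rewrite /= addrC subrK.
  by split => //=; have [_ + _] := s_net k; exact.
- move=> x x_freq; apply: normal_sum_approx => // e e0.
  have [N Ne] := ex_natSinv_lt (divr_gt0 e0 B0).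
  have [k /= Nk [n Dn [sn nm]]] := x_freq N I.
  have [_ sK net] := s_net k; exists n => //; split; first exact: sK.
  have [a Ka ->] := support_fun_attained n cK K0; have [b bs ab] := net a Ka.
  have ab_le : dotv (a - b) n <= e.
    apply: (le_trans (cauchy_schwarz _ _)); apply: (@le_trans _ _ (k.+1%:R^-1 * B)).
      by rewrite ler_pM ?enorm_ge0 ?DB.
    rewrite -ler_pdivlMr// (le_trans _ (ltW Ne))// lef_pV2 ?posrE//.
    by rewrite ler_nat.
  by have := nm b bs; move: ab_le; rewrite !dotvBl; lra.
- by move=> k; apply: vol_normal_sum_finite => //; case: (s_net k).
Qed.

End NormalSum.

(** * Growth of normal tubes *)

Section NormalTubes.
Variables (R : realType) (m j n : nat).
Local Notation vol := (vol R).
Variables (P : set 'rV[R]_n) (W : 'M[R]_(m, n)) (U : 'M[R]_(j, n)).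
Hypotheses (nE : n = (m + j)%N) (fr : frame W U).
Hypothesis cP : compact P.

Definition normal_tube (r : R) : set 'rV[R]_n := normal_sum P [set u *m W | u in eball r].

Lemma normal_tubeP r x : normal_tube r x <->
  exists2 u : 'rV[R]_m, enorm u <= r & face P (u *m W) (x - u *m W).
Proof.
split=> [[_ [u ur <-] fu]|[u ur fu]]; first by exists u.
by exists (u *m W) => //; exists u.
Qed.

Lemma compact_normal_tube r : compact (normal_tube r).
Proof.
apply: compact_normal_sum => //; apply: compact_image; first exact: compact_eball.
exact/continuous_mulmxr/continuous_id.
Qed.

Lemma measurable_normal_tube r : measurable (normal_tube r).
Proof. by apply: compact_measurable_mx; exact: compact_normal_tube. Qed.

Lemma normal_tube_unique x (u v : 'rV[R]_m) : face P (u *m W) (x - u *m W) ->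
  face P (v *m W) (x - v *m W) -> u = v.
Proof.
move=> fu fv; have [WW _ _] := fr.
have := face_sub_inj fu fv; rewrite ![_ *m W + _]addrC !subrK => /(_ erefl) uWvW.
by rewrite -[u]mulmx1 -[v]mulmx1 -WW !mulmxA uWvW.
Qed.

Definition face_bundle (r : R) : set 'rV[R]_(m + j) :=
  [set z | eball r (lsubmx z) /\ shadow (face P (lsubmx z *m W)) U (rsubmx z)].

Lemma compact_face_bundle r : compact (face_bundle r).
Proof.
have cW : continuous (fun u : 'rV[R]_m => u *m W) by exact/continuous_mulmxr/continuous_id.
have cpairs := compact_face_pairs cP (@compact_eball R m r) cW.
have crow : continuous (fun p : 'rV[R]_m * 'rV[R]_n => row_mx p.1 (p.2 *m U^T)).
  by apply: continuous_row_mx; [exact: continuous_fst|exact/continuous_mulmxr/continuous_snd].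
have := compact_image cpairs crow.
congr compact; apply/seteqP; split => z.
  by move=> [[u x] [/= ur fx] <-]; rewrite /face_bundle /= row_mxKl row_mxKr; split => //; exists x.
by move=> [zr [x fx xz]]; exists (lsubmx z, x) => //=; rewrite xz hsubmxK.
Qed.

Lemma measurable_face_bundle r : measurable (face_bundle r).
Proof. by apply: compact_measurable_mx; exact: compact_face_bundle. Qed.

Lemma vol_face_bundleZ r : 0 < r ->
  vol (m + j) (face_bundle r) = ((r ^+ m)%:E * vol (m + j) (face_bundle 1))%E.
Proof.
move=> r0; rewrite -(vol_dilate_left r0 (@measurable_face_bundle r)).
congr (_ * vol _ _)%E; apply/seteqP; split => z;
  rewrite /face_bundle /eball /= row_mxKl row_mxKr enormZ (gtr0_norm r0);
  by rewrite -scalemxAl faceZ// ger_pMr.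
Qed.

Section FibersOverU.
Variables (r : R) (t : 'rV[R]_j).
Let K : set 'rV[R]_m := [set a | P (a *m W + t *m U)].
Let D : set 'rV[R]_m := [set u | face_bundle r (row_mx u t)].

Lemma compact_frame_fiber : compact K.
Proof.
apply: (closed_sub_compact (compact_shadow (A := W) cP)).
  apply: closed_preimage (compact_closed_mx cP).
  by apply: continuous_add; [exact/continuous_mulmxr/continuous_id|exact: cst_continuous].
by move=> a Ka; exists (a *m W + t *m U) => //; rewrite frame_coordl.
Qed.

Lemma compact_face_bundle_fiber : compact D.
Proof.
apply: (closed_sub_compact (@compact_eball R m r)); last first.
  by move=> u []; rewrite row_mxKl.
apply: (closed_preimage _ (compact_closed_mx (@compact_face_bundle r))).
by apply: continuous_row_mx; [exact: continuous_id|exact: cst_continuous].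
Qed.

Lemma normal_sum_sub_tube_fiber :
  normal_sum K D `<=` [set y | normal_tube r (y *m W + t *m U)].
Proof.
move=> y [u [ur]]; rewrite row_mxKl row_mxKr => -[x [Px xm] xt] [Ky ym].
have xE : x = x *m W^T *m W + t *m U by rewrite -xt frame_decomp.
have [WW _ _] := fr.
apply/normal_tubeP; exists u; first by move: ur; rewrite row_mxKl.
have -> : y *m W + t *m U - u *m W = (y - u) *m W + t *m U by rewrite mulmxBl addrAC.
split=> // x' Px'; apply: (le_trans (xm _ Px')).
rewrite xE !dotvDl !(dotv_frame _ _ (frameC fr)) !addr0 !dotv_orthonormal//.
by apply: ym; rewrite /K /= -xE.
Qed.

End FibersOverU.

Lemma vol_face_bundle_le r : (vol (m + j) (face_bundle r) <= vol n (normal_tube r))%E.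
Proof.
have mB := @measurable_face_bundle r; have mT := @measurable_normal_tube r.
rewrite vol_row_mxC// (vol_frame nE fr mT); apply: ge0_le_integral => //.
- exact: measurable_vol_sliceC.
- exact: measurable_vol_frame.
move=> t _; have cD := @compact_face_bundle_fiber r t; have cK := @compact_frame_fiber t.
have [->|/set0P[u Du]] := eqVneq [set u | face_bundle r (row_mx u t)] set0.
  by rewrite measure0.
have K0 : [set a | P (a *m W + t *m U)] !=set0.
  move: Du; rewrite /face_bundle /= row_mxKr => -[_ [x [Px _] xt]].
  by exists (x *m W^T); rewrite /= -xt frame_decomp.
apply: (le_trans (vol_normal_sum_ge cK K0 cD)); apply: le_measure; rewrite ?inE.
- exact: measurable_normal_sum.
- by apply: measurable_preimage => //; exact: measurable_frame_map.
- exact: normal_sum_sub_tube_fiber.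
Qed.

Definition rescaled_tube (r : R) : set 'rV[R]_(m + j) :=
  [set z | normal_tube r ((r *: lsubmx z) *m W + rsubmx z *m U)].

Let tube_coords r : set 'rV[R]_(m + j) :=
  [set z | normal_tube r (lsubmx z *m W + rsubmx z *m U)].

Let rescaled_tubeE r :
  rescaled_tube r = [set z | tube_coords r (row_mx (r *: lsubmx z) (rsubmx z))].
Proof. by apply/seteqP; split => z; rewrite /tube_coords /= row_mxKl row_mxKr. Qed.

Let measurable_tube_coords r : measurable (tube_coords r).
Proof. by apply: measurable_frame_coords; exact: measurable_normal_tube. Qed.

Lemma measurable_rescaled_tube r : measurable (rescaled_tube r).
Proof.
rewrite rescaled_tubeE; apply: measurable_preimage; last exact: measurable_tube_coords.
apply: measurable_row_mx; last exact: (measurable_rsubmx (f := fun z : 'rV[R]_(m + j) => z)).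
apply: measurable_scalemx; first exact: measurable_cst.
exact: (measurable_lsubmx (f := fun z : 'rV[R]_(m + j) => z)).
Qed.

Lemma vol_rescaled_tube r : 0 < r ->
  ((r ^+ m)%:E * vol (m + j) (rescaled_tube r) = vol n (normal_tube r))%E.
Proof.
move=> r0; rewrite (vol_frame_coords nE fr (@measurable_normal_tube r)).
by rewrite rescaled_tubeE (vol_dilate_left r0 (@measurable_tube_coords r)).
Qed.

Lemma rescaled_tube_decomp r z : 0 < r -> rescaled_tube r z ->
  exists2 u, face_bundle 1 (row_mx u (rsubmx z)) &
    exists2 x, P x & lsubmx z - u = r^-1 *: (x *m W^T).
Proof.
move=> r0 /normal_tubeP[u ur]; set y := _ *m W + _ => fy; have [WW _ WU] := fr.
have xU : (y - u *m W) *m U^T = rsubmx z.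
  by rewrite mulmxBl (frame_coordr _ _ fr) -mulmxA WU mulmx0 subr0.
exists (r^-1 *: u).
  rewrite /face_bundle /eball /= row_mxKl row_mxKr; split.
    by rewrite enormZ gtr0_norm ?invr_gt0// mulrC ler_pdivrMr// mul1r.
  by exists (y - u *m W); rewrite // -scalemxAl faceZ// invr_gt0.
exists (y - u *m W); first by case: fy.
rewrite mulmxBl (frame_coordl _ _ fr) -mulmxA WW mulmx1 scalerBr scalerA.
by rewrite mulVf ?scale1r// gt_eqF.
Qed.

Lemma rescaled_tube_bounded : exists M : R, forall k,
  rescaled_tube k.+1%:R `<=` [set z | `|z| <= M].
Proof.
have [B B0 bundleB] := compact_norm_le (@compact_face_bundle 1).
have [C C0 PC] := compact_norm_le (compact_shadow (A := W) cP).
exists (B + C) => k z /(rescaled_tube_decomp (ltr0Sn _ _))[u bu [x Px zE]] /=.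
have -> : z = row_mx u (rsubmx z) + row_mx (k.+1%:R^-1 *: (x *m W^T)) 0.
  by rewrite add_row_mx -zE addr0 addrC subrK hsubmxK.
rewrite (le_trans (ler_normD _ _))// lerD ?bundleB//.
apply: norm_row_mx_le; rewrite ?normr0 ?(ltW C0)//.
rewrite normrZ ger0_norm ?invr_ge0// -[leRHS]mul1r ler_pM ?invr_ge0//.
  by rewrite invf_le1// ler1n.
by apply: PC; exists x.
Qed.

Lemma rescaled_tube_lim_sup :
  lim_sup_set (fun k => rescaled_tube k.+1%:R) `<=` face_bundle 1.
Proof.
move=> z z_freq; have [C C0 PC] := compact_norm_le (compact_shadow (A := W) cP).
apply: closed_approx => [|e e0].
  by apply: compact_closed_mx; exact: compact_face_bundle.
have [N Ne] := ex_natSinv_lt (divr_gt0 e0 C0).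
have [k /= Nk /(rescaled_tube_decomp (ltr0Sn _ _))[u bu [x Px zE]]] := z_freq N I.
exists (row_mx u (rsubmx z)) => //.
rewrite -[X in X - _]hsubmxK opp_row_mx add_row_mx subrr zE.
apply: norm_row_mx_le; rewrite ?normr0 ?(ltW e0)// normrZ ger0_norm ?invr_ge0//.
apply: (@le_trans _ _ (N.+1%:R^-1 * C)); last by rewrite -ler_pdivlMr// ltW.
rewrite ler_pM ?invr_ge0//; first by rewrite lef_pV2 ?posrE ?ler_nat.
by apply: PC; exists x.
Qed.

Lemma cvg_vol_normal_tube :
  fine (vol n (normal_tube k.+1%:R)) / k.+1%:R ^+ m @[k --> \oo] -->
  fine (vol (m + j) (face_bundle 1)).
Proof.
have [M tubeM] := rescaled_tube_bounded.
rewrite (_ : (fun k : nat => _) = fun k => fine (vol (m + j) (rescaled_tube k.+1%:R))).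
  apply: (@cvg_measure_lim_sup _ _ _ (vol (m + j)) (fun k => rescaled_tube k.+1%:R)
    _ [set z | `|z| <= M]) => //.
  - by move=> k; exact: measurable_rescaled_tube.
  - exact: measurable_face_bundle.
  - exact: measurable_norm_ball.
  - exact: vol_norm_ball_lty.
  - exact: rescaled_tube_lim_sup.
  move=> k; have k0 : 0 < k.+1%:R ^+ m :> R by rewrite exprn_gt0.
  rewrite -(@lee_pmul2l _ (k.+1%:R ^+ m)%:E) ?lte_fin// vol_rescaled_tube//.
  by rewrite -vol_face_bundleZ//; exact: vol_face_bundle_le.
apply/funext => k; rewrite -vol_rescaled_tube// fineM//; last first.
  rewrite ge0_fin_numE//; apply: le_lt_trans (vol_norm_ball_lty (m + j) M).
  apply: le_measure; rewrite ?inE; [exact: measurable_rescaled_tube|exact: measurable_norm_ball|].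
  exact: tubeM.
by rewrite mulrC mulrA mulVf ?mul1r// expf_neq0.
Qed.

Lemma vol_face_bundle1 (c : R) :
  {ae vol m, forall u, vol j (shadow (face P (u *m W)) U) = c%:E} ->
  vol (m + j) (face_bundle 1) = (c * kappa R m)%:E.
Proof.
move=> aec; have mB := @measurable_face_bundle 1; have mb := @measurable_eball R m 1.
have c0 : 0 <= c by have [u uE] := ae_vol_exists aec; rewrite -lee_fin -uE.
rewrite vol_row_mx// EFinM -kappaE (measure_integral_indic (vol m) mb).
rewrite -ge0_integralZl//; last exact: measurable_EFin_indic.
apply: ge0_ae_eq_integral => //.
- exact: measurable_vol_slice.
- by apply: measurable_funeM; exact: measurable_EFin_indic.
- by move=> x _; rewrite mule_ge0 ?lee_fin.
apply: filterS aec => u uE _; rewrite indicE.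
have [/set_mem u1|/negP u1] := boolP (u \in eball 1).
  rewrite mule1 -uE; congr (vol j _).
  by apply/seteqP; split => t; rewrite /face_bundle /= row_mxKl row_mxKr => // -[].
rewrite mule0 (_ : mkset _ = set0) ?measure0//; apply/seteqP; split => // t.
by rewrite /face_bundle /= row_mxKl => -[u1' _]; apply: u1; exact/mem_set.
Qed.

End NormalTubes.

(** * Area measures *)

Section LocalParallelBodies.
Variables (R : realType) (n : nat).
Implicit Types (K : set 'rV[R]_n) (u b x : 'rV[R]_n) (r s d : R).

Lemma local_parallelP K d (w : set 'rV[R]_n) x : convex_set K ->
  local_parallel K d w x <-> exists p u t,
    [/\ face K u p, enorm u = 1, w u, 0 < t <= d & x = p + t *: u].
Proof.
move=> vK; split=> [[p [Kp [near_p [xp_d wxp]]]]|[p [u [t [fp u1 wu /andP[t0 td] ->]]]]].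
  exists p, (normalize (x - p)), (enorm (x - p)); have /andP[xp0 _] := xp_d.
  rewrite normalizeK face_normalize -?enorm_gt0// enorm_normalize -?enorm_gt0//.
  by split => //; [exact: nearest_face|rewrite addrC subrK].
exists p; rewrite addrC addKr; split; first by case: fp.
rewrite enormZ u1 mulr1 gtr0_norm// scalerA mulVf ?gt_eqF// scale1r t0.
split=> // y Ky; have := @face_nearest _ _ K (t *: u) p y.
by rewrite faceZ// enormZ u1 mulr1 gtr0_norm//; apply.
Qed.

Lemma convex_parallel_body K r : convex_set K -> convex_set (parallel_body K r).
Proof.
move=> vK x y t [a [b [Ka [b1 ->]]]] [a' [b' [Ka' [b'1 ->]]]] t01; have /andP[t0 t1] := t01.
exists (t *: a + (1 - t) *: a'), (t *: b + (1 - t) *: b'); split; first exact: vK.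
split; last by apply/rowP => i; rewrite !mxE; ring.
apply: (le_trans (ler_enormD _ _)); rewrite !enormZ ger0_norm// ger0_norm ?subr_ge0//.
have tb : t * enorm b <= t * 1 by rewrite ler_wpM2l.
have tb' : (1 - t) * enorm b' <= (1 - t) * 1 by rewrite ler_wpM2l// subr_ge0.
lra.
Qed.

Lemma compact_parallel_body K r : compact K -> compact (parallel_body K r).
Proof.
move=> cK; have crx : continuous (fun p : 'rV[R]_n * 'rV[R]_n => p.1 + r *: p.2).
  apply: continuous_add; first exact: continuous_fst.
  by apply: continuous_scale; [exact: cst_continuous|exact: continuous_snd].
have := compact_image (compact_setX cK (@compact_eball R n 1)) crx.
congr compact; apply/seteqP; split => z.
  by move=> [[a b] [/= Ka b1] <-]; exists a, b.
by move=> [a [b [Ka [b1 ->]]]]; exists (a, b).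
Qed.

Lemma measurable_parallel_body K r : compact K -> measurable (parallel_body K r).
Proof. by move=> cK; apply: compact_measurable_mx; exact: compact_parallel_body. Qed.

Lemma vol_parallel_body_fin_num K r : compact K -> vol R n (parallel_body K r) \is a fin_num.
Proof. by move=> cK; apply: vol_compact_fin_num; exact: compact_parallel_body. Qed.

Lemma dotv_unit_eq b u : enorm b <= 1 -> enorm u = 1 -> 1 <= dotv b u -> b = u.
Proof.
move=> b1 u1 bu; apply/eqP; rewrite -subr_eq0 -dotv_eq0 eq_le dotv_ge0 andbT.
rewrite !dotvD [dotv u b]dotvC (enorm_dotv1 u1).
have : dotv b b <= 1 by rewrite -enorm_sq expr_le1// enorm_ge0.
lra.
Qed.

Lemma face_parallel_body K r u x : 0 <= r -> enorm u = 1 ->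
  face (parallel_body K r) u x <-> face K u (x - r *: u).
Proof.
move=> r0 u1; split=> [[[a [b [Ka [b1 ->]]]] ab_max]|[Kx x_max]].
  have r_le : r <= r * dotv b u.
    have := ab_max (a + r *: u); rewrite !dotvD (enorm_dotv1 u1) mulr1 lerD2l; apply.
    by exists a, u; rewrite u1.
  have -> : a + r *: b - r *: u = a.
    have [->|r_neq0] := eqVneq r 0; first by rewrite !scale0r addr0 subr0.
    have {}r0 : 0 < r by rewrite lt0r r_neq0.
    by rewrite (@dotv_unit_eq b u) ?addrK// -(ler_pM2l r0) mulr1.
  split=> // y Ky; have := ab_max (y + r *: b); rewrite !dotvD lerD2r; apply.
  by exists y, b.
split; first by exists (x - r *: u), u; rewrite u1 subrK.
move=> _ [a [b [Ka [b1 ->]]]]; have := x_max _ Ka.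
have : r * dotv b u <= r * 1 by rewrite ler_wpM2l// (le_trans (dotv_le_unit _ u1)).
by rewrite !dotvD (enorm_dotv1 u1); lra.
Qed.

Lemma parallel_body_mono K r s : 0 <= r -> r <= s -> parallel_body K r `<=` parallel_body K s.
Proof.
move=> r0 rs _ [a [b [Ka [b1 ->]]]].
have [s_eq0|s_neq0] := eqVneq s 0.
  by exists a, b; rewrite s_eq0 (_ : r = 0)//; apply/eqP; rewrite eq_le r0 -{1}s_eq0 rs.
have s0 : 0 < s by rewrite lt0r s_neq0 (le_trans r0).
exists a, (r / s *: b); split=> //; rewrite scalerA mulrCA mulfV// mulr1; split=> //.
have rs_ge0 : 0 <= r / s by rewrite divr_ge0// ltW.
by rewrite enormZ ger0_norm// mulr_ile1 ?enorm_ge0// ler_pdivrMr// mul1r.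
Qed.

Section InnerBall.
Variables (K : set 'rV[R]_n) (rho : R).
Hypotheses (cK : compact K) (vK : convex_set K) (rho0 : 0 < rho) (Krho : eball rho `<=` K).

Lemma parallel_body_scale r d : 0 <= d ->
  parallel_body K (r + d) `<=` [set x | parallel_body K r ((1 + d / rho)^-1 *: x)].
Proof.
move=> d0 _ [a [b [Ka [b1 ->]]]]; set q := _^-1.
have dr0 : 0 <= d / rho by rewrite divr_ge0// ltW.
have dr1 : 0 < 1 + d / rho by rewrite ltr_pwDl.
have q0 : 0 < q by rewrite invr_gt0.
have q1 : q <= 1 by rewrite invf_le1// lerDl.
rewrite /=; exists (q *: a + (1 - q) *: (rho *: b)), (q *: b); split.
  apply: vK => //; last by rewrite (ltW q0).
  by apply: Krho; rewrite /eball /= enormZ gtr0_norm// ler_piMr// ltW.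
split; first by rewrite enormZ gtr0_norm// mulr_ile1 ?enorm_ge0 ?(ltW q0).
rewrite scalerDr !scalerA -addrA -scalerDl; congr (_ + _ *: _).
by rewrite /q; field; rewrite !gt_eqF// ltr_wpDr.
Qed.

Lemma vol_parallel_body_le r d : 0 <= d ->
  fine (vol R n (parallel_body K (r + d))) <=
  (1 + d / rho) ^+ n * fine (vol R n (parallel_body K r)).
Proof.
move=> d0; have dr0 : 0 < 1 + d / rho by rewrite ltr_pwDl// divr_ge0// ltW.
have fK := @vol_parallel_body_fin_num K _ cK.
rewrite -lee_fin EFinM !fineK//.
rewrite -(vol_scale (invr_neq0 (lt0r_neq0 dr0)) (measurable_parallel_body r cK)).
rewrite gtr0_norm ?invr_gt0// exprVn muleA -EFinM mulfV ?mul1e; last first.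
  by rewrite expf_neq0// gt_eqF.
apply: le_measure; rewrite ?inE; first exact: measurable_parallel_body.
  apply: measurable_preimage; last exact: measurable_parallel_body.
  by apply: measurable_scalemx; [exact: measurable_cst|exact: measurable_id].
exact: parallel_body_scale.
Qed.

End InnerBall.
End LocalParallelBodies.

Section AreaPolynomial.
Variable R : realType.

Definition primitive (p : {poly R}) : {poly R} :=
  \poly_(k < (size p).+1) (p`_k.-1 / k%:R).

Lemma coef_primitive p k : (primitive p)`_k.+1 = p`_k / k.+1%:R.
Proof.
by rewrite coef_poly ltnS; case: ltnP => // pk; rewrite nth_default// mul0r.
Qed.

Lemma deriv_primitive p : (primitive p)^`() = p.
Proof.
by apply/polyP => k; rewrite coef_deriv coef_primitive -[LHS]mulr_natr mulfVK ?pnatr_eq0.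
Qed.

Definition area_polynomial n (c : nat -> R) : {poly R} :=
  \poly_(k < n) ('C(n.-1, n.-1 - k)%:R * c (n.-1 - k)%N).

Lemma horner_area_polynomial n c r :
  (area_polynomial n c).[r] = \sum_(i < n) r ^+ (n.-1 - i) * 'C(n.-1, i)%:R * c i.
Proof.
rewrite horner_poly (reindex_inj rev_ord_inj) /=; apply: eq_bigr => i _.
have -> : (n - i.+1 = n.-1 - i)%N by rewrite -subn1 -subnDA add1n.
have i_le : (i <= n.-1)%N by case: n i => [[]|n'] // i; exact: (ltn_ord i).
by rewrite subKn// mulrC mulrA.
Qed.

End AreaPolynomial.

Section AreaMeasure.
Variables (R : realType) (m j n : nat) (P : set 'rV[R]_n).
Variables (W : 'M[R]_(m, n)) (U : 'M[R]_(j, n)).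
Local Notation vol := (vol R).
Local Notation tube := (normal_tube P W).
Hypotheses (nE : n = (m + j)%N) (fr : frame W U).
Hypotheses (cP : compact P) (vP : convex_set P).

Lemma normal_tube_mono r s : r <= s -> tube r `<=` tube s.
Proof.
move=> rs x /normal_tubeP[u ur fu]; apply/normal_tubeP.
by exists u => //; exact: le_trans rs.
Qed.

Lemma normal_tube_setDP r s x : 0 <= r -> (tube s `\` tube r) x <-> exists a v d,
  [/\ face P (v *m W) a, enorm v = 1, r < d <= s & x = a + d *: (v *m W)].
Proof.
move=> r0; split=> [[/normal_tubeP[u us fu] x_far]|[a [v [d [fv v1 /andP[rd ds] xE]]]]].
  have ru : r < enorm u.
    by rewrite ltNge; apply/negP => ur; apply: x_far; apply/normal_tubeP; exists u.
  have u0 : u != 0 by rewrite -enorm_gt0 (le_lt_trans r0).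
  exists (x - u *m W), (normalize u), (enorm u); rewrite ru enorm_normalize//.
  rewrite [_ *: (_ *m _)]scalemxAl normalizeK subrK; split=> //.
  by rewrite -scalemxAl faceZ ?invr_gt0 ?enorm_gt0.
have d0 : 0 < d by exact: le_lt_trans rd.
have fd : face P ((d *: v) *m W) (x - (d *: v) *m W).
  by rewrite xE -scalemxAl addrK faceZ.
have enorm_dv : enorm (d *: v) = d by rewrite enormZ v1 mulr1 gtr0_norm.
split; first by apply/normal_tubeP; exists (d *: v); rewrite ?enorm_dv.
move=> /normal_tubeP[u ur fu]; move: ur.
by rewrite (normal_tube_unique fr fu fd) enorm_dv leNgt rd.
Qed.

Lemma local_parallel_tube (E : 'M[R]_n) r e : (W == E)%MS -> 0 <= r ->
  local_parallel (parallel_body P r) e (@sphere R n `&` subsp E) = tube (r + e) `\` tube r.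
Proof.
move=> /eqmxP WE r0; have [WW _ _] := fr.
have vPr := convex_parallel_body (r := r) vP; apply/seteqP; split => x.
  move=> /(local_parallelP _ _ _ vPr)[p [u [d [fp u1 [_ uE] /andP[d0 de] ->]]]].
  have /submxP[v vE] : (u <= W)%MS by rewrite WE.
  apply/normal_tube_setDP => //; exists (p - r *: u), v, (r + d); split.
  - by rewrite -vE -face_parallel_body.
  - by rewrite -(enorm_orthonormal v WW) -vE.
  - by rewrite ltrDl d0 lerD2l.
  - by rewrite -vE scalerDl addrA subrK.
move=> /(normal_tube_setDP _ _ r0)[a [v [d [fv v1 /andP[rd de] ->]]]].
apply/local_parallelP => //; exists (a + r *: (v *m W)), (v *m W), (d - r); split.
- by rewrite face_parallel_body ?addrK ?enorm_orthonormal.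
- by rewrite enorm_orthonormal.
- by split; [rewrite /sphere /= enorm_orthonormal|rewrite /subsp /= -WE submxMl].
- by rewrite subr_gt0 rd lerBlDl.
- by rewrite -addrA -scalerDl [r + _]addrC subrK.
Qed.

Lemma normal_tube_setD_sub r s : 0 <= r ->
  tube s `\` tube r `<=` parallel_body P s `\` parallel_body P r.
Proof.
have [WW _ _] := fr.
move=> r0 x /(normal_tube_setDP _ _ r0)[a [v [d [[Pa a_max] v1 /andP[rd ds] xE]]]].
have w1 : enorm (v *m W) = 1 by rewrite enorm_orthonormal.
split.
  apply: (parallel_body_mono (le_trans r0 (ltW rd)) ds).
  by exists a, (v *m W); rewrite w1.
move=> [a' [b [Pa' [b1]]]] /(congr1 (fun y => dotv y (v *m W))); have := a_max _ Pa'.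
have : r * dotv b (v *m W) <= r * 1 by rewrite ler_wpM2l// (le_trans (dotv_le_unit _ w1)).
by rewrite xE !dotvD (enorm_dotv1 w1); lra.
Qed.

Local Notation tube_vol r := (fine (vol n (tube r))).
Local Notation body_vol r := (fine (vol n (parallel_body P r))).

Lemma fine_vol_setD (A B : set 'rV[R]_n) : compact A -> compact B -> A `<=` B ->
  fine (vol n (B `\` A)) = fine (vol n B) - fine (vol n A).
Proof.
move=> cA cB AB; have fA := vol_compact_fin_num cA; have fB := vol_compact_fin_num cB.
have [mA mB] := (compact_measurable_mx cA, compact_measurable_mx cB).
rewrite measureD//; last by rewrite -ge0_fin_numE.
by rewrite setIC (setIidl AB) fineB.
Qed.

Lemma vol_normal_tube_setD r s : r <= s ->
  fine (vol n (tube s `\` tube r)) = tube_vol s - tube_vol r.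
Proof.
by move=> rs; apply: fine_vol_setD; [exact: compact_normal_tube..|exact: normal_tube_mono].
Qed.

Lemma vol_normal_tube_increment r s : 0 <= r -> r <= s ->
  tube_vol s - tube_vol r <= body_vol s - body_vol r.
Proof.
move=> r0 rs; rewrite -vol_normal_tube_setD//.
have bodyD := fine_vol_setD (compact_parallel_body (r := r) cP)
  (compact_parallel_body (r := s) cP) (parallel_body_mono r0 rs).
rewrite -bodyD; have mb t := measurable_parallel_body t cP.
have mt t := measurable_normal_tube W cP t.
have fin_setD (A B : set 'rV[R]_n) : compact A -> measurable B -> vol n (A `\` B) \is a fin_num.
  move=> cA mB; have mA := compact_measurable_mx cA.
  rewrite ge0_fin_numE//; apply: le_lt_trans (vol_compact_lty cA).
  by apply: le_measure; rewrite ?inE//; exact: measurableD.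
apply: fine_le.
- by apply: fin_setD => //; exact: compact_normal_tube.
- by apply: fin_setD => //; exact: compact_parallel_body.
apply: le_measure; rewrite ?inE; try exact: measurableD.
exact: normal_tube_setD_sub.
Qed.

Section InnerBall.
Variable rho : R.
Hypotheses (rho0 : 0 < rho) (Prho : eball rho `<=` P).

Lemma vol_normal_tube_modulus r s : 0 <= s -> s <= r ->
  `|tube_vol r - tube_vol s| <= ((1 + (r - s) / rho) ^+ n - 1) * body_vol r.
Proof.
move=> s0 sr; have rs0 : 0 <= r - s by rewrite subr_ge0.
rewrite ger0_norm; last first.
  by rewrite -vol_normal_tube_setD// fine_ge0.
apply: (le_trans (vol_normal_tube_increment s0 sr)).
have := vol_parallel_body_le cP vP rho0 Prho s rs0; rewrite addrC subrK => body_le.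
apply: (@le_trans _ _ (((1 + (r - s) / rho) ^+ n - 1) * body_vol s)).
  by rewrite mulrBl mul1r lerB.
rewrite ler_wpM2l//; first by rewrite subr_ge0 exprn_ege1// lerDl divr_ge0// ltW.
apply: fine_le; [exact: vol_parallel_body_fin_num..|].
by apply: le_measure; rewrite ?inE; [exact: measurable_parallel_body..|exact: parallel_body_mono].
Qed.

Lemma cvg_at_left_vol_normal_tube r : 0 < r -> tube_vol s @[s --> r^'-] --> tube_vol r.
Proof.
move=> r0; pose p : {poly R} := ((1 + (r%:P - 'X) * (rho^-1)%:P) ^+ n - 1) * (body_vol r)%:P.
have pE s : p.[s] = ((1 + (r - s) / rho) ^+ n - 1) * body_vol r by rewrite /p !hornerE.
have pr : p.[r] = 0 by rewrite pE subrr mul0r addr0 expr1n subrr mul0r.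
have cp : p.[s] @[s --> r^'-] --> 0.
  by rewrite -pr; apply: cvg_at_left_filter; exact: continuous_horner.
apply/cvgrPdist_le => e e0; move/cvgrPdist_le: cp => /(_ _ e0) near_p.
near=> s; apply: (@le_trans _ _ p.[s]).
  rewrite pE; apply: vol_normal_tube_modulus; first by near: s; exact: nbhs_left_ge.
  by near: s; exact: nbhs_left_le.
apply: (le_trans (ler_norm _)); rewrite -normrN -sub0r; near: s; exact: near_p.
Unshelve. all: by end_near. Qed.

Lemma vol_normal_tube_polynomial (E : 'M[R]_n) (c : nat -> R) : (W == E)%MS ->
  area_measures_at P (@sphere R n `&` subsp E) c ->
  exists a : R, forall r, 0 <= r -> tube_vol r = a + (primitive (area_polynomial n c)).[r].
Proof.
move=> WE areaP; set p := primitive _; exists (tube_vol 0 - p.[0]) => r r0.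
rewrite addrAC; apply: (@eq_horner_right_derivative R (fun s => tube_vol s) p) => //.
  move=> s s0; rewrite deriv_primitive horner_area_polynomial.
  apply: cvg_trans (areaP s s0); apply: near_eq_cvg.
  near=> e; have e0 : 0 < e by near: e; exact: nbhs_right_gt.
  rewrite (local_parallel_tube _ WE s0) volnE ?vol_normal_tube_setD ?lerDl ?ltW//.
  by apply: measurableD; exact: measurable_normal_tube.
by move=> s s0; exact: cvg_at_left_vol_normal_tube.
Unshelve. all: by end_near. Qed.

(* The volume of the tube of radius r is a polynomial in r, whose coefficient of degree m
   is given both by an area measure and by the growth of the tubes. *)
Lemma area_measure_face_shadow (E : 'M[R]_n) (a : nat -> R) (c : R) : (0 < m)%N ->
  (W == E)%MS -> {ae vol m, forall u, vol j (shadow (face P (u *m W)) U) = c%:E} ->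
  area_measures_at P (@sphere R n `&` subsp E) a ->
  'C(n.-1, j)%:R * a j = m%:R * (c * kappa R m).
Proof.
move=> m0 WE aec areaP.
have [b tubeE] := vol_normal_tube_polynomial WE areaP.
pose q := primitive (area_polynomial n a) + b%:P.
have growth : q.[k.+1%:R] / k.+1%:R ^+ m @[k --> \oo] -->
    c * kappa R m.
  have := cvg_vol_normal_tube nE fr cP; rewrite (vol_face_bundle1 cP aec).
  rewrite (_ : (fun k : nat => tube_vol _ / _) = fun k : nat => q.[k.+1%:R] / k.+1%:R ^+ m)//.
  by apply/funext => k; rewrite tubeE// hornerD hornerC addrC.
have := coef_cvg_horner_divXn growth; rewrite /q coefD coefC gtn_eqF// addr0 => <-.
rewrite -(prednK m0) coef_primitive prednK// mulrCA mulfV ?pnatr_eq0 -?lt0n// mulr1.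
have jE : (n.-1 - m.-1)%N = j by rewrite nE -[m in LHS](prednK m0) /= addKn.
have m_lt : (m.-1 < n)%N by rewrite nE prednK// leq_addr.
by rewrite coef_poly m_lt jE.
Qed.

End InnerBall.
End AreaMeasure.

(** * Convex hulls and faces of positive volume *)

Section ConvexHulls.
Variable R : realType.
Implicit Types (k m n : nat).

Lemma convex_set_sum n (A : set 'rV[R]_n) k (x : 'I_k -> 'rV[R]_n) (l : 'I_k -> R) :
  convex_set A -> (forall i, A (x i)) -> (forall i, 0 <= l i) -> \sum_i l i = 1 ->
  A (\sum_i l i *: x i).
Proof.
move=> vA; elim: k x l => [|k IH] x l Ax l0.
  by rewrite big_ord0 => /eqP; rewrite eq_sym oner_eq0.
rewrite !big_ord_recl => l1.
pose s := \sum_(i < k) l (lift ord0 i).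
have s0 : 0 <= s by apply: sumr_ge0.
have lE : l ord0 = 1 - s by rewrite -l1 /s addrK.
have [s_eq0|s_neq0] := eqVneq s 0.
  have l_eq0 i : l (lift ord0 i) = 0 by apply: (psumr_eq0P _ s_eq0) => // j _.
  rewrite big1; last by move=> i _; rewrite l_eq0 scale0r.
  by rewrite lE s_eq0 subr0 scale1r addr0.
have -> : \sum_(i < k) l (lift ord0 i) *: x (lift ord0 i) =
    s *: \sum_(i < k) (l (lift ord0 i) / s) *: x (lift ord0 i).
  by rewrite scaler_sumr; apply: eq_bigr => i _; rewrite scalerA mulrCA mulfV ?mulr1.
rewrite addrC lE; apply: vA => //.
  apply: IH => //; first by move=> i; rewrite divr_ge0.
  by rewrite -mulr_suml mulfV.
by rewrite s0 /= -subr_ge0 -lE.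
Qed.

Definition feasible k m (A : 'M[R]_(k, m)) (y : 'rV[R]_m) : set 'rV[R]_k :=
  [set a : 'rV[R]_k | (forall i, 0 <= a 0 i) /\ a *m A = y].

Definition hull k n (V : 'M[R]_(k, n)) : set 'rV[R]_n :=
  [set a *m V | a in feasible (const_mx 1) 1%:M].

Lemma feasible_const1P k (a : 'rV[R]_k) :
  feasible (const_mx 1) 1%:M a <-> (forall i, 0 <= a 0 i) /\ \sum_i a 0 i = 1.
Proof.
have sumE : a *m const_mx 1 = (\sum_i a 0 i)%:M :> 'M[R]_1.
  apply/matrixP => i i'; rewrite !ord1 !mxE eqxx mulr1n.
  by apply: eq_bigr => l _; rewrite mxE mulr1.
rewrite /feasible /= sumE; split=> -[a0]; last by move=> ->.
by move=> /matrixP/(_ 0 0); rewrite !mxE eqxx !mulr1n.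
Qed.

Lemma polytopeP n (P : set 'rV[R]_n) :
  polytope P <-> exists k (V : 'M[R]_(k, n)), P = hull V.
Proof.
split=> [[k [p ->]]|[k [V ->]]].
  exists k, (\matrix_i p i); apply/seteqP; split=> x.
    move=> [l [l0 [l1 ->]]]; exists (\row_i l i).
      apply/feasible_const1P; split=> [i|]; rewrite ?mxE// -l1.
      by apply: eq_bigr => i _; rewrite mxE.
    by rewrite mulmx_sum_row; apply: eq_bigr => i _; rewrite mxE rowK.
  move=> [a /feasible_const1P[a0 a1] <-]; exists (a 0); split=> //; split=> //.
  by rewrite mulmx_sum_row; apply: eq_bigr => i _; rewrite rowK.
exists k, (fun i => row i V); apply/seteqP; split=> x.
  move=> [a /feasible_const1P[a0 a1] <-]; exists (a 0); split=> //; split=> //.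
  exact: mulmx_sum_row.
move=> [l [l0 [l1 ->]]]; exists (\row_i l i).
  by apply/feasible_const1P; split=> [i|]; rewrite ?mxE// -l1; apply: eq_bigr => i _; rewrite mxE.
by rewrite mulmx_sum_row; apply: eq_bigr => i _; rewrite mxE.
Qed.

Lemma convex_hull k n (V : 'M[R]_(k, n)) : convex_set (hull V).
Proof.
move=> _ _ t [a [a0 a1] <-] [b [b0 b1] <-] /andP[t0 t1].
exists (t *: a + (1 - t) *: b); last by rewrite mulmxDl -!scalemxAl.
split=> [i|]; first by rewrite !mxE addr_ge0// mulr_ge0// subr_ge0.
by rewrite mulmxDl -!scalemxAl a1 b1 -scalerDl addrC subrK scale1r.
Qed.

Lemma row_hull k n (V : 'M[R]_(k, n)) i : hull V (row i V).
Proof.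
exists (delta_mx 0 i); last by rewrite -rowE.
apply/feasible_const1P; split=> [l|]; first by rewrite mxE ler0n.
rewrite (bigD1 i)//= mxE !eqxx big1 ?addr0// => l /negbTE il.
by rewrite mxE il andbF.
Qed.

Lemma hull_sub k n (V : 'M[R]_(k, n)) (A : set 'rV[R]_n) :
  convex_set A -> (forall i, A (row i V)) -> hull V `<=` A.
Proof.
move=> vA VA _ [a /feasible_const1P[a0 a1] <-]; rewrite mulmx_sum_row.
exact: convex_set_sum.
Qed.

Lemma convex_halfspace n (u : 'rV[R]_n) (h : R) : convex_set [set x | dotv x u <= h].
Proof.
move=> x y t /= xh yh /andP[t0 t1]; rewrite !dotvD.
have tx : t * dotv x u <= t * h by rewrite ler_wpM2l.
have ty : (1 - t) * dotv y u <= (1 - t) * h by rewrite ler_wpM2l// subr_ge0.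
lra.
Qed.

End ConvexHulls.

Section AffineSpan.
Variable R : realType.
Local Notation vol := (vol R).
Implicit Types (m n k : nat).

Lemma ex_dotv_neq0 m (A : set 'rV[R]_m) a c : measurable A -> (0 < vol m A)%E -> c != 0 ->
  exists2 x, A x & dotv (x - a) c != 0.
Proof.
move=> mA A0 c0; apply: contrapT => flat; move: A0; rewrite ltNge => /negP; apply.
rewrite -(vol_hyperplane0 a c0); apply: le_measure; rewrite ?inE//.
  by apply: closed_measurable_mx; exact: closed_hyperplane.
by move=> x Ax /=; apply/eqP; apply: contrapT => /negP xc; apply: flat; exists x.
Qed.

Lemma ex_orthogonal_row k m (N : 'M[R]_(k, m)) : (k < m)%N ->
  exists2 c : 'rV[R]_m, c != 0 & c *m N^T = 0.
Proof.
move=> km; have ker0 : kermx N^T != 0.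
  rewrite kermx_eq0 -row_leq_rank mxrank_tr -ltnNge.
  exact: leq_ltn_trans (rank_leq_row N) km.
exists (nz_row (kermx N^T)); first by rewrite nz_row_eq0.
by apply/eqP; rewrite -sub_kermx nz_row_sub.
Qed.

Lemma row_free_col_mx k m (x c : 'rV[R]_m) (N : 'M[R]_(k, m)) :
  row_free N -> c *m N^T = 0 -> dotv x c != 0 -> row_free (col_mx x N).
Proof.
move=> fN cN xc; apply: inj_row_free => w; rewrite -[w]hsubmxK mul_row_col => wE.
have w1 : lsubmx (w : 'rV[R]_(1 + k)) = 0.
  have := congr1 (mulmx^~ c^T) wE; rewrite mulmxDl -!mulmxA mul0mx.
  have -> : N *m c^T = 0 by apply: (can_inj trmxK); rewrite trmx_mul trmxK cN trmx0.
  rewrite mulmx0 addr0 mul_trmx_dotv mul_mx_scalar => /eqP.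
  by rewrite scaler_eq0 (negbTE xc) => /eqP.
move: wE; rewrite w1 mul0mx add0r => /eqP; rewrite mulmx_free_eq0// => /eqP ->.
exact: row_mx0.
Qed.

Lemma ex_row_free_differences m (A : set 'rV[R]_m) a k : measurable A -> (0 < vol m A)%E ->
  (k <= m)%N -> exists2 N : 'M[R]_(k, m), row_free N &
    forall i, exists2 x, A x & row i N = x - a.
Proof.
move=> mA A0; elim: k => [|k IH] km; first by exists 0; [rewrite -row_leq_rank|case].
have [N fN Nd] := IH (ltnW km); have [c c0 cN] := ex_orthogonal_row N km.
have [x Ax xc] := ex_dotv_neq0 a mA A0 c0.
exists (col_mx (x - a) N); first exact: row_free_col_mx cN xc.
move=> i; case: (@split_ordP 1 k i) => i' ->.
  by exists x => //; rewrite (@rowKu _ 1 k) ord1 row_id.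
by have [y Ay yE] := Nd i'; exists y => //; rewrite (@rowKd _ 1 k).
Qed.

Lemma ex_unitmx_differences m (A : set 'rV[R]_m) : measurable A -> (0 < vol m A)%E ->
  exists2 N : 'M[R]_m, N \in unitmx & forall i, exists x y, [/\ A x, A y & row i N = x - y].
Proof.
move=> mA A0; have [a Aa] : A !=set0.
  by apply/set0P; apply: contraTneq A0 => ->; rewrite measure0 ltxx.
have [N fN Nd] := ex_row_free_differences a mA A0 (leqnn m).
exists N; first by rewrite -row_free_unit.
by move=> i; have [x Ax xE] := Nd i; exists x, a.
Qed.

Lemma interior_box m (A : set 'rV[R]_m) (N : 'M[R]_m) c (e : R) : N \in unitmx -> 0 < e ->
  (forall t : 'rV[R]_m, (forall i, `|t 0 i| <= e) -> A (c + t *m N)) -> A° c.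
Proof.
move=> uN e0 box.
have coords : continuous (fun z : 'rV[R]_m => (z - c) *m invmx N).
  by apply: continuous_mulmxr; apply: continuous_sub; [exact: continuous_id|exact: cst_continuous].
have /coords near_c : nbhs ((c - c) *m invmx N) (ball ((c - c) *m invmx N) e).
  exact: nbhsx_ballx.
apply: (@filterS _ (nbhs c) (nbhs_filter c) _ A _ near_c) => z.
rewrite subrr mul0mx /= => /mx_ballP[_ z_small].
have := box ((z - c) *m invmx N); rewrite -mulmxA mulVmx// mulmx1 [c + _]addrC subrK; apply.
by move=> i; have := z_small 0 i; rewrite mxE sub0r normrN => /ltW.
Qed.

(* The box is centred at the average of the midpoints of the segments [x, y]. *)
Lemma interior_of_differences m (A : set 'rV[R]_m) (N : 'M[R]_m) :
  convex_set A -> A !=set0 -> N \in unitmx ->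
  (forall i, exists x y, [/\ A x, A y & row i N = x - y]) -> A° !=set0.
Proof.
move=> vA [a0 Aa0] uN /choice[x /choice[y xy]].
have [m0|m0] := posnP m.
  subst m; exists a0; rewrite (_ : A = setT); first exact: filterT.
  by apply/seteqP; split => // b _; rewrite [b]thinmx0 -[0](thinmx0 a0).
have M0 : 0 < m%:R :> R by rewrite ltr0n.
pose c := \sum_i m%:R^-1 *: (2^-1 *: (x i + y i)).
exists c; apply: (interior_box (e := (2 * m%:R)^-1) uN); first by rewrite invr_gt0 mulr_gt0.
move=> t t_small; pose s i := 2^-1 + m%:R * t 0 i.
have -> : c + t *m N = \sum_i m%:R^-1 *: (s i *: x i + (1 - s i) *: y i).
  rewrite mulmx_sum_row -big_split /=; apply: eq_bigr => i _.
  have [_ _ ->] := xy i; apply/rowP => k; rewrite !mxE /s; field.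
  by rewrite gt_eqF.
apply: convex_set_sum => //.
- move=> i; have [Ax Ay _] := xy i; apply: vA => //.
  have : `|m%:R * t 0 i| <= 2^-1.
    rewrite normrM gtr0_norm// (le_trans (ler_wpM2l (ltW M0) (t_small i)))//.
    by rewrite invfM mulrCA mulfV ?mulr1// gt_eqF.
  by rewrite ler_norml /s; lra.
- by rewrite sumr_const card_ord -(mulr_natr m%:R^-1) mulVf// gt_eqF.
Qed.

Lemma vol_shadow_gt0 k n (G : set 'rV[R]_n) (M U : 'M[R]_(k, n)) :
  compact G -> convex_set G -> G !=set0 -> orthonormal U -> (M == U)%MS ->
  (forall i, exists x y, [/\ G x, G y & row i M = x - y]) -> (0 < vol k (shadow G U))%E.
Proof.
move=> cG vG [x0 Gx0] UU /eqmxP MU Md.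
apply: vol_interior_gt0; first exact: measurable_shadow.
apply: (@interior_of_differences _ _ (M *m U^T)).
- move=> _ _ t [x Gx <-] [y Gy <-] t01.
  by exists (t *: x + (1 - t) *: y); [exact: vG|rewrite mulmxDl !scalemxAl].
- by exists (x0 *m U^T); exists x0.
- have /submxP[D DE] : (M <= U)%MS by rewrite MU.
  rewrite -row_free_unit -row_leq_rank DE -mulmxA UU mulmx1.
  by apply: leq_trans (mxrankM_maxl D U); rewrite -DE MU (orthonormal_rank UU).
- move=> i; have [x [y [Gx Gy xyE]]] := Md i.
  exists (x *m U^T), (y *m U^T); split; [by exists x|by exists y|].
  by rewrite row_mul xyE mulmxBl.
Qed.

Lemma ae_exists_nbhs m (A B : set 'rV[R]_m) (a : 'rV[R]_m) :
  {ae vol m, forall x, A x} -> nbhs a B -> exists2 x, B x & A x.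
Proof.
move=> aeA aB; have mB : measurable B°.
  rewrite -[B°]setCK; apply: measurableC; apply: closed_measurable_mx.
  by apply: open_closedC; exact: open_interior.
have B0 : (0 < vol m B°)%E.
  by apply: vol_interior_gt0 mB _; exists a; exact: nbhs_interior.
have [x xB Ax] := ae_exists_in aeA mB B0.
by exists x => //; exact: interior_subset.
Qed.

End AffineSpan.

Section UniqueFacePoint.
Variables (R : realType) (k : nat) (K : set 'rV[R]_k).
Hypotheses (cK : compact K) (K0 : K !=set0).
Local Notation vol := (vol R).

Let coord_gap (i : 'I_k) (e : R) : set 'rV[R]_k := [set v | exists2 x, K x &
  exists2 y, K y & [/\ face K v x, face K v y & e <= x 0 i - y 0 i]].

Let closed_coord_gap i e : closed (coord_gap i e).
Proof.
pose T := ('rV[R]_k * ('rV[R]_k * 'rV[R]_k))%type.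
have c1 : continuous (fun p : T => p.1) by exact: continuous_fst.
have c21 : continuous (fun p : T => p.2.1).
  by move=> p; apply: continuous_comp; [exact: cvg_snd|exact: cvg_fst].
have c22 : continuous (fun p : T => p.2.2).
  by move=> p; apply: continuous_comp; [exact: cvg_snd|exact: cvg_snd].
pose gap := [set p : T | face K p.2.2 p.2.1 /\ face K p.2.2 p.1 /\
  e <= (p.2.1 - p.1) 0 i].
have cgap : closed gap.
  apply: closedI; first exact: (closed_face cK K0 c22 c21).
  apply: closedI; first exact: (closed_face cK K0 c22 c1).
  apply: closed_le_fun; first exact: cst_continuous.
  by apply: continuous_coord; exact: continuous_sub c21 c1.
have := closed_exists_compact cK (closed_exists_compact cK cgap).
congr closed; apply/seteqP; split=> v [x Kx [y Ky]].
  by move=> [fx [fy xy]]; exists x => //; exists y => //; move: xy; rewrite /= !mxE.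
by move=> [fx fy xy]; exists x => //; exists y => //; rewrite /gap /= !mxE.
Qed.

Lemma face_coord_mono v i a b x y : a < b ->
  face K (v + a *: delta_mx 0 i) x -> face K (v + b *: delta_mx 0 i) y -> x 0 i <= y 0 i.
Proof.
move=> ab [Kx xm] [Ky ym]; have := xm _ Ky; have := ym _ Kx.
rewrite !dotvD !dotv_delta => yx xy.
by rewrite -(ler_pM2l (_ : 0 < b - a)) ?subr_gt0//; lra.
Qed.

(* The intervals of i-th coordinates of the faces with normals v + l e_i are
   non-overlapping, and each non-degenerate one contains a rational. *)
Let countable_coord_gap_line i e v : 0 < e ->
  countable [set l | coord_gap i e (v + l *: delta_mx 0 i)].
Proof.
move=> e0; set Z := mkset _.
have /choice[r rP] l : exists r : rat, Z l -> exists x y, [/\ face K (v + l *: delta_mx 0 i) x,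
    face K (v + l *: delta_mx 0 i) y & y 0 i < ratr r < x 0 i].
  have [[x _ [y _ [fx fy xy]]]|nZ] := pselect (Z l); last by exists 0.
  have lt_yx : y 0 i < x 0 i by rewrite -subr_gt0; exact: lt_le_trans xy.
  by have [r] := rat_in_itvoo lt_yx; rewrite in_itv /= => yrx; exists r => _; exists x, y.
have r_neq a b : a < b -> Z a -> Z b -> r a <> r b.
  move=> ab /rP[x [_ [fx _ /andP[_ rx]]]] /rP[_ [y [_ fy /andP[yr _]]]] rab.
  by have := lt_trans yr (eq_ind _ (fun q => ratr q < x 0 i) rx _ rab);
    rewrite ltNge (face_coord_mono ab fx fy).
apply/countable_injP; exists (pickle \o r) => a b /set_mem Za /set_mem Zb.
move=> /(pcan_inj pickleK) rab; case: (ltgtP a b) => // lt_ab.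
  by case: (r_neq _ _ lt_ab Za Zb).
by case: (r_neq _ _ lt_ab Zb Za).
Qed.

Let vol0_coord_gap i e : 0 < e -> vol k (coord_gap i e) = 0%E.
Proof.
move=> e0; apply: (@vol0_segments R k _ (delta_mx 0 i)).
  by apply: closed_measurable_mx; exact: closed_coord_gap.
move=> v; apply: countable_lebesgue_measure0.
by apply: sub_countable (countable_coord_gap_line i v e0); apply: subset_card_le => l [].
Qed.

Lemma ae_face_unique : {ae vol k, forall v, forall x y, face K v x -> face K v y -> x = y}.
Proof.
have ae_no_coord_gap i : {ae vol k, forall v, forall q, ~ coord_gap i q.+1%:R^-1 v}.
  apply: ae_foralln => q; exists (coord_gap i q.+1%:R^-1).
  split; last by move=> v /= /contrapT.
    by apply: closed_measurable_mx; exact: closed_coord_gap.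
  exact: vol0_coord_gap.
have ae_no_gap : {ae vol k, forall v, forall i q, ~ coord_gap i q.+1%:R^-1 v}.
  by apply: filter_forall => i; exact: ae_no_coord_gap.
apply: filterS ae_no_gap => v no_gap.
have coord_le i a b : face K v a -> face K v b -> a 0 i <= b 0 i.
  move=> fa fb; rewrite leNgt; apply/negP => lt_ba.
  have [q] := ltr_add_invr lt_ba; rewrite -ltrBrDl => ab_gap.
  apply: (no_gap i q); exists a; first by case: fa.
  by exists b; [case: fb|split => //; exact: ltW].
by move=> x y fx fy; apply/rowP => i; apply/eqP; rewrite eq_le !coord_le.
Qed.

End UniqueFacePoint.

Section ParallelFaces.
Variable R : realType.
Local Notation vol := (vol R).

Lemma polytope_face_near n (P : set 'rV[R]_n) u0 : polytope P ->
  \forall u \near u0, (forall x y, face P u0 x -> face P u0 y -> dotv (x - y) u = 0) ->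
    face P u0 `<=` face P u.
Proof.
move=> /polytopeP[k [V ->]].
have [->|/set0P[x0 fx0]] := eqVneq (face (hull V) u0) set0; first by apply: filterE => u _ x [].
have row_le i : \forall u \near u0,
    (forall x y, face (hull V) u0 x -> face (hull V) u0 y -> dotv (x - y) u = 0) ->
    dotv (row i V) u <= dotv x0 u.
  have [fi|nfi] := pselect (face (hull V) u0 (row i V)).
    by apply: filterE => u /(_ _ _ fi fx0)/eqP; rewrite dotvBl subr_eq0 => /eqP ->.
  have lt_i : dotv (row i V - x0) u0 < 0.
    rewrite dotvBl subr_lt0 ltNge; apply/negP => le_i; apply: nfi; split=> [|y Vy].
      exact: row_hull.
    by apply: le_trans le_i; case: fx0 => _; exact.
  have c_i : continuous (fun u => dotv (row i V - x0) u).
    by apply: continuous_dotv; [exact: cst_continuous|exact: continuous_id].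
  have near_lt : \forall u \near u0, dotv (row i V - x0) u < 0 := c_i u0 _ (lt_nbhsl lt_i).
  near=> u => _; rewrite -subr_le0 -dotvBl ltW//; near: u; exact: near_lt.
near=> u => flat x fx; split=> [|y]; first by case: fx.
have -> : dotv x u = dotv x0 u by apply/eqP; rewrite -subr_eq0 -dotvBl flat.
apply: (hull_sub (@convex_halfspace _ _ u _)) => i; move: i flat; near: u.
by apply: filter_forall => i; exact: row_le.
Unshelve. all: by end_near. Qed.

Lemma face_dotv_const n (P : set 'rV[R]_n) u x y :
  face P u x -> face P u y -> dotv (x - y) u = 0.
Proof.
move=> [Px xm] [Py ym]; apply/eqP; rewrite dotvBl subr_eq0 eq_le.
by rewrite xm// ym.
Qed.

Lemma face_shadow_dotv k n (Q : set 'rV[R]_n) (U : 'M[R]_(k, n)) v x :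
  face Q (v *m U) x -> face (shadow Q U) v (x *m U^T).
Proof.
move=> [Qx xm]; split; first by exists x.
by move=> _ [y Qy <-]; rewrite -!dotv_mulmxr; exact: xm.
Qed.

Lemma has_face_parallel_vol_gt0 m j n (Q : set 'rV[R]_n) (W : 'M[R]_(m, n)) (U : 'M[R]_(j, n))
    (F : 'M[R]_n) v : n = (m + j)%N -> frame W U -> (W == F)%MS -> compact Q ->
  (forall x y, face (shadow Q U) v x -> face (shadow Q U) v y -> x = y) ->
  (0 < vol m (shadow (face Q (v *m U)) W))%E -> has_face_parallel Q m F.
Proof.
move=> nE fr /eqmxP WF cQ uniq_v vol_gt0.
have faceD x y : face Q (v *m U) x -> face Q (v *m U) y -> x - y = (x - y) *m W^T *m W.
  move=> fx fy; rewrite -[LHS](frame_decomp _ nE fr) [X in _ + X *m _]mulmxBl.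
  by rewrite (uniq_v _ _ (face_shadow_dotv fx) (face_shadow_dotv fy)) subrr mul0mx addr0.
have mface : measurable (shadow (face Q (v *m U)) W).
  by apply: measurable_shadow; exact: compact_face.
have [N uN Nd] := ex_unitmx_differences mface vol_gt0.
exists (v *m U); split.
  by move=> x y fx fy; rewrite -WF (faceD x y)// submxMl.
exists (N *m W); split.
  by apply/eqmxP; apply: eqmx_trans WF; apply: eqmxMfull; rewrite row_full_unit.
move=> i; have [_ [_ [[x fx <-] [y fy <-] xyE]]] := Nd i.
by exists x, y; split => //; split => //; rewrite row_mul xyE -mulmxBl -faceD.
Qed.

Lemma has_face_parallel_perp m j n (P Q : set 'rV[R]_n) (F : 'M[R]_n) :
  n = (m.+1 + j.+1)%N -> polytope P ->
  compact P -> convex_set P -> P !=set0 -> origin_symmetric P ->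
  compact Q -> convex_set Q -> Q !=set0 -> origin_symmetric Q ->
  complementary_shadows m.+1 j.+1 P Q -> \rank F = j.+1 ->
  has_face_parallel P j.+1 F -> has_face_parallel Q m.+1 (perp F).
Proof.
move=> nE pP cP vP P0 sP cQ vQ Q0 sQ PQ rF [u0]; rewrite -/(face P u0).
set G := face P u0 => -[GF [M [/eqmxP MF Md]]].
have nE' : n = (j.+1 + m.+1)%N by rewrite addnC.
have [U UU UF] := ex_orthonormal_basis rF; have [W /frameC fr] := ex_frame nE' UU.
have WF := frame_perp nE fr UF.
have flat w x y : G x -> G y -> dotv (x - y) (w *m W) = 0.
  move=> Gx Gy; have /submxP[D ->] : (x - y <= U)%MS by move/eqmxP: UF => ->; exact: GF.
  exact: dotv_frame (frameC fr).
have u0U : u0 *m U^T = 0.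
  have u0M : u0 *m M^T = 0.
    apply/eqP; rewrite mulmx_tr_eq0; apply/forallP => i; apply/eqP.
    by have [x [y [fx [fy ->]]]] := Md i; rewrite dotvC (face_dotv_const fx fy).
  have /submxP[D ->] : (U <= M)%MS by move/eqmxP: UF => UF; rewrite MF UF.
  by rewrite trmx_mul mulmxA u0M mul0mx.
have u0E : u0 *m W^T *m W = u0.
  by rewrite -[RHS](frame_decomp u0 nE fr) u0U mul0mx addr0.
have near_w0 : \forall w \near u0 *m W^T, G `<=` face P (w *m W).
  have cW : continuous (fun w : 'rV[R]_m.+1 => w *m W) by exact/continuous_mulmxr/continuous_id.
  have near_u0 : nbhs u0 [set u | (forall x y, G x -> G y -> dotv (x - y) u = 0) ->
      G `<=` face P u] := polytope_face_near u0 pP.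
  rewrite -u0E in near_u0.
  apply: (@filterS _ (nbhs (u0 *m W^T)) (nbhs_filter _) _ _ _ (cW _ _ near_u0)) => w; apply.
  exact: flat.
have [c [aeP aeQ]] := ae_vol_face_shadow cP vP sP cQ vQ sQ PQ fr.
have c0 : (0 < c%:E)%E.
  have [w Gw <-] := ae_exists_nbhs aeP near_w0.
  have cG := compact_face (u := u0) cP.
  have MU : (M == U)%MS by apply/eqmxP; apply: eqmx_trans MF (eqmx_sym _); exact/eqmxP.
  have G0 : (0 < vol j.+1 (shadow G U))%E.
    apply: (vol_shadow_gt0 cG (convex_face vP) (face_nonempty _ cP P0) UU MU) => i.
    by have [x [y [Gx [Gy xyE]]]] := Md i; exists x, y.
  apply: (lt_le_trans G0); apply: le_measure; rewrite ?inE; [exact: measurable_shadow| |].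
    by apply: measurable_shadow; exact: compact_face.
  by move=> _ [x Gx <-]; exists x => //; exact: Gw.
have QU0 : shadow Q U !=set0 by case: Q0 => x Qx; exists (x *m U^T); exists x.
have [v [vc v_uniq]] := ae_vol_exists (filterI aeQ
  (ae_face_unique (compact_shadow (A := U) cQ) QU0)).
by apply: (has_face_parallel_vol_gt0 nE fr WF cQ (v := v)) => //; rewrite vc.
Qed.

End ParallelFaces.

(** * Stability of the optimum of a linear program *)

Section LinearProgram.
Variables (R : realType) (k m : nat) (A : 'M[R]_(k, m)).
Implicit Types (a b c d g : 'rV[R]_k) (y : 'rV[R]_m) (I : {set 'I_k}).

Lemma ratio_test a b : (forall i, 0 <= a 0 i) -> (exists i, b 0 i < 0) ->
  exists t i, [/\ 0 <= t, b 0 i < 0, (a + t *: b) 0 i = 0 &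
    forall i', 0 <= (a + t *: b) 0 i'].
Proof.
move=> a0 [i0 bi0].
case: (@arg_minP _ _ _ i0 (fun i => b 0 i < 0) (fun i => a 0 i / - b 0 i) bi0) => i bi i_min.
have t0 : 0 <= a 0 i / - b 0 i by rewrite divr_ge0// oppr_ge0 ltW.
exists (a 0 i / - b 0 i), i; split=> //.
  by rewrite !mxE; field; rewrite lt_eqF.
move=> i'; rewrite !mxE; have [bi'|bi'] := ltP (b 0 i') 0; last by rewrite addr_ge0// mulr_ge0.
by have := i_min i' bi'; rewrite ler_pdivlMr ?oppr_gt0// mulrN -subr_ge0 opprK addrC.
Qed.

Lemma optimal_direction_le0 c y a g : face (feasible A y) c a -> g *m A = 0 ->
  (forall i, g 0 i < 0 -> 0 < a 0 i) -> dotv g c <= 0.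
Proof.
move=> [[a0 aA] a_max] gA a_pos.
suff [t t0 atg] : exists2 t, 0 < t & forall i, 0 <= (a + t *: g) 0 i.
  have := a_max (a + t *: g); rewrite !dotvD gerDl pmulr_rle0//; apply.
  by split=> //; rewrite mulmxDl -scalemxAl gA scaler0 addr0.
have [neg|nneg] := pselect (exists i, g 0 i < 0).
  have [t [i [t0 gi ai atg]]] := ratio_test a0 neg; exists t => //.
  rewrite lt0r t0 andbT; apply: contraTneq (a_pos i gi) => t_eq0.
  by rewrite -ai t_eq0 scale0r addr0 ltxx.
exists 1 => // i; rewrite scale1r mxE addr_ge0// leNgt.
by apply/negP => gi; apply: nneg; exists i.
Qed.

Definition supported_in I a := forall i, i \notin I -> a 0 i = 0.

Definition carrier a : {set 'I_k} := [set i | a 0 i != 0]%SET.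

Definition independent I := forall b, supported_in I b -> b *m A = 0 -> b = 0.

Lemma supported_in_carrier a : supported_in (carrier a) a.
Proof. by move=> i; rewrite inE negbK => /eqP. Qed.

Lemma supported_in_lincomb I a b (s t : R) :
  supported_in I a -> supported_in I b -> supported_in I (s *: a + t *: b).
Proof. by move=> aI bI i iI; rewrite !mxE aI// bI// !mulr0 addr0. Qed.

Lemma feasible_carrier_gt0 y a b i : feasible A y a -> supported_in (carrier a) b ->
  b 0 i < 0 -> 0 < a 0 i.
Proof.
move=> [a0 _] ba bi; rewrite lt0r a0 andbT; apply: contraTneq bi => ai.
by rewrite ba ?ltxx// inE ai eqxx.
Qed.

Lemma optimal_carrier_decrease c y a b : face (feasible A y) c a ->
  supported_in (carrier a) b -> b *m A = 0 -> b != 0 ->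
  exists2 a', face (feasible A y) c a' & (#|carrier a'| < #|carrier a|)%N.
Proof.
move=> fa; have [[a0 aA] a_max] := fa.
wlog neg : b / exists i, b 0 i < 0 => [neg_case ba bA b0|ba bA b0].
  have [i bi] : exists i, b 0 i != 0 by apply/rV0Pn.
  move: bi; rewrite neq_lt => /orP[bi|bi]; first by apply: (neg_case b) => //; exists i.
  apply: (neg_case (- b)); rewrite ?mulNmx ?bA ?oppr0 ?oppr_eq0//.
    by exists i; rewrite mxE oppr_lt0.
  by move=> i' i'a; rewrite mxE ba ?oppr0.
have flat : dotv b c = 0.
  apply/eqP; rewrite eq_le -oppr_le0 -dotvNl !(optimal_direction_le0 fa)//.
  - by rewrite mulNmx bA oppr0.
  - by move=> i; apply: (feasible_carrier_gt0 fa.1) => i' i'a; rewrite mxE ba ?oppr0.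
  - by move=> i; exact: (feasible_carrier_gt0 fa.1).
have [t [i [t0 bi ai a'0]]] := ratio_test a0 neg; exists (a + t *: b).
  split; first by split=> //; rewrite mulmxDl -scalemxAl bA scaler0 addr0.
  by move=> a' fa'; rewrite !dotvD flat mulr0 addr0; exact: a_max.
apply: proper_card; apply/properP; split.
  apply/fintype.subsetP => i'; rewrite !inE mxE; apply: contraNN => /eqP ai'.
  by rewrite mxE ai' ba ?mulr0 ?addr0// inE ai' eqxx.
exists i; last by rewrite inE ai eqxx.
by rewrite inE gt_eqF// (feasible_carrier_gt0 fa.1 ba).
Qed.

Lemma ex_basic_optimum c y : face (feasible A y) c !=set0 ->
  exists2 a, face (feasible A y) c a & independent (carrier a).
Proof.
move=> [a]; have [N] := ubnP #|carrier a|; elim: N a => // N IH a aN fa.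
have [|/existsNP[b /not_implyP[ba /not_implyP[bA /eqP b0]]]] :=
  pselect (independent (carrier a)); first by exists a.
have [a' fa' lt_a'] := optimal_carrier_decrease fa ba bA b0.
by apply: (IH a' _ fa'); exact: leq_trans lt_a' aN.
Qed.

Definition basic_direction I i g :=
  [/\ independent I, g *m A = 0 & supported_in I (g - delta_mx 0 i)].

Lemma basic_direction_unique I i g g' :
  basic_direction I i g -> basic_direction I i g' -> g = g'.
Proof.
move=> [indep gA gI] [_ g'A g'I]; apply/eqP; rewrite -subr_eq0; apply/eqP/indep.
  have -> : g - g' = 1 *: (g - delta_mx 0 i) + (-1) *: (g' - delta_mx 0 i).
    by rewrite scale1r scaleN1r opprB addrA subrK.
  exact: supported_in_lincomb.
by rewrite mulmxBl gA g'A subrr.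
Qed.

Definition reduced_cost_dominates c d (eps : R) := forall I i g, basic_direction I i g ->
  eps * `|dotv g d| <= `|dotv g c|.

Lemma ex_reduced_cost_dominates c d :
  (forall I i g, basic_direction I i g -> dotv g c = 0 -> dotv g d = 0) ->
  exists2 eps, 0 < eps & reduced_cost_dominates c d eps.
Proof.
move=> cd; have near_basis (t : {set 'I_k} * 'I_k) : \forall eps \near 0^'+,
    forall g, basic_direction t.1 t.2 g -> eps * `|dotv g d| <= `|dotv g c|.
  have [[g gt]|none] := pselect (exists g, basic_direction t.1 t.2 g); last first.
    by apply: filterE => eps g gt; case: none; exists g.
  have [gc|gc] := eqVneq (dotv g c) 0.
    apply: filterE => eps g' g't; rewrite (basic_direction_unique g't gt).
    by rewrite (cd _ _ _ gt gc) normr0 mulr0.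
  have r0 : 0 < `|dotv g c| / (`|dotv g d| + 1) by rewrite divr_gt0 ?normr_gt0// ltr_wpDl.
  near=> eps => g' g't; rewrite (basic_direction_unique g't gt).
  have eps0 : 0 < eps by near: eps; exact: nbhs_right_gt.
  apply: (@le_trans _ _ (eps * (`|dotv g d| + 1))); first by rewrite ler_pM2l// lerDl.
  by rewrite -ler_pdivlMr ?ltr_wpDl//; near: eps; exact: nbhs_right_le.
have near_all : \forall eps \near 0^'+, forall t : {set 'I_k} * 'I_k,
    forall g, basic_direction t.1 t.2 g -> eps * `|dotv g d| <= `|dotv g c|.
  by apply: filter_forall => t; exact: near_basis.
have [eps [eps0 epsP]] := filter_ex (filterI (nbhs_right_gt 0) near_all).
by exists eps => // I i g; exact: (epsP (I, i)).
Unshelve. all: by end_near. Qed.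

Definition mask I : 'M[R]_k := diag_mx (\row_i (i \in I)%:R).

Lemma mask_supported_in I a : supported_in I (a *m mask I).
Proof. by move=> i /negbTE iI; rewrite mul_mx_diag !mxE iI mulr0. Qed.

Lemma supported_in_mask I a : supported_in I a -> a *m mask I = a.
Proof.
move=> aI; apply/rowP => i; rewrite mul_mx_diag !mxE.
by have [_|/aI ->] := boolP (i \in I); rewrite ?mulr1 ?mul0r.
Qed.

Lemma sub_maskP I y : (y <= mask I *m A)%MS <-> exists2 a, supported_in I a & a *m A = y.
Proof.
split=> [/submxP[a ->]|[a aI <-]]; last by rewrite -(supported_in_mask aI) -mulmxA submxMl.
by exists (a *m mask I); rewrite ?mulmxA//; exact: mask_supported_in.
Qed.

Definition nondegenerate y := forall I, (y <= mask I *m A)%MS -> (A <= mask I *m A)%MS.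

(* In the basis expansion L of the rows of A, the directions e_i - L_i are basic. *)
Lemma stable_optimum c d y eps : face (feasible A y) c !=set0 -> nondegenerate y ->
  0 <= eps -> reduced_cost_dominates c d eps ->
  exists a, forall s, `|s| <= eps -> face (feasible A y) (c + s *: d) a.
Proof.
move=> /ex_basic_optimum[a fa indep] ndeg eps0 dom.
have [[a0 aA] a_max] := fa; set I := carrier a in indep.
have aI : supported_in I a by exact: supported_in_carrier.
have /submxP[D AE] : (A <= mask I *m A)%MS by apply: ndeg; apply/sub_maskP; exists a.
pose L := D *m mask I.
have LA : L *m A = A by rewrite -mulmxA.
have LI x : supported_in I (x *m L) by rewrite mulmxA; exact: mask_supported_in.
have basic i : basic_direction I i (row i (1%:M - L)).
  split=> //; first by rewrite -row_mul mulmxBl mul1mx LA subrr row0.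
  move=> i' iI; have := LI (delta_mx 0 i) i' iI.
  by rewrite -rowE linearB /= row1 !mxE => ->; rewrite subr0 subrr.
have reduced_cost_le0 i : dotv (row i (1%:M - L)) c <= 0.
  have [_ gA gI] := basic i; apply: (optimal_direction_le0 fa gA) => i' gi'.
  rewrite lt0r a0 andbT; apply: contraTneq gi' => ai'.
  have := gI i'; rewrite inE ai' eqxx => /(_ isT) /eqP.
  by rewrite mxE [X in _ + X]mxE subr_eq0 => /eqP ->; rewrite -leNgt mxE ler0n.
exists a => s s_eps; split=> // x [x0 xA].
have xLa : x *m L = a.
  apply/eqP; rewrite -subr_eq0; apply/eqP/indep.
    by rewrite -[x *m L]scale1r -scaleN1r; exact: supported_in_lincomb.
  by rewrite mulmxBl -mulmxA LA xA aA subrr.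
rewrite -subr_le0 -dotvBl -[X in X - _]mulmx1 -xLa -mulmxBr mulmx_sum_row dotv_suml.
apply: sumr_le0 => i _; rewrite dotvZl mulr_ge0_le0// dotvDr dotvZr.
have := dom _ _ _ (basic i); rewrite (ler0_norm (reduced_cost_le0 i)).
have : s * dotv (row i (1%:M - L)) d <= eps * `|dotv (row i (1%:M - L)) d|.
  by apply: le_trans (ler_norm _) _; rewrite normrM ler_wpM2r.
lra.
Qed.

End LinearProgram.

Section HullFibers.
Variables (R : realType) (k l n : nat) (V : 'M[R]_(k, n)) (e : 'M[R]_(l, n)).
Local Notation vol := (vol R).
Implicit Types (u v x : 'rV[R]_n) (z : 'rV[R]_l).

Definition fiber_constraints : 'M[R]_(k, 1 + l) := row_mx (const_mx 1) (V *m e^T).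
Local Notation A := fiber_constraints.

Lemma mulmx_fiber_constraints r (a : 'M[R]_(r, k)) :
  a *m A = row_mx (a *m const_mx 1) (a *m V *m e^T).
Proof. by rewrite mul_mx_row mulmxA. Qed.

Lemma fiber_hull z : fiber (hull V) e z = [set a *m V | a in feasible A (row_mx 1%:M z)].
Proof.
apply/seteqP; split=> x.
  by move=> [[a [a0 a1] <-] az]; exists a => //; split=> //; rewrite mulmx_fiber_constraints a1 az.
move=> [a [a0]]; rewrite mulmx_fiber_constraints => /eq_row_mx[a1 az] <-.
by split; [exists a|].
Qed.

Lemma face_fiber_hull z u a :
  face (feasible A (row_mx 1%:M z)) (u *m V^T) a -> face (fiber (hull V) e z) u (a *m V).
Proof.
rewrite fiber_hull => -[fa a_max]; split=> [|_ [b fb <-]]; first by exists a.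
by rewrite !dotv_mulmx; exact: a_max.
Qed.

Lemma face_feasible_nonempty z u : compact (hull V) -> fiber (hull V) e z !=set0 ->
  face (feasible A (row_mx 1%:M z)) (u *m V^T) !=set0.
Proof.
move=> cV V0; have [x] := face_nonempty u (compact_fiber (e := e) (z := z) cV) V0.
rewrite fiber_hull => -[[a fa <-] a_max]; exists a; split=> // b fb.
by rewrite -!dotv_mulmx; apply: a_max; exists b.
Qed.

Lemma ae_affine_notin (M : 'M[R]_(k, 1 + l)) (y : 'rV[R]_l) : ~~ (row_mx 1%:M y <= M)%MS ->
  {ae vol l, forall z, ~~ (row_mx 1%:M z <= M)%MS}.
Proof.
rewrite submxE => /matrix0Pn[i [c]]; rewrite ord1 => {i} yc.
pose w : 'cV[R]_(1 + l) := col c (cokermx M).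
have wE (z : 'rV[R]_l) :
    (row_mx 1%:M z *m cokermx M) 0 c = w (lshift l 0) 0 + dotv z (dsubmx w)^T.
  transitivity ((row_mx 1%:M z *m w) 0 0).
    by rewrite [LHS]mxE [RHS]mxE; apply: eq_bigr => i _; rewrite [w _ _]mxE.
  by rewrite -[w in LHS]vsubmxK mul_row_col mul1mx mxE /dotv trmxK [usubmx _ _ _]mxE.
have notinP (z : 'rV[R]_l) : w (lshift l 0) 0 + dotv z (dsubmx w)^T != 0 ->
    ~~ (row_mx 1%:M z <= M)%MS.
  by rewrite -wE submxE; apply: contra => /eqP ->; rewrite mxE.
rewrite wE in yc; set d := (dsubmx w)^T in notinP yc.
have [d0|d0] := eqVneq d 0.
  by apply: filterE => z; apply: notinP; move: yc; rewrite d0 !dotv0r.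
pose q := - (w (lshift l 0) 0 / dotv d d) *: d.
exists [set z | dotv (z - q) d = 0]; split; last 1 first.
- move=> z /=; apply: contra_notP => /eqP zq; apply: notinP; move: zq.
  by rewrite dotvBl /q dotvZl mulNr opprK divfK ?dotv_eq0// addrC.
- by apply: closed_measurable_mx; exact: closed_hyperplane.
- exact: vol_hyperplane0.
Qed.

Lemma ae_nondegenerate : {ae vol l, forall z, nondegenerate A (row_mx 1%:M z)}.
Proof.
have ae_mask (I : {set 'I_k}) : {ae vol l, forall z,
    (row_mx 1%:M z <= mask R I *m A)%MS -> (A <= mask R I *m A)%MS}.
  have [sub|/row_subPn[i]] := boolP (A <= mask R I *m A)%MS; first by apply: filterE.
  rewrite (_ : row i A = row_mx 1%:M (row i V *m e^T)).
    move=> /ae_affine_notin; apply: filterS => z /negP notin /notin [].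
  rewrite row_row_mx -row_mul; congr row_mx.
  by apply/matrixP => ? ?; rewrite !ord1 !mxE eqxx.
have : {ae vol l, forall z, forall I, (row_mx 1%:M z <= mask R I *m A)%MS ->
    (A <= mask R I *m A)%MS}.
  by apply: filter_forall => I; exact: ae_mask.
exact.
Qed.

Lemma ae_width_second_diff_hull u v eps : compact (hull V) -> 0 <= eps ->
  reduced_cost_dominates A (u *m V^T) (v *m V^T) eps ->
  {ae vol l, forall z, width_second_diff (fiber (hull V) e z) u (eps *: v) = 0}.
Proof.
move=> cV eps0 dom; apply: filterS ae_nondegenerate => z ndeg.
have [->|/set0P F0] := eqVneq (fiber (hull V) e z) set0; first exact: width_second_diff_set0.
have domN : reduced_cost_dominates A (- u *m V^T) (v *m V^T) eps.
  by move=> I i g /dom; rewrite mulNmx dotvNr normrN.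
have [a a_opt] := stable_optimum (face_feasible_nonempty u cV F0) ndeg eps0 dom.
have [b b_opt] := stable_optimum (face_feasible_nonempty (- u) cV F0) ndeg eps0 domN.
have opt w (c : 'rV[R]_k) : (forall s, `|s| <= eps -> face (feasible A (row_mx 1%:M z))
    (w *m V^T + s *: (v *m V^T)) c) -> forall s, `|s| <= eps ->
    support_fun (fiber (hull V) e z) (w + s *: v) = dotv (c *m V) (w + s *: v).
  move=> c_opt s /c_opt; rewrite scalemxAl -mulmxDl => /face_fiber_hull.
  exact: support_fun_face.
have n0 : `|0 : R| <= eps by rewrite normr0.
have n1 : `|eps| <= eps by rewrite ger0_norm.
have n2 : `|- eps| <= eps by rewrite normrN ger0_norm.
have := (opt _ _ a_opt _ n0, opt _ _ a_opt _ n1, opt _ _ a_opt _ n2,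
  opt _ _ b_opt _ n0, opt _ _ b_opt _ n1, opt _ _ b_opt _ n2).
rewrite !scale0r !addr0 !scaleNr => -[[[[[a1 a2] a3] b1] b2] b3].
rewrite /width_second_diff /width !opprD !opprK a1 a2 a3 b1 b2 b3 !dotvD.
ring.
Qed.

Lemma shadow_second_diff_hull u v eps : compact (hull V) -> 0 <= eps ->
  reduced_cost_dominates A (u *m V^T) (v *m V^T) eps ->
  shadow_second_diff (hull V) e u (eps *: v) = 0.
Proof.
move=> cV eps0 dom; have vV := convex_hull (V := V).
apply/eqP; rewrite -(inj_eq (@EFin_inj R)) -integral_width_second_diff//.
rewrite -[eqbRHS](integral0 (vol l) setT); apply/eqP; apply: ge0_ae_eq_integral => //.
- by apply/measurable_EFinP; exact: measurable_width_second_diff.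
- by move=> z _; rewrite lee_fin width_second_diff_ge0//; exact: compact_fiber.
by apply: filterS (ae_width_second_diff_hull cV eps0 dom) => z -> _.
Qed.

End HullFibers.

Section RotationCriterion.
Variables (R : realType) (k l q n : nat) (V : 'M[R]_(k, n)).
Implicit Types (u v x y : 'rV[R]_n) (I : {set 'I_k}).

Definition affine_directions I : 'M[R]_(k, n) :=
  kermx (mask R I *m const_mx 1 : 'cV_k) *m mask R I *m V.

Lemma sub_affine_directionsP I (B : 'M[R]_n) y : (y <= affine_directions I *m B)%MS <->
  exists a, [/\ supported_in I a, a *m (const_mx 1 : 'cV_k) = 0 & a *m V *m B = y].
Proof.
split=> [/submxP[D ->]|[a [aI a0 <-]]].
  exists (D *m kermx (mask R I *m const_mx 1 : 'cV_k) *m mask R I).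
  split; first exact: mask_supported_in.
    by rewrite -[_ *m mask R I *m _]mulmxA -[D *m _ *m _]mulmxA mulmx_ker mulmx0.
  by rewrite !mulmxA.
rewrite -(supported_in_mask aI) /affine_directions; apply/submxMr/submxMr/submxMr.
by apply/sub_kermxP; rewrite mulmxA supported_in_mask.
Qed.

(* The orthogonal projection onto the complement of the rows of e, when these are
   orthonormal. *)
Definition coprojector (e : 'M[R]_(q, n)) : 'M[R]_n := 1%:M - e^T *m e.

Lemma coprojector_orth e x : orthonormal e -> x *m coprojector e *m e^T = 0.
Proof. by move=> ee; rewrite -mulmxA mulmxBl mul1mx -mulmxA ee mulmx1 subrr mulmx0. Qed.

Lemma coprojectorE (e1 : 'M[R]_(q, n)) (e2 : 'M[R]_(l, n)) u v :
  n = (1 + q + (1 + l))%N -> frame (col_mx u e1) (col_mx v e2) ->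
  coprojector e1 = u^T *m u + v^T *m v + e2^T *m e2.
Proof.
move=> nE fr; rewrite /coprojector -(frame_resolution nE fr) !tr_col_mx !mul_row_col.
by apply/eqP; rewrite subr_eq addrACA [e1^T *m e1 + _]addrC addrA.
Qed.

Lemma rotation_dominates (e1 : 'M[R]_(q, n)) (e2 : 'M[R]_(l, n)) u v :
  n = (1 + q + (1 + l))%N -> frame (col_mx u e1) (col_mx v e2) ->
  (forall I, (v <= affine_directions I *m coprojector e1)%MS ->
    (u <= affine_directions I *m coprojector e1)%MS) ->
  exists2 eps, 0 < eps &
    reduced_cost_dominates (fiber_constraints V e2) (u *m V^T) (v *m V^T) eps.
Proof.
move=> nE fr v_u; apply: ex_reduced_cost_dominates => I i g [indep].
rewrite mulmx_fiber_constraints -row_mx0 => /eq_row_mx[g1 ge] gI; rewrite -!dotv_mulmx.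
set d := g *m V in ge * => du.
have [[uu _ _] _ [uv ue2 _ e12]] := (frame_col_mxP _ _ _ _).1 fr.
have [/eqP //|dv] := boolP (dotv d v == 0).
have d_proj : d *m coprojector e1 = dotv d v *: v.
  rewrite (coprojectorE nE fr) !mulmxDr !mulmxA ge mul0mx addr0 !mul_trmx_dotv du.
  by rewrite !mul_scalar_mx scale0r add0r.
have iI : i \notin I.
  apply: contraNN dv => iI; rewrite /d (indep g) ?mul0mx ?dotv0l//.
    move=> i' i'I; have /negbTE ii' : i' != i by apply: contraNneq i'I => ->.
    by have := gI i' i'I; rewrite !mxE ii' andbF subr0.
  by rewrite mulmx_fiber_constraints g1 ge row_mx0.
have g_i : g 0 i = 1.
  by have := gI i iI; rewrite !mxE !eqxx => /eqP; rewrite subr_eq0 => /eqP.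
have g_supp : supported_in (i |: I) g.
  move=> i'; rewrite !inE negb_or => /andP[/negbTE ii' /gI].
  by rewrite !mxE ii' andbF subr0.
have /sub_affine_directionsP[b [b_supp b1 bu]] :
    (u <= affine_directions (i |: I) *m coprojector e1)%MS.
  apply/v_u/sub_affine_directionsP; exists ((dotv d v)^-1 *: g); split.
  - by move=> i' /g_supp gi'; rewrite mxE gi' mulr0.
  - by rewrite -scalemxAl g1 scaler0.
  - by rewrite -!scalemxAl d_proj scalerA mulVf// scale1r.
have be : b *m V *m e2^T = 0.
  by rewrite -[RHS]ue2 -bu mulmxBr mulmx1 mulmxBl mulmxA -[_ *m e1 *m _]mulmxA e12 mulmx0 subr0.
have bE : b = b 0 i *: g.
  apply/eqP; rewrite -subr_eq0; apply/eqP/indep => [i' i'I|].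
    have [->|ii'] := eqVneq i' i; first by rewrite !mxE g_i mulr1 subrr.
    have i'iI : i' \notin i |: I by rewrite !inE negb_or ii'.
    by rewrite !mxE (b_supp i')// (g_supp i')// mulr0 subrr.
  by rewrite mulmxBl -scalemxAl !mulmx_fiber_constraints b1 g1 be ge row_mx0 scaler0 subrr.
have := enorm_dotv1 ((orthonormal_rV u).1 uu); rewrite -{1}bu bE -!scalemxAl -/d d_proj.
rewrite !dotvZl [dotv v u]dotvC (mulmx_tr_dotv0 uv) !mulr0 => /eqP.
by rewrite eq_sym oner_eq0.
Qed.

End RotationCriterion.

(** * Regular normals *)

Section RegularNormals.
Variable R : realType.
Local Notation vol := (vol R).

(* The outer normals at the points of the boundary touched by a ball contained in Q. *)
Definition regular_normal n (Q : set 'rV[R]_n) : set 'rV[R]_n :=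
  [set nu | enorm nu = 1 /\ exists c rho, [/\ 0 < rho, forall b, enorm b <= rho -> Q (c + b) &
    forall x, Q x -> dotv x nu <= dotv c nu + rho]].

Section FibersNearRegularPoints.
Variables (n q : nat) (Q : set 'rV[R]_n) (e : 'M[R]_(q, n)).
Hypotheses (cQ : compact Q) (ee : orthonormal e).
Implicit Types (c d u v nu : 'rV[R]_n) (z t : 'rV[R]_q) (rho : R).

Lemma fiber_ball c d rho z : (forall b, enorm b <= rho -> Q (c + b)) ->
  enorm d = 1 -> d *m e^T = 0 -> enorm (z - c *m e^T) <= rho ->
  fiber Q e z (c + ((z - c *m e^T) *m e + Num.sqrt (rho ^+ 2 - enorm (z - c *m e^T) ^+ 2) *: d)).
Proof.
set w := z - _; set r := Num.sqrt _ => Qb d1 de w_rho; split; last first.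
  by rewrite 2!mulmxDl -mulmxA ee mulmx1 -scalemxAl de scaler0 addr0 addrC subrK.
have rho0 : 0 <= rho by exact: le_trans (enorm_ge0 w) w_rho.
have r2 : r ^+ 2 = rho ^+ 2 - enorm w ^+ 2.
  by rewrite sqr_sqrtr// subr_ge0 ler_pXn2r ?nnegrE ?enorm_ge0.
apply: Qb; rewrite -(@ler_pXn2r _ 2) ?nnegrE ?enorm_ge0// enorm_sq !dotvD.
have -> : dotv d (w *m e) = 0 by rewrite dotv_mulmxr de dotv0l.
have -> : dotv (w *m e) d = 0 by rewrite dotv_mulmx de dotv0r.
by rewrite dotv_orthonormal// (enorm_dotv1 d1) -enorm_sq; lra.
Qed.

Lemma support_fun_fiber_ball_ge c d rho z : (forall b, enorm b <= rho -> Q (c + b)) ->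
  d != 0 -> d *m e^T = 0 -> enorm (z - c *m e^T) <= rho ->
  dotv c d + Num.sqrt (rho ^+ 2 - enorm (z - c *m e^T) ^+ 2) * enorm d
    <= support_fun (fiber Q e z) d.
Proof.
move=> Qb d0 de z_rho; have d1 := enorm_normalize d0.
have d1e : normalize d *m e^T = 0 by rewrite -scalemxAl de scaler0.
have := support_fun_ge d (compact_fiber (e := e) (z := z) cQ) (fiber_ball Qb d1 d1e z_rho).
have -> : enorm d = dotv (normalize d) d.
  by rewrite -{3}[d]normalizeK dotvZr (enorm_dotv1 d1) mulr1.
by rewrite !dotvDl [dotv (_ *m e) d]dotv_mulmx de dotv0r add0r dotvZl.
Qed.

Lemma support_fun_fiber_le v nu t z (s h : R) : (forall x, Q x -> dotv x nu <= h) ->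
  nu = s *: v + t *m e -> fiber Q e z !=set0 ->
  s * support_fun (fiber Q e z) v <= h - dotv z t.
Proof.
move=> Qh nuE F0; have [x [Qx <-] ->] := support_fun_attained v (compact_fiber cQ) F0.
by have := Qh x Qx; rewrite nuE dotvDr dotvZr dotv_mulmxr; lra.
Qed.

Lemma enorm_orthD u v : dotv u v = 0 -> enorm (v + u) = Num.sqrt (dotv v v + dotv u u).
Proof. by move=> uv; rewrite /enorm !dotvD [dotv v u]dotvC uv addr0 add0r. Qed.

(* Half of the second difference that a touching ball of radius rho guarantees on the
   fiber at offset w from its center. *)
Definition ball_gain t (s rho N : R) (w : 'rV[R]_q) : R :=
  s * (Num.sqrt (rho ^+ 2 - enorm w ^+ 2) * N) - (rho - dotv w t).

Lemma continuous_ball_gain t (s rho N : R) : continuous (ball_gain t s rho N).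
Proof.
have c_enorm : continuous (fun w : 'rV[R]_q => enorm w).
  by apply: continuous_enorm; exact: continuous_id.
have c_sqrt : continuous (fun w : 'rV[R]_q => Num.sqrt (rho ^+ 2 - enorm w ^+ 2)).
  have c_arg : continuous (fun w : 'rV[R]_q => rho ^+ 2 - enorm w ^+ 2).
    apply: (@continuous_sub R _ R^o); first exact: cst_continuous.
    exact: (@continuous_scale R _ R^o _ _ c_enorm c_enorm).
  by move=> w; apply: continuous_comp; [exact: c_arg|exact: sqrt_continuous].
apply: (@continuous_sub R _ R^o).
  apply: (@continuous_scale R _ R^o); first exact: cst_continuous.
  by apply: (@continuous_scale R _ R^o); [exact: c_sqrt|exact: cst_continuous].
by apply: (@continuous_sub R _ R^o); [exact: cst_continuous|exact: continuous_dotvl].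
Qed.

Lemma ball_gain_gt0 t (s rho N : R) : s ^+ 2 + dotv t t = 1 -> 0 < s -> 0 < rho -> 1 < N ->
  0 < ball_gain t s rho N (rho *: t).
Proof.
move=> st s0 rho0 N1; rewrite /ball_gain enormZ gtr0_norm// exprMn enorm_sq.
have -> : rho ^+ 2 - rho ^+ 2 * dotv t t = (rho * s) ^+ 2.
  by rewrite exprMn -[s ^+ 2](addrK (dotv t t)) st; ring.
rewrite sqrtr_sqr ger0_norm ?dotvZl; last by rewrite mulr_ge0// ltW.
have : 0 < rho * s ^+ 2 * (N - 1) by rewrite !mulr_gt0 ?exprn_gt0// subr_gt0.
have : rho * (s ^+ 2 + dotv t t) = rho by rewrite st mulr1.
by lra.
Qed.

Lemma width_second_diff_fiber_ge u v nu t c (s rho : R) z :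
  (forall b, enorm b <= rho -> Q (c + b)) -> (forall x, Q x -> dotv x nu <= dotv c nu + rho) ->
  enorm v = 1 -> dotv u v = 0 -> u *m e^T = 0 -> v *m e^T = 0 -> nu = s *: v + t *m e ->
  0 < s -> enorm (z - c *m e^T) <= rho ->
  2 * ball_gain t s rho (enorm (v + u)) (z - c *m e^T)
    <= s * width_second_diff (fiber Q e z) v u.
Proof.
move=> Qb Qnu v1 uv ue ve nuE s0 z_rho; rewrite /ball_gain; set r := Num.sqrt _.
have cF := compact_fiber (e := e) (z := z) cQ.
have F0 : fiber Q e z !=set0 by eexists; exact: fiber_ball Qb v1 ve z_rho.
have enorm_minus : enorm (v - u) = enorm (v + u).
  by rewrite !enorm_orthD ?dotvNl ?uv ?oppr0// dotvNr opprK.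
have ge_dir d : enorm d = enorm (v + u) -> d *m e^T = 0 ->
    dotv c d + r * enorm (v + u) <= support_fun (fiber Q e z) d.
  move=> dE de; rewrite -dE; apply: support_fun_fiber_ball_ge => //.
  rewrite -enorm_gt0 dE enorm_orthD// (enorm_dotv1 v1) sqrtr_gt0.
  by rewrite ltr_pwDl// dotv_ge0.
have ge_plus := ge_dir _ erefl; rewrite mulmxDl ve ue addr0 dotvDr in ge_plus.
have ge_minus := ge_dir _ enorm_minus; rewrite mulmxBl ve ue subr0 dotvBr in ge_minus.
have := lerD (ge_plus erefl) (ge_minus erefl); rewrite -(ler_pM2l s0) => ge_sum.
have := support_fun_fiber_le Qnu nuE F0; rewrite {1}nuE !dotvD dotv_mulmxr => le_v.
have := support_fun_midpoint (- v) u cF; rewrite -(ler_pM2l s0) => mid.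
by rewrite /width_second_diff /width !opprD !opprK; lra.
Qed.

(* The ball touching Q at the point with normal nu bends away from the supporting
   hyperplane, and this persists on the fibers close to that point. *)
Lemma near_width_second_diff_gt0 u v nu t (s : R) : enorm v = 1 -> u != 0 ->
  dotv u v = 0 -> u *m e^T = 0 -> v *m e^T = 0 -> nu = s *: v + t *m e -> 0 < s ->
  regular_normal Q nu ->
  exists z0, \forall z \near z0, 0 < width_second_diff (fiber Q e z) v u.
Proof.
move=> v1 u0 uv ue ve nuE s0 [nu1 [c [rho [rho0 Qb Qnu]]]].
have st : s ^+ 2 + dotv t t = 1.
  rewrite -(enorm_dotv1 nu1) nuE !dotvD (enorm_dotv1 v1) dotv_orthonormal// dotv_mulmxr.
  by rewrite ve dotv0l dotv_mulmx ve dotv0r; ring.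
have t1 : enorm t < 1 by rewrite -[ltRHS]sqrtr1 /enorm ltr_sqrt// -st ltrDr exprn_gt0.
have N1 : 1 < enorm (v + u).
  rewrite enorm_orthD// (enorm_dotv1 v1) -[ltLHS]sqrtr1 ltr_sqrt ?ltrDl ?dotv_gt0//.
  by rewrite ltr_wpDr// dotv_ge0.
have c_w : continuous (fun z => z - c *m e^T).
  by apply: continuous_sub; [exact: continuous_id|exact: cst_continuous].
pose z0 := c *m e^T + rho *: t; have wz0 : z0 - c *m e^T = rho *: t by rewrite addrC addKr.
have near_gain : \forall z \near z0, 0 < ball_gain t s rho (enorm (v + u)) (z - c *m e^T).
  have c_gain : continuous (fun z => ball_gain t s rho (enorm (v + u)) (z - c *m e^T)).
    by move=> z; exact: (continuous_comp (c_w z) (@continuous_ball_gain t s rho _ _)).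
  by apply: (c_gain z0 _ (lt_nbhsr _)); rewrite wz0 ball_gain_gt0.
have near_rho : \forall z \near z0, enorm (z - c *m e^T) < rho.
  apply: (continuous_enorm c_w (x := z0) (lt_nbhsl _)).
  by rewrite wz0 enormZ gtr0_norm// gtr_pMr.
exists z0; near=> z; rewrite -(pmulr_rgt0 _ s0).
apply: lt_le_trans (width_second_diff_fiber_ge Qb Qnu v1 uv ue ve nuE s0 _).
  by rewrite mulr_gt0//; near: z; exact: near_gain.
by rewrite ltW//; near: z; exact: near_rho.
Unshelve. all: by end_near. Qed.

Lemma shadow_second_diff_regular_neq0 u v nu t (s : R) : convex_set Q -> enorm v = 1 ->
  u != 0 -> dotv u v = 0 -> u *m e^T = 0 -> v *m e^T = 0 -> nu = s *: v + t *m e -> 0 < s ->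
  regular_normal Q nu -> shadow_second_diff Q e v u != 0.
Proof.
move=> vQ v1 u0 uv ue ve nuE s0 rnu; apply/eqP => diff0.
have [z0 near_z0] := near_width_second_diff_gt0 v1 u0 uv ue ve nuE s0 rnu.
have int0 : (\int[vol q]_z `|(width_second_diff (fiber Q e z) v u)%:E| = 0)%E.
  rewrite -[RHS](congr1 EFin diff0) -integral_width_second_diff//.
  apply: eq_integral => z _; rewrite gee0_abs// lee_fin width_second_diff_ge0//.
  exact: compact_fiber.
have mdiff : measurable_fun setT (fun z => (width_second_diff (fiber Q e z) v u)%:E).
  by apply/measurable_EFinP; exact: measurable_width_second_diff.
have ae0 := (ae_eq_integral_abs (vol q) measurableT mdiff).1 int0.
have [z z_gt0 z_eq0] := ae_exists_nbhs ae0 near_z0.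
by move: z_gt0 => /=; rewrite -lte_fin (z_eq0 I) ltxx.
Qed.

End FibersNearRegularPoints.

Section Rotations.
Variables (k l q n : nat) (V : 'M[R]_(k, n)) (Q : set 'rV[R]_n).
Hypotheses (cV : compact (hull V)) (cQ : compact Q) (vQ : convex_set Q).
Hypotheses (PQ : complementary_shadows q.+1 l.+1 (hull V) Q) (nE : n = (q + (2 + l))%N).
Implicit Types (u v nu : 'rV[R]_n).

(* Otherwise rotating u towards v would, for small angles, leave the optimal solutions of
   the linear programs over the fibers of the polytope unchanged. *)
Lemma ex_rotation_obstruction (e : 'M[R]_(q, n)) u v nu (s : R) :
  frame (col_mx u v) e -> regular_normal Q nu -> nu *m coprojector e = s *: v -> 0 < s ->
  exists2 I, (v <= affine_directions V I *m coprojector e)%MS &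
    ~~ (u <= affine_directions V I *m coprojector e)%MS.
Proof.
move=> fr rnu nuE s0; apply: contrapT => none.
have v_u I : (v <= affine_directions V I *m coprojector e)%MS ->
    (u <= affine_directions V I *m coprojector e)%MS.
  by move=> vI; apply: contrapT => /negP uI; apply: none; exists I.
have nE' : n = (1 + 1 + q + l)%N by rewrite nE; lia.
have [e2 /frame_col_mxl[_ /frame_col_mxl[_ ue2 ve2] ee2]] := ex_frame nE' (frame_col_mx fr).
have /frame_col_mxl[uv ue ve] := fr.
have fr2 : frame (col_mx u e) (col_mx v e2).
  by apply/frame_col_mxl; split=> //; apply/frameC/frame_col_mxl; split=> //;
    rewrite ?frameC//; exact: frameC.
have [/orthonormal_rV u1 /orthonormal_rV v1 /mulmx_tr_dotv0 uv0] := uv.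
have [_ oe ue0] := ue; have [_ _ ve0] := ve.
have nE2 : n = (1 + q + (1 + l))%N by rewrite nE; lia.
have [eps eps0 dom] := rotation_dominates nE2 fr2 v_u.
have vV := convex_hull (V := V).
have := shadow_second_diff_hull cV (ltW eps0) dom.
rewrite (shadow_second_diff_rotate eps cV vV cQ vQ PQ fr2); apply/eqP.
have nu_split : nu = s *: v + nu *m e^T *m e by rewrite -nuE mulmxBr mulmx1 mulmxA subrK.
apply: (shadow_second_diff_regular_neq0 cQ oe vQ v1 _ _ _ ve0 nu_split s0 rnu).
- by rewrite scaler_eq0 negb_or gt_eqF// -enorm_gt0 u1 ltr01.
- by rewrite dotvZl uv0 mulr0.
- by rewrite -scalemxAl ue0 scaler0.
Qed.

Lemma coprojector_parallel (e : 'M[R]_(q, n)) nu nu' : orthonormal e -> regular_normal Q nu ->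
  nu *m coprojector e != 0 ->
  (forall I, (nu *m coprojector e <= affine_directions V I *m coprojector e)%MS ->
    (nu' *m coprojector e <= affine_directions V I *m coprojector e)%MS) ->
  exists a, nu' *m coprojector e = a *: (nu *m coprojector e).
Proof.
move=> oe rnu; set x := nu *m _ => x0; set x' := nu' *m _ => x_x'.
pose v := normalize x; pose y := x' - dotv x' v *: v.
have xE : x = enorm x *: v by rewrite normalizeK.
have [y_eq0|y0] := eqVneq y 0.
  exists (dotv x' v / enorm x); rewrite -scalerA -/(normalize x) -/v.
  by apply/eqP; rewrite -subr_eq0 -/y y_eq0.
have xe : x *m e^T = 0 by exact: coprojector_orth.
have x'e : x' *m e^T = 0 by exact: coprojector_orth.
have ve : v *m e^T = 0 by rewrite -scalemxAl xe scaler0.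
have ye : y *m e^T = 0 by rewrite mulmxBl x'e -scalemxAl ve scaler0 subr0.
have v1 : enorm v = 1 by exact: enorm_normalize.
have yv : dotv y v = 0 by rewrite dotvBl dotvZl (enorm_dotv1 v1) mulr1 subrr.
have fr : frame (col_mx (normalize y) v) e.
  apply/frame_col_mxl; split; split=> //; try by apply/orthonormal_rV; rewrite ?enorm_normalize.
    by rewrite mul_trmx_dotv dotvZl yv mulr0 raddf0.
  by rewrite -scalemxAl ye scaler0.
have x_gt0 : 0 < enorm x by rewrite enorm_gt0.
have [I vI /negP[]] := ex_rotation_obstruction fr rnu xE x_gt0.
apply/scalemx_sub/addmx_sub; first by apply: x_x'; rewrite xE scalemx_sub.
by rewrite -scaleNr scalemx_sub.
Qed.

Lemma ex_orthonormal_orthogonal r (A : 'M[R]_(r, n)) : (r + q <= n)%N ->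
  exists2 e : 'M[R]_(q, n), orthonormal e & A *m e^T = 0.
Proof.
move=> rq; have rank_ker : (q <= \rank (kermx A^T))%N.
  by rewrite mxrank_ker mxrank_tr; have := rank_leq_row A; lia.
have [W WW WA] := ex_orthonormal_basis (esym (subnKC rank_ker)).
exists (usubmx W).
  apply/matrixP => i i'; have /matrixP/(_ (lshift _ i) (lshift _ i')) := WW.
  by rewrite !mxE (inj_eq (@lshift_inj _ _)) => <-; apply: eq_bigr => l' _; rewrite !mxE.
apply: mulmx_tr_eq0C; have /eqmxP WA' := WA.
have /sub_kermxP : (W <= kermx A^T)%MS by rewrite WA'.
by rewrite -[W in LHS]vsubmxK mul_col_mx -[RHS]col_mx0 => /eq_col_mx[].
Qed.

Lemma coprojector_coord (e : 'M[R]_(q, n)) nu i : (delta_mx 0 i : 'rV[R]_n) *m e^T = 0 ->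
  (nu *m coprojector e) 0 i = nu 0 i.
Proof.
move=> ie; rewrite -[LHS]dotv_delta mulmxBr mulmx1 mulmxA dotvBl [dotv (_ *m e) _]dotv_mulmx.
by rewrite ie dotv0r subr0 dotv_delta.
Qed.

Lemma ex_orthonormal_coord_orthogonal (i b : 'I_n) : exists e : 'M[R]_(q, n),
  [/\ orthonormal e, (delta_mx 0 i : 'rV[R]_n) *m e^T = 0 & (delta_mx 0 b : 'rV[R]_n) *m e^T = 0].
Proof.
pose A : 'M[R]_(1 + 1, n) := col_mx (delta_mx 0 i) (delta_mx 0 b).
have qn : (1 + 1 + q <= n)%N by rewrite nE; lia.
have [e oe] := ex_orthonormal_orthogonal A qn.
by rewrite /A mul_col_mx -[RHS]col_mx0 => /eq_col_mx[]; exists e.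
Qed.

Lemma regular_normal_parallel_eq nu nu' : regular_normal Q nu -> regular_normal Q nu' ->
  (forall i b, nu 0 i * nu' 0 b = nu 0 b * nu' 0 i) ->
  (forall i, (0 < nu 0 i) = (0 < nu' 0 i)) -> nu = nu'.
Proof.
move=> [nu1 _] [nu'1 _] minors signs.
have [i nui] : exists i, nu 0 i != 0.
  by apply/rV0Pn; rewrite -enorm_gt0 nu1.
pose a := nu' 0 i / nu 0 i.
have nu'E : nu' = a *: nu.
  by apply/rowP => b; rewrite mxE /a mulrAC [nu' 0 i * _]mulrC -minors mulrC mulKf.
have a0 : 0 <= a.
  move: nui; rewrite /a neq_lt => /orP[ng|ps].
    by rewrite -mulrNN -invrN divr_ge0 ?oppr_ge0 ?(ltW ng)// leNgt -signs -leNgt ltW.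
  by rewrite divr_ge0 ?(ltW ps)// ltW// -signs.
by move: nu'1; rewrite nu'E enormZ nu1 mulr1 ger0_norm// => ->; rewrite scale1r.
Qed.

(* A regular normal is determined by its signs and by the positions of its projections on
   the coordinate planes with respect to the finitely many subspaces of directions. *)
Lemma finite_regular_normal : finite_set (regular_normal Q).
Proof.
have /choice[e eP] (ib : 'I_n * 'I_n) := ex_orthonormal_coord_orthogonal ib.1 ib.2.
pose spans ib nu := [set I | (nu *m coprojector (e ib) <=
  affine_directions V I *m coprojector (e ib))%MS]%SET.
pose key nu := ([ffun ib => spans ib nu], [ffun i => 0 < nu 0 i]).
suff key_inj : {in regular_normal Q &, injective key}.
  by rewrite -(eq_finite_set (inj_card_eq key_inj)); exact: finite_finset.
move=> nu nu' /set_mem rnu /set_mem rnu' [/ffunP spans_eq /ffunP signs_eq].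
apply: regular_normal_parallel_eq => // [i b|i]; last by have := signs_eq i; rewrite !ffunE.
have [oe ei eb] := eP (i, b).
rewrite -(coprojector_coord nu ei) -(coprojector_coord nu' ei).
rewrite -(coprojector_coord nu eb) -(coprojector_coord nu' eb).
have [->|nu0] := eqVneq (nu *m coprojector (e (i, b))) 0; first by rewrite !mxE !mul0r.
have [I|a ->] := coprojector_parallel (nu' := nu') oe rnu nu0.
  by have /setP/(_ I) := spans_eq (i, b); rewrite !ffunE !inE => ->.
by rewrite !mxE; ring.
Qed.

End Rotations.
End RegularNormals.

(** * Bodies with finitely many regular normals *)

Section InnerDepth.
Variables (R : realType) (n : nat) (Q : set 'rV[R]_n).
Hypotheses (cQ : compact Q) (vQ : convex_set Q) (Q0 : Q !=set0).
Implicit Types (x y nu b : 'rV[R]_n).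

Definition depth x : R := inf [set support_fun Q nu - dotv x nu | nu in @sphere R n].

Lemma compact_sphere : compact (@sphere R n).
Proof.
have -> : @sphere R n = [set nu | enorm nu = 1] by [].
apply: (closed_sub_compact (@compact_eball R n 1)); last first.
  by move=> nu nu1; rewrite /eball /= nu1.
apply: closed_eq_fun; last exact: cst_continuous.
by apply: continuous_enorm; exact: continuous_id.
Qed.

Section NonemptySphere.
Hypothesis S0 : @sphere R n !=set0.

Lemma depth_attained x : exists2 nu, enorm nu = 1 & depth x = support_fun Q nu - dotv x nu.
Proof.
have c_gap : continuous (fun nu => dotv x nu - support_fun Q nu).
  have c_dot : continuous (fun nu => dotv x nu).
    by apply: continuous_dotv; [exact: cst_continuous|exact: continuous_id].
  exact: (@continuous_sub R _ R^o _ _ c_dot (continuous_support_fun cQ Q0)).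
have [nu nu1 nu_max] := compact_argmax compact_sphere S0 c_gap; exists nu => //.
apply/eqP; rewrite eq_le; apply/andP; split.
  apply: ge_inf; last by exists nu.
  by exists (support_fun Q nu - dotv x nu) => _ [mu mu1 <-]; have := nu_max mu mu1; lra.
apply: lb_le_inf; first by exists (support_fun Q nu - dotv x nu); exists nu.
by move=> _ [mu mu1 <-]; have := nu_max mu mu1; lra.
Qed.

Lemma depth_le x nu : enorm nu = 1 -> depth x <= support_fun Q nu - dotv x nu.
Proof.
move=> nu1; have [B B0 QB] := compact_enorm_le cQ.
apply: ge_inf; last by exists nu.
exists (- B - enorm x) => _ [mu mu1 <-]; have [y Qy ->] := support_fun_attained mu cQ Q0.
have := dotv_le_unit x mu1; have := dotv_le_unit (- y) mu1; rewrite dotvNl enormN.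
by have := QB y Qy; lra.
Qed.

Lemma depth_lipschitz x y : `|depth x - depth y| <= enorm (x - y).
Proof.
suff depth_le_add a b : depth a <= depth b + enorm (a - b).
  rewrite ler_norml; have := depth_le_add x y; have := depth_le_add y x.
  by rewrite -[enorm (y - x)]enormN opprB; lra.
have [nu nu1 ->] := depth_attained b; have := depth_le a nu1.
by have := dotv_le_unit (b - a) nu1; rewrite dotvBl -[enorm (b - a)]enormN opprB; lra.
Qed.

Lemma continuous_depth : continuous depth.
Proof.
by apply: (lipschitz_enorm_continuous ltr01) => x y; rewrite mul1r; exact: depth_lipschitz.
Qed.

Lemma depth_eball x b : enorm b <= depth x -> Q (x + b).
Proof.
move=> bx; apply: contrapT => nQ; have [nu nu1 sep] := separation cQ vQ Q0 nQ.
have := depth_le x nu1; have := dotv_le_unit b nu1.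
by move: sep; rewrite dotvDl; lra.
Qed.

Lemma depth_lt0 y : ~ Q y -> depth y < 0.
Proof.
move=> nQy; have [nu nu1 sep] := separation cQ vQ Q0 nQy.
by apply: le_lt_trans (depth_le y nu1) _; rewrite subr_lt0.
Qed.

Lemma regular_normal_depth x : 0 < depth x ->
  exists2 nu, regular_normal Q nu & depth x = support_fun Q nu - dotv x nu.
Proof.
move=> x0; have [nu nu1 xE] := depth_attained x; exists nu => //.
split=> //; exists x, (depth x); split=> // [b|z Qz]; first exact: depth_eball.
by rewrite xE addrC subrK; exact: support_fun_ge.
Qed.

Lemma support_fun_eball_ge r nu : eball r `<=` Q -> 0 <= r -> enorm nu = 1 ->
  r <= support_fun Q nu.
Proof.
move=> Qr r0 nu1; have : Q (r *: nu) by apply: Qr; rewrite /eball /= enormZ nu1 mulr1 ger0_norm.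
by move=> /(support_fun_ge nu cQ); rewrite dotvZl (enorm_dotv1 nu1) mulr1.
Qed.

Lemma depth_eball_ge r : eball r `<=` Q -> 0 <= r -> r <= depth 0.
Proof.
move=> Qr r0; have [nu nu1 ->] := depth_attained 0.
by rewrite dotv0l subr0; exact: support_fun_eball_ge.
Qed.

End NonemptySphere.

(* On the segment from the origin to y the depth decreases from at least r to a negative
   value; where it meets the line (1 - s) r / 2, the inner ball is too small for the
   normal at its contact point not to separate y from Q. *)
Lemma regular_separation r y : eball r `<=` Q -> 0 < r -> ~ Q y ->
  exists2 nu, regular_normal Q nu & support_fun Q nu < dotv y nu.
Proof.
move=> Qr r0 nQy; have S0 : @sphere R n !=set0.
  by have [nu nu1 _] := separation cQ vQ Q0 nQy; exists nu.
pose f (s : R) : R := depth (s *: y) - (1 - s) * (r / 2).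
have cf : continuous f.
  have c_line : continuous (fun s : R => s *: y).
    by apply: (@continuous_scale R R); [exact: continuous_id|exact: cst_continuous].
  have c_lin : continuous (fun s : R => (1 - s) * (r / 2)).
    apply: (@continuous_scale R _ R^o); last exact: cst_continuous.
    by apply: (@continuous_sub R _ R^o); [exact: cst_continuous|exact: continuous_id].
  apply: (@continuous_sub R _ R^o) c_lin => s.
  exact: (continuous_comp (c_line s) (@continuous_depth S0 _)).
have f0 : 0 < f 0 by rewrite /f scale0r; have := depth_eball_ge S0 Qr (ltW r0); lra.
have f1 : f 1 < 0 by rewrite /f scale1r subrr mul0r subr0; exact: depth_lt0.
have [s /andP[s0 s1] fs] : exists2 s, 0 <= s <= 1 & f s = 0.
  have [|s sP fs] := @IVT R f 0 1 0 ler01 (continuous_subspaceT cf).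
    by rewrite ge_min le_max (ltW f0) (ltW f1) orbT.
  by exists s; rewrite // -in_itv.
have {}s1 : s < 1 by rewrite lt_neqAle s1 andbT; apply: contraTneq f1 => <-; rewrite fs ltxx.
have rs : 0 < (1 - s) * r by rewrite mulr_gt0// subr_gt0.
have depth_sy : 0 < depth (s *: y) by move: fs; rewrite /f; lra.
have [nu rnu nuE] := regular_normal_depth S0 depth_sy.
exists nu => //; rewrite ltNge; apply/negP => y_le; have [nu1 _] := rnu.
have := support_fun_eball_ge Qr (ltW r0) nu1; rewrite -(ler_pM2l (_ : 0 < 1 - s)) ?subr_gt0//.
have : s * dotv y nu <= s * support_fun Q nu by rewrite ler_wpM2l.
by move: nuE fs; rewrite /f dotvZl; lra.
Qed.

End InnerDepth.

Section Halfspaces.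
Variables (R : realType) (n m : nat) (A : 'M[R]_(m, n)) (b : 'rV[R]_m).
Implicit Types (x y d : 'rV[R]_n).

Definition slack x : 'rV[R]_m := b - x *m A^T.

Local Notation Q := [set x | forall i, 0 <= slack x 0 i].
Hypotheses (cQ : compact Q) (Q0 : Q !=set0).

Lemma slackD x d (t : R) : slack (x + t *: d) = slack x + t *: - (d *m A^T).
Proof. by rewrite /slack mulmxDl -scalemxAl opprD addrA scalerN. Qed.

Lemma slack_convex x y (t : R) :
  slack (t *: x + (1 - t) *: y) = t *: slack x + (1 - t) *: slack y.
Proof. by rewrite /slack mulmxDl -!scalemxAl; apply/rowP => i; rewrite !mxE; ring. Qed.

Lemma convex_slack : convex_set Q.
Proof.
move=> x y t Qx Qy /andP[t0 t1] i; rewrite slack_convex mxE [X in X + _]mxE [X in _ + X]mxE.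
by apply: addr_ge0; apply: mulr_ge0; rewrite ?subr_ge0//.
Qed.

Lemma ex_slack_decrease x d : Q x -> d != 0 -> exists i, (- (d *m A^T)) 0 i < 0.
Proof.
move=> Qx d0; apply: contrapT => nonneg; have [B B0 QB] := compact_enorm_le cQ.
have d_gt0 : 0 < enorm d by rewrite enorm_gt0.
pose t := (B + enorm x + 1) / enorm d.
have t0 : 0 <= t by rewrite divr_ge0 ?addr_ge0 ?enorm_ge0// ltW.
have Qt : Q (x + t *: d).
  move=> i; rewrite slackD mxE addr_ge0// mxE mulr_ge0// leNgt.
  by apply/negP => di; apply: nonneg; exists i.
have td : t * enorm d = B + enorm x + 1 by rewrite divfK// gt_eqF.
have := ler_enormD (x + t *: d) (- x); rewrite addrAC subrr add0r enormN enormZ ger0_norm// td.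
by have := QB _ Qt; lra.
Qed.

Lemma ex_boundary_step x d : Q x -> d != 0 ->
  supported_in (carrier (slack x)) (- (d *m A^T)) -> exists2 t, 0 < t &
    Q (x + t *: d) /\ (#|carrier (slack (x + t *: d))| < #|carrier (slack x)|)%N.
Proof.
move=> Qx d0 d_supp.
have [t [i [t0 di ti Qt]]] := ratio_test Qx (ex_slack_decrease Qx d0).
have xi : slack x 0 i != 0 by apply: contraTneq di => xi; rewrite d_supp ?ltxx// inE xi eqxx.
have {}t0 : 0 < t.
  by rewrite lt0r t0 andbT; apply: contraNneq xi => t_eq0; rewrite -ti t_eq0 scale0r addr0.
exists t => //; rewrite -slackD in ti Qt; split=> //.
apply: proper_card; apply/properP; split; last first.
  by exists i; rewrite !inE// ti eqxx.
apply/fintype.subsetP => i'; rewrite !inE slackD; apply: contraNN => /eqP xi'.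
by rewrite mxE xi' mxE d_supp ?mulr0 ?addr0// inE xi' eqxx.
Qed.

Definition vertex x := Q x /\ forall d, supported_in (carrier (slack x)) (- (d *m A^T)) -> d = 0.

Lemma vertex_carrier_inj x y :
  vertex x -> vertex y -> carrier (slack x) = carrier (slack y) -> x = y.
Proof.
move=> [_ x_ext] _ xy; apply/eqP; rewrite -subr_eq0; apply/eqP/x_ext => i xi.
have -> : - ((x - y) *m A^T) = slack x - slack y.
  by rewrite mulmxBl opprB /slack opprB [RHS]addrC subrKA.
have := xi; rewrite xy => yi; move: xi yi; rewrite !inE !negbK => /eqP xi /eqP yi.
by rewrite mxE xi mxE yi subrr.
Qed.

Lemma ex_vertices : exists k (V : 'M[R]_(k, n)),
  (forall i, Q (row i V)) /\ forall x, vertex x -> exists i, x = row i V.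
Proof.
have [q Qq] := Q0.
have /choice[v vP] (S : {set 'I_m}) : exists v, Q v /\
    forall x, vertex x -> carrier (slack x) = S -> x = v.
  have [[v vv vS]|none] := pselect (exists2 v, vertex v & carrier (slack v) = S).
    by exists v; split=> [|x xv xS]; [case: vv|apply: vertex_carrier_inj; rewrite // vS].
  by exists q; split=> // x xv xS; case: none; exists x.
exists #|{set 'I_m}|, (\matrix_i v (enum_val i)); split=> [i|x xv].
  by rewrite rowK; case: (vP (enum_val i)).
exists (enum_rank (carrier (slack x))); rewrite rowK enum_rankK.
by case: (vP (carrier (slack x))) => _; exact.
Qed.

Lemma polytope_halfspaces : polytope Q.
Proof.
have [k [V [QV vertexV]]] := ex_vertices.
apply/polytopeP; exists k, V; apply/seteqP; split; last exact: hull_sub convex_slack QV.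
move=> x; have [N] := ubnP #|carrier (slack x)|; elim: N x => // N IH x xN Qx.
have [/vertexV[i ->]|not_vertex] := pselect (vertex x); first exact: row_hull.
have [d d_supp d0] : exists2 d, supported_in (carrier (slack x)) (- (d *m A^T)) & d != 0.
  apply: contrapT => none; apply: not_vertex; split=> // d d_supp; apply/eqP.
  by apply: contrapT => /negP d0; apply: none; exists d.
have dN_supp : supported_in (carrier (slack x)) (- (- d *m A^T)).
  by move=> i /d_supp; rewrite mulNmx opprK mxE => /eqP; rewrite oppr_eq0 => /eqP.
have dN0 : - d != 0 by rewrite oppr_eq0.
have [t t0 [Qt lt_t]] := ex_boundary_step Qx d0 d_supp.
have [s s0 [Qs lt_s]] := ex_boundary_step Qx dN0 dN_supp.
have ts0 : 0 < t + s by rewrite addr_gt0.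
have -> : x = (s / (t + s)) *: (x + t *: d) + (1 - s / (t + s)) *: (x + s *: - d).
  by apply/rowP => i; rewrite !mxE; field; rewrite gt_eqF.
apply: convex_hull.
- by apply: IH Qt; exact: leq_trans lt_t xN.
- by apply: IH Qs; exact: leq_trans lt_s xN.
- by rewrite divr_ge0 ?(ltW s0) ?(ltW ts0)//= ler_pdivrMr// mul1r lerDr ltW.
Qed.

End Halfspaces.

(** * Transfer between the two bodies *)

Lemma symmetric_eball_sub (R : realType) n (K : set 'rV[R]_n) :
  convex_set K -> origin_symmetric K -> K° !=set0 -> exists2 rho : R, 0 < rho & eball rho `<=` K.
Proof.
move=> vK sK [x]; rewrite /interior /= => /nbhs_ballP[d /= d0 dK].
have d20 : 0 < d / 2 by rewrite divr_gt0.
have near_x z : enorm z <= d / 2 -> K (x + z).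
  move=> zd; apply: dK; apply/mx_ballP; split => // i i'.
  rewrite !mxE opprD addrA subrr sub0r normrN ord1.
  apply: (le_lt_trans (coord_le_norm z i')); apply: (le_lt_trans (norm_le_enorm z)).
  by apply: (le_lt_trans zd); lra.
exists (d / 2) => // b bd; have Kxb := near_x _ bd.
have Kbx : K (- (x - b)) by apply: sK; apply: near_x; rewrite enormN.
have := vK _ _ 2^-1 Kxb Kbx.
rewrite (_ : 2^-1 *: (x + b) + (1 - 2^-1) *: - (x - b) = b); first by apply; lra.
by apply/rowP => i; rewrite !mxE; field.
Qed.

Lemma volk_proj (R : realType) k n (X : set 'rV[R]_n) (B : 'M[R]_(k, n)) (A : 'M[R]_n) :
  compact X -> orthonormal B -> (B == A)%MS -> volk B (proj X A) = vol R k (shadow X B).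
Proof.
move=> cX BB /eqmxP BA; rewrite /volk -volnE; last exact: measurable_shadow.
have kerE (y : 'rV[R]_n) : (y *m A^T == 0) = (y *m B^T == 0).
  have /submxP[D AE] : (A <= B)%MS by rewrite BA.
  have /submxP[D' BE] : (B <= A)%MS by rewrite BA.
  apply/eqP/eqP => y0; first by rewrite BE trmx_mul mulmxA y0 mul0mx.
  by rewrite AE trmx_mul mulmxA y0 mul0mx.
congr voln; apply/seteqP; split => z /=.
  move=> [_ [x [Xx /eqP]]]; rewrite kerE mulmxBl -mulmxA BB mulmx1 subr_eq0 => /eqP xz.
  by exists x.
move=> [x Xx <-]; split; first by rewrite -BA submxMl.
exists x; split=> //; apply/eqP.
by rewrite kerE mulmxBl -[_ *m B *m _]mulmxA BB mulmx1 subrr.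
Qed.

Lemma jprojection_complementary_shadows (R : realType) n j (P Q : set 'rV[R]_n) : (j <= n)%N ->
  compact P -> compact Q -> jprojection_body j P Q -> complementary_shadows (n - j) j P Q.
Proof.
move=> jn cP cQ PQ W U fr; have [WW UU _] := fr.
have nE : n = (j + (n - j))%N by rewrite subnKC.
have WE : (W == W^T *m W)%MS.
  by rewrite submxMl andbT; apply/submxP; exists W; rewrite mulmxA WW mul1mx.
have UE := frame_perp nE (frameC fr) WE.
have rE : \rank (W^T *m W) = (n - j)%N by have /eqmxP <- := WE; exact: orthonormal_rank.
by rewrite -(volk_proj cP UU UE) -(volk_proj cQ WW WE); exact: PQ.
Qed.

Lemma polytope_complementary_shadows (R : realType) q l n (P Q : set 'rV[R]_n) :
  n = (q + (2 + l))%N -> polytope P -> compact P -> compact Q -> convex_set Q ->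
  origin_symmetric Q -> Q° !=set0 -> complementary_shadows q.+1 l.+1 P Q -> polytope Q.
Proof.
move=> nE /polytopeP[k [V ->]] cP cQ vQ sQ iQ PQ.
have [r r0 Qr] := symmetric_eball_sub vQ sQ iQ.
have Q0 : Q !=set0 by exists 0; apply: Qr; rewrite /eball /= enorm0 ltW.
have /finite_seqP[s sE] := finite_regular_normal cP cQ vQ PQ nE.
pose A : 'M[R]_(size s, n) := \matrix_(i < size s) s`_i.
pose b : 'rV[R]_(size s) := \row_i support_fun Q s`_i.
have slackE x (i : 'I_(size s)) : slack A b x 0 i = support_fun Q s`_i - dotv x s`_i.
  by rewrite !mxE dotvE; congr (_ - _); apply: eq_bigr => l' _; rewrite !mxE.
suff QE : Q = [set x | forall i, 0 <= slack A b x 0 i].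
  by rewrite QE in cQ Q0 *; exact: polytope_halfspaces.
apply/seteqP; split=> x.
  by move=> Qx i; rewrite slackE subr_ge0; exact: support_fun_ge.
move=> x_slack; apply: contrapT => nQx.
have [nu rnu] := regular_separation cQ vQ Q0 Qr r0 nQx.
have /= nu_s : [set` s] nu by rewrite -sE.
have i_lt : (index nu s < size s)%N by rewrite index_mem.
have := x_slack (Ordinal i_lt); rewrite slackE /= nth_index// subr_ge0 => x_le.
by rewrite ltNge x_le.
Qed.

Lemma has_face_parallel_eqmx (R : realType) n (K : set 'rV[R]_n) k (F F' : 'M[R]_n) :
  (F == F')%MS -> has_face_parallel K k F -> has_face_parallel K k F'.
Proof.
move=> /eqmxP FF [u [KF [M [/eqmxP MF Md]]]]; exists u; split.
  by move=> x y fx fy; rewrite -FF; exact: KF.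
by exists M; split=> //; apply/eqmxP; exact: eqmx_trans FF.
Qed.

Lemma bin_mul_swap m j : (j.+1 * 'C(m + j.+1, j.+1) = m.+1 * 'C(m + j.+1, m.+1))%N.
Proof.
rewrite -!mul_bin_diag addnS /=; congr (_ * _)%N.
by rewrite -[in RHS]bin_sub ?leq_addr// addKn.
Qed.

Section ComplementaryBodies.
Variables (R : realType) (m j n : nat) (P Q : set 'rV[R]_n).
Hypotheses (nE : n = (m.+1 + j.+1)%N) (PQ : complementary_shadows m.+1 j.+1 P Q).
Hypotheses (bP : convex_body P) (sP : origin_symmetric P).
Hypotheses (bQ : convex_body Q) (sQ : origin_symmetric Q).

Lemma area_measures_complementary (E : 'M[R]_n) (a b : nat -> R) :
  P° !=set0 -> Q° !=set0 -> \rank E = m.+1 ->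
  area_measures_at P (@sphere R n `&` subsp E) a ->
  area_measures_at Q (@sphere R n `&` subsp (perp E)) b ->
  a j.+1 = kappa R m.+1 / kappa R j.+1 * b m.+1.
Proof.
move=> iP iQ rE areaP areaQ; have [cP [vP _]] := bP; have [cQ [vQ _]] := bQ.
have nE' : n = (j.+1 + m.+1)%N by rewrite addnC.
have [W WW WE] := ex_orthonormal_basis rE; have [U fr] := ex_frame nE WW.
have UE := frame_perp nE' (frameC fr) WE.
have [c [aeP aeQ]] := ae_vol_face_shadow cP vP sP cQ vQ sQ PQ fr.
have [rP rP0 Pr] := symmetric_eball_sub vP sP iP.
have [rQ rQ0 Qr] := symmetric_eball_sub vQ sQ iQ.
have := area_measure_face_shadow nE fr cP vP rP0 Pr (ltn0Sn m) WE aeP areaP.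
have := area_measure_face_shadow nE' (frameC fr) cQ vQ rQ0 Qr (ltn0Sn j) UE aeQ areaQ.
have -> : n.-1 = (m + j.+1)%N by rewrite nE.
have := congr1 (fun i : nat => i%:R : R) (bin_mul_swap m j); rewrite !natrM.
have Cj0 : 0 < 'C(m + j.+1, j.+1)%:R :> R by rewrite ltr0n bin_gt0 leq_addl.
have Cm0 : 0 < 'C(m + j.+1, m.+1)%:R :> R by rewrite ltr0n bin_gt0 addnS ltnS leq_addr.
move: Cj0 Cm0; move: 'C(m + j.+1, j.+1)%:R 'C(m + j.+1, m.+1)%:R => Cj Cm Cj0 Cm0 bins bE aE.
have kj := kappa_gt0 R j.+1.
have aE' : a j.+1 = m.+1%:R * (c * kappa R m.+1) / Cj by rewrite -aE mulrC mulKf// gt_eqF.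
have bE' : b m.+1 = j.+1%:R * (c * kappa R j.+1) / Cm by rewrite -bE mulrC mulKf// gt_eqF.
have mE : m.+1%:R = j.+1%:R * Cj / Cm by rewrite bins mulfK// gt_eqF.
by rewrite aE' bE' mE; field; rewrite !gt_eqF.
Qed.

Lemma has_face_parallel_perp_iff (F : 'M[R]_n) : polytope P -> polytope Q -> \rank F = j.+1 ->
  has_face_parallel P j.+1 F <-> has_face_parallel Q m.+1 (perp F).
Proof.
move=> pP pQ rF; have [cP [vP P0]] := bP; have [cQ [vQ Q0]] := bQ.
have nE' : n = (j.+1 + m.+1)%N by rewrite addnC.
split; first exact: (has_face_parallel_perp nE pP).
have [U UU UF] := ex_orthonormal_basis rF; have [W /frameC fr] := ex_frame nE' UU.
have WF := frame_perp nE fr UF; have /eqmxP UFF := frame_perp nE' (frameC fr) WF.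
have rW : \rank (perp F) = m.+1.
  by have /eqmxP <- := WF; case: fr => WW _ _; exact: orthonormal_rank.
have QP := complementary_shadowsC PQ.
move=> /(has_face_parallel_perp nE' pQ cQ vQ Q0 sQ cP vP P0 sP QP rW).
by apply: has_face_parallel_eqmx; apply/eqmxP/(eqmx_trans (eqmx_sym UFF)); exact/eqmxP.
Qed.

End ComplementaryBodies.

Unset Implicit Arguments.

Theorem theorem5p3 (R : realType) (n j : nat) (P Q : set 'rV[R]_n) :
  (3 <= n)%N -> (1 <= j <= n - 1)%N ->
  convex_body P -> convex_body Q ->
  origin_symmetric P -> origin_symmetric Q ->
  (interior P) !=set0 -> (interior Q) !=set0 ->
  jprojection_body j P Q ->
  (forall E : 'M[R]_n, \rank E = (n - j)%N ->
     forall cP cQ : nat -> R,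
       area_measures_at P (@sphere R n `&` subsp E) cP ->
       area_measures_at Q (@sphere R n `&` subsp (perp E)) cQ ->
       cP j = kappa R (n - j) / kappa R j * cQ (n - j)%N)
  /\
  (polytope P ->
     polytope Q /\
     forall F : 'M[R]_n, \rank F = j ->
       (has_face_parallel P j F <-> has_face_parallel Q (n - j) (perp F))).
Proof.
move=> n3 /andP[j1 jn1] bP bQ sP sQ iP iQ jPQ; have [cP _] := bP; have [cQ [vQ _]] := bQ.
have jn : (j < n)%N by lia.
have PQ := jprojection_complementary_shadows (ltnW jn) cP cQ jPQ.
have : n = (n - j + j)%N by rewrite subnK// ltnW.
have : (0 < n - j)%N by rewrite subn_gt0.
move: (n - j)%N PQ {jn jn1 jPQ} => [//|m] PQ _ nE; case: j j1 nE PQ => // j _ nE PQ.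
split=> [E rE cP' cQ'|pP]; first exact: (area_measures_complementary nE PQ bP sP bQ sQ iP iQ rE).
have nE' : n = (m + (2 + j))%N by rewrite nE; lia.
have pQ : polytope Q by exact: (polytope_complementary_shadows nE' pP cP cQ vQ sQ iQ PQ).
by split=> // F rF; exact: (has_face_parallel_perp_iff nE PQ bP sP bQ sQ pP pQ rF).
Qed.
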